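(* Let $\Gamma$ be a subgroup of translations of $\mathcal A\simeq\mathbb R^2$ generated by two translations $\tau_1:a\mapsto a+(s_1,t_1)$ and $\tau_2:a\mapsto a+(s_2,t_2)$ by linearly independent vectors, such that $s_1\mathbb Z+s_2\mathbb Z=S\,\mathbb Z$ and $t_1\mathbb Z+t_2\mathbb Z=T\,\mathbb Z$ for some positive numbers $S,T$. Let $g:\mathcal A\to S^3_{\mathcal A}$ be a conformal map such that $$g'g^{-1}=\cos\psi\ J+\sin\psi\ K$$ for some conformal map $\psi:\mathcal A\to\mathcal A$. Write $g=\frac{1+\sigma}2g_1+\frac{1-\sigma}2g_2$ with $g_1=g_1(s)$ and $g_2=g_2(t)\in S^3\subset\mathbb H$, and assume that one of the following two conditions holds: (1) $g_1$ and $g_2$ are periodic curves with period $S$ and $T$ respectively; (2) $g_1(s+kS)=(-1)^kg_1(s)$ and $g_2(t+kT)=(-1)^kg_2(t)$ for all $s,t\in\mathbb R$ and $k\in\mathbb Z$, and $\Gamma\subset\{(mS,nT):\ m,n\in\mathbb Z,\ m\equiv n\ [2]\}$. Writing $\psi=\theta_1+\sigma\theta_2$ with $\theta_1,\theta_2:\mathcal A\to\mathbb R$, assume moreover that $\theta_2$ takes its values in $(\pi/2,\pi)$ modulo $\pi$. Then the formula $$F=\sigma\,\overline g\,\hat g\ \in\ S^3\subset\mathbb R^4\subset\mathbb H^{\mathcal A}$$ defines a flat torus immersed in $S^3$ (an immersion of $\mathcal A/\Gamma$ in $S^3$ with flat induced metric). Conversely, every flat torus immersed in $S^3$ is of tha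t form.
   Context: $\mathcal A=\{x+\sigma y:\ x,y\in\mathbb R\}$ is the algebra of Lorentz numbers, $\sigma^2=1$, with conjugation $\overline{x+\sigma y}=x-\sigma y$; $\cos,\sin$ on $\mathcal A$ are defined by the usual power series. Coordinates $(s,t)$ on $\mathcal A$ are defined by $x+\sigma y=\frac{1+\sigma}2s+\frac{1-\sigma}2t$; pairs such as $(s_1,t_1)$ denote elements of $\mathcal A$ in these coordinates, and translations are identified with their vectors. $\mathbb H^{\mathcal A}=\{\xi=a_01+a_1I+a_2J+a_3K:\ a_i\in\mathcal A\}$ are the quaternions with coefficients in $\mathcal A$ ($I^2=J^2=K^2=-1$, $IJ=-JI=K$), $\overline\xi=a_01-a_1I-a_2J-a_3K$, $\hat\xi=\overline{a_0}1+\overline{a_1}I+\overline{a_2}J+\overline{a_3}K$, $H(\xi,\xi)=\sum_ia_i^2\in\mathcal A$, $S^3_{\mathcal A}=\{\xi\in\mathbb H^{\mathcal A}:H(\xi,\xi)=1\}$. $\mathbb H$ denotes the usual quaternions and $S^3\subset\mathbb H$ the unit sphere; every $\xi\in\mathbb H^{\mathcal A}$ is uniquely $\frac{1+\sigma}2\xi_++\frac{1-\sigma}2\xi_-$ with $\xi_\pm\in\mathbb H$. $\mathbb R^4$ is identified with $\{\sigma x_01+x_1I+x_2J+x_3K:\ x_i\in\mathbb R\}\subset\mathbb H^{\mathcal A}$ with its Euclidean metric, the restriction of $H$. A smooth map $f$ from $\mathcal A$ to $\mathcal A$ or $\mathbb H^{\mathcal A}\simeq\mathcal A^4$ is conformal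 if $\partial_yf=\sigma\,\partial_xf$; then $df=f'(dx+\sigma dy)$. For a conformal $g$, the components $g_1$ and $g_2$ depend only on $s$ and only on $t$ respectively. *)

(* Defs.v *)
From Stdlib Require Import Reals ZArith Lra.
From Coquelicot Require Import Coquelicot.

Open Scope R_scope.

Inductive axis := ax | ay.

Definition partial (i : axis) (f : R * R -> R) (p : R * R) : R :=
  match i with
  | ax => Derive (fun u => f (u, snd p)) (fst p)
  | ay => Derive (fun v => f (fst p, v)) (snd p)
  end.

Definition ex_partial (i : axis) (f : R * R -> R) (p : R * R) : Prop :=
  match i with
  | ax => ex_derive (fun u => f (u, snd p)) (fst p)
  | ay => ex_derive (fun v => f (fst p, v)) (snd p)
  end.

Fixpoint Ck (k : nat) (f : R * R -> R) : Prop :=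
  match k with
  | O => forall p, continuous f p
  | S k' => (forall i p, ex_partial i f p) /\ (forall i, Ck k' (partial i f))
  end.

Definition smooth (f : R * R -> R) : Prop := forall k, Ck k f.

(* The pair [(x, y)] stands for [x + sigma y]; the identification of the
   algebra with the real plane is therefore definitional. *)
Definition lorentz : Type := (R * R)%type.

Definition Lreal (x : R) : lorentz := (x, 0).
Definition Lsigma : lorentz := (0, 1).
Definition Ladd (a b : lorentz) : lorentz := (fst a + fst b, snd a + snd b).
Definition Lopp (a : lorentz) : lorentz := (- fst a, - snd a).
Definition Lsub (a b : lorentz) : lorentz := Ladd a (Lopp b).
Definition Lmul (a b : lorentz) : lorentz :=
  (fst a * fst b + snd a * snd b, fst a * snd b + snd a * fst b).
Definition Lscal (r : R) (a : lorentz) : lorentz := (r * fst a, r * snd a).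
Definition Lconj (a : lorentz) : lorentz := (fst a, - snd a).

(* Meaningful only when [a * conj a = x^2 - y^2] does not vanish. *)
Definition Linv (a : lorentz) : lorentz :=
  Lscal (/ (fst a ^ 2 - snd a ^ 2)) (Lconj a).

Fixpoint Lpow (a : lorentz) (n : nat) : lorentz :=
  match n with
  | O => Lreal 1
  | S n' => Lmul a (Lpow a n')
  end.

(* Convergence in the two-dimensional real algebra is convergence of both
   real components. *)
Definition Lseries (u : nat -> lorentz) : lorentz :=
  (Series (fun n => fst (u n)), Series (fun n => snd (u n))).

Definition Lcos (a : lorentz) : lorentz :=
  Lseries (fun n => Lscal ((-1) ^ n / INR (fact (2 * n))) (Lpow a (2 * n))).
Definition Lsin (a : lorentz) : lorentz :=
  Lseries (fun n =>
    Lscal ((-1) ^ n / INR (fact (2 * n + 1))) (Lpow a (2 * n + 1))).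

(* [st s t] is [(1 + sigma)/2 s + (1 - sigma)/2 t]. *)
Definition st (s t : R) : lorentz :=
  Ladd (Lmul (/ 2, / 2) (Lreal s)) (Lmul (/ 2, - / 2) (Lreal t)).

Definition Lpartial (i : axis) (f : lorentz -> lorentz) (a : lorentz)
  : lorentz :=
  (partial i (fun b => fst (f b)) a, partial i (fun b => snd (f b)) a).

Definition Lsmooth (f : lorentz -> lorentz) : Prop :=
  smooth (fun a => fst (f a)) /\ smooth (fun a => snd (f a)).

Definition conformal (f : lorentz -> lorentz) : Prop :=
  Lsmooth f /\ forall a, Lpartial ay f a = Lmul Lsigma (Lpartial ax f a).

(* For conformal [f], [df = f' (dx + sigma dy)] forces [f' = d f / d x]. *)
Definition Lderive (f : lorentz -> lorentz) : lorentz -> lorentz :=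
  Lpartial ax f.

Record quat (K : Type) := Quat { q0 : K; q1 : K; q2 : K; q3 : K }.
Arguments Quat {K}.
Arguments q0 {K}.
Arguments q1 {K}.
Arguments q2 {K}.
Arguments q3 {K}.

Definition qmap {K L : Type} (f : K -> L) (x : quat K) : quat L :=
  Quat (f (q0 x)) (f (q1 x)) (f (q2 x)) (f (q3 x)).
Definition qmap2 {K L M : Type} (f : K -> L -> M) (x : quat K) (y : quat L)
  : quat M :=
  Quat (f (q0 x) (q0 y)) (f (q1 x) (q1 y)) (f (q2 x) (q2 y)) (f (q3 x) (q3 y)).

(* [quat R] serves both as the real quaternions and as Euclidean R^4. *)
Definition qdot (x y : quat R) : R :=
  q0 x * q0 y + q1 x * q1 y + q2 x * q2 y + q3 x * q3 y.

Definition S3 (x : quat R) : Prop := qdot x x = 1.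

Definition HL : Type := quat lorentz.

Definition Hadd (x y : HL) : HL := qmap2 Ladd x y.
Definition Hscal (a : lorentz) (x : HL) : HL := qmap (Lmul a) x.
Definition Hmul (x y : HL) : HL :=
  Quat
    (Lsub (Lsub (Lsub (Lmul (q0 x) (q0 y)) (Lmul (q1 x) (q1 y)))
                (Lmul (q2 x) (q2 y))) (Lmul (q3 x) (q3 y)))
    (Lsub (Ladd (Ladd (Lmul (q0 x) (q1 y)) (Lmul (q1 x) (q0 y)))
                (Lmul (q2 x) (q3 y))) (Lmul (q3 x) (q2 y)))
    (Ladd (Ladd (Lsub (Lmul (q0 x) (q2 y)) (Lmul (q1 x) (q3 y)))
                (Lmul (q2 x) (q0 y))) (Lmul (q3 x) (q1 y)))
    (Ladd (Lsub (Ladd (Lmul (q0 x) (q3 y)) (Lmul (q1 x) (q2 y)))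
                (Lmul (q2 x) (q1 y))) (Lmul (q3 x) (q0 y))).

Definition Hone : HL := Quat (Lreal 1) (Lreal 0) (Lreal 0) (Lreal 0).
Definition HI : HL := Quat (Lreal 0) (Lreal 1) (Lreal 0) (Lreal 0).
Definition HJ : HL := Quat (Lreal 0) (Lreal 0) (Lreal 1) (Lreal 0).
Definition HK : HL := Quat (Lreal 0) (Lreal 0) (Lreal 0) (Lreal 1).

Definition Hbar (x : HL) : HL :=
  Quat (q0 x) (Lopp (q1 x)) (Lopp (q2 x)) (Lopp (q3 x)).
Definition Hhat (x : HL) : HL := qmap Lconj x.
Definition Hform (x y : HL) : lorentz :=
  Ladd (Ladd (Ladd (Lmul (q0 x) (q0 y)) (Lmul (q1 x) (q1 y)))
             (Lmul (q2 x) (q2 y))) (Lmul (q3 x) (q3 y)).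

(* Meaningful only when [Hform x x] is a unit; see [Hmul_inv]. *)
Definition Hinv (x : HL) : HL := Hscal (Linv (Hform x x)) (Hbar x).

Definition S3L (x : HL) : Prop := Hform x x = Lreal 1.

Definition Hconformal (g : lorentz -> HL) : Prop :=
  conformal (fun a => q0 (g a)) /\ conformal (fun a => q1 (g a)) /\
  conformal (fun a => q2 (g a)) /\ conformal (fun a => q3 (g a)).

Definition Hderive (g : lorentz -> HL) (a : lorentz) : HL :=
  Quat (Lderive (fun b => q0 (g b)) a) (Lderive (fun b => q1 (g b)) a)
       (Lderive (fun b => q2 (g b)) a) (Lderive (fun b => q3 (g b)) a).

(* R^4 sits in the quaternions over the Lorentz numbers as
   [sigma x0 + x1 I + x2 J + x3 K]; see [Hform_R4]. *)
Definition R4_HL (x : quat R) : HL :=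
  Quat (Lmul Lsigma (Lreal (q0 x)))
       (Lreal (q1 x)) (Lreal (q2 x)) (Lreal (q3 x)).

Lemma Hmul_units :
  Hmul HI HI = Hscal (Lreal (-1)) Hone /\
  Hmul HJ HJ = Hscal (Lreal (-1)) Hone /\
  Hmul HK HK = Hscal (Lreal (-1)) Hone /\
  Hmul HI HJ = HK /\ Hmul HJ HI = Hscal (Lreal (-1)) HK.
Proof.
  unfold Hmul, HI, HJ, HK, Hone, Hscal, Lreal, Lsub, Lopp, Ladd, Lmul, qmap;
    simpl.
  repeat split; f_equal; apply injective_projections; simpl; ring.
Qed.

Lemma Lmul_inv (a : lorentz) :
  fst a ^ 2 - snd a ^ 2 <> 0 -> Lmul (Linv a) a = Lreal 1.
Proof.
  destruct a as [x y]; unfold Linv, Lmul, Lscal, Lconj, Lreal; simpl; intros h.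
  apply injective_projections; simpl; field; contradict h; rewrite <- h; ring.
Qed.

Lemma Hmul_inv (x : HL) :
  fst (Hform x x) ^ 2 - snd (Hform x x) ^ 2 <> 0 ->
  Hmul x (Hinv x) = Hone /\ Hmul (Hinv x) x = Hone.
Proof.
  intros h; apply Lmul_inv in h.
  assert (e : Hscal (Lmul (Linv (Hform x x)) (Hform x x)) Hone = Hone).
  { rewrite h; unfold Hscal, Hone, qmap, Lmul, Lreal; simpl.
    f_equal; apply injective_projections; simpl; ring. }
  unfold Hinv; rewrite <- e; clear h e.
  generalize (Linv (Hform x x)); intros [c c'].
  destruct x as [[x0 y0] [x1 y1] [x2 y2] [x3 y3]].
  unfold Hmul, Hone, Hform, Hscal, Hbar, Lreal, Lsub, Lopp, Ladd, Lmul, qmap;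
    simpl.
  split; f_equal; apply injective_projections; simpl; ring.
Qed.

Lemma Hform_R4 (x y : quat R) : Hform (R4_HL x) (R4_HL y) = Lreal (qdot x y).
Proof.
  unfold Hform, R4_HL, Lreal, qdot, Ladd, Lmul, Lsigma; simpl; f_equal; ring.
Qed.

Definition smooth4 (F : R * R -> quat R) : Prop :=
  smooth (fun p => q0 (F p)) /\ smooth (fun p => q1 (F p)) /\
  smooth (fun p => q2 (F p)) /\ smooth (fun p => q3 (F p)).

Definition partial4 (i : axis) (F : R * R -> quat R) (p : R * R) : quat R :=
  Quat (partial i (fun r => q0 (F r)) p) (partial i (fun r => q1 (F r)) p)
       (partial i (fun r => q2 (F r)) p) (partial i (fun r => q3 (F r)) p).

Definition immersion (F : R * R -> quat R) : Prop :=
  forall p (a b : R),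
    qmap2 (fun u v => a * u + b * v) (partial4 ax F p) (partial4 ay F p)
      = Quat 0 0 0 0 ->
    a = 0 /\ b = 0.

Definition metric_field : Type := axis -> axis -> R * R -> R.

Definition induced_metric (F : R * R -> quat R) : metric_field :=
  fun i j p => qdot (partial4 i F p) (partial4 j F p).

Definition metric_det (h : metric_field) (p : R * R) : R :=
  h ax ax p * h ay ay p - h ax ay p * h ay ax p.

Definition metric_inv (h : metric_field) : metric_field :=
  fun i j p =>
    match i, j with
    | ax, ax => h ay ay p
    | ay, ay => h ax ax p
    | ax, ay => - h ax ay p
    | ay, ax => - h ay ax p
    end / metric_det h p.

Definition sum_axis (f : axis -> R) : R := f ax + f ay.

(* [christoffel h k i j] has upper index [k]. *)
Definition christoffel (h : metric_field) (k i j : axis) (p : R * R) : R :=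
  / 2 * sum_axis (fun l =>
    metric_inv h k l p *
      (partial i (h j l) p + partial j (h i l) p - partial l (h i j) p)).

(* [riemann h l k i j] is the coefficient of [d_l] in [R(d_i, d_j) d_k]. *)
Definition riemann (h : metric_field) (l k i j : axis) (p : R * R) : R :=
  partial i (christoffel h l j k) p - partial j (christoffel h l i k) p
  + sum_axis (fun m =>
      christoffel h l i m p * christoffel h m j k p
      - christoffel h l j m p * christoffel h m i k p).

Definition flat (h : metric_field) : Prop :=
  forall l k i j p, riemann h l k i j p = 0.

Definition lin_indep (v w : R * R) : Prop :=
  forall a b : R, Ladd (Lscal a v) (Lscal b w) = (0, 0) -> a = 0 /\ b = 0.

Definition lattice (v w : R * R) (u : R * R) : Prop :=
  exists m n : Z, u = Ladd (Lscal (IZR m) v) (Lscal (IZR n) w).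

(* An immersion of the torus [R^2 / (Z v + Z w)] is represented by its lift to
   the universal cover. *)
Record flat_torus_in_S3 (v w : R * R) (F : R * R -> quat R) : Prop := {
  ft_basis : lin_indep v w;
  ft_smooth : smooth4 F;
  ft_sphere : forall p, S3 (F p);
  ft_periodic : forall p u, lattice v w u -> F (Ladd p u) = F p;
  ft_immersion : immersion F;
  ft_flat : flat (induced_metric F)
}.

Definition diffeo (phi : R * R -> R * R) : Prop :=
  Lsmooth phi /\
  exists phi' : R * R -> R * R,
    Lsmooth phi' /\ (forall p, phi' (phi p) = p) /\ (forall p, phi (phi' p) = p).

(* A diffeomorphism of tori [R^2 / (Z v + Z w) -> R^2 / (Z v' + Z w')], lifted
   to universal covers. *)
Definition torus_diffeo (v w v' w' : R * R) (phi : R * R -> R * R) : Prop :=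
  diffeo phi /\
  forall p q, lattice v w (Lsub q p) <-> lattice v' w' (Lsub (phi q) (phi p)).

Definition cyclic_span (r1 r2 r : R) : Prop :=
  forall x, (exists m n : Z, x = IZR m * r1 + IZR n * r2) <->
            (exists k : Z, x = IZR k * r).

Definition antiperiodic_case (s1 t1 s2 t2 S T : R) (g1 g2 : R -> quat R)
  : Prop :=
  (forall (k : Z) s, g1 (s + IZR k * S) = qmap (Rmult (powerRZ (-1) k)) (g1 s)) /\
  (forall (k : Z) t, g2 (t + IZR k * T) = qmap (Rmult (powerRZ (-1) k)) (g2 t)) /\
  (forall u, lattice (st s1 t1) (st s2 t2) u ->
     exists m n : Z, u = st (IZR m * S) (IZR n * T) /\ (2 | m - n)%Z).

Record torus_data (s1 t1 s2 t2 S T : R) (g : lorentz -> HL)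
    (psi : lorentz -> lorentz) (g1 g2 : R -> quat R) : Prop := {
  td_indep : lin_indep (st s1 t1) (st s2 t2);
  td_S_pos : 0 < S;
  td_T_pos : 0 < T;
  td_S : cyclic_span s1 s2 S;
  td_T : cyclic_span t1 t2 T;
  td_g_conformal : Hconformal g;
  td_g_sphere : forall a, S3L (g a);
  td_psi_conformal : conformal psi;
  td_equation : forall a,
    Hmul (Hderive g a) (Hinv (g a))
      = Hadd (Hscal (Lcos (psi a)) HJ) (Hscal (Lsin (psi a)) HK);
  (* [qmap2 st x y] is [(1 + sigma)/2 x + (1 - sigma)/2 y]. *)
  td_split : forall s t, g (st s t) = qmap2 st (g1 s) (g2 t);
  td_g1_sphere : forall s, S3 (g1 s);
  td_g2_sphere : forall t, S3 (g2 t);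
  td_periods :
    ((forall s, g1 (s + S) = g1 s) /\ (forall t, g2 (t + T) = g2 t)) \/
    antiperiodic_case s1 t1 s2 t2 S T g1 g2;
  td_theta2 : forall a, exists k : Z,
    PI / 2 < snd (psi a) - IZR k * PI < PI
}.

Definition torus_formula (g : lorentz -> HL) (a : lorentz) : HL :=
  Hscal Lsigma (Hmul (Hbar (g a)) (Hhat (g a))).

(* Main.v *)
(* Converse.  Let N be the unit normal of the flat immersion F.  The connection
   induced on the tangent planes by the right trivialisation of S^3 is the
   Levi-Civita connection, so flatness (in the form of the Gauss equation) forces the
   Gauss map N F^-1 to have rank one; hence d(N F^-1) = 2 alpha e with |e| = 1, and
   alpha is closed.  The same holds for F^-1 N with a form beta, and alpha, beta are
   independent.  Their primitives (U, V) are asymptotic coordinates; as alpha and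
   beta are doubly periodic up to sign, (U, V) has bounded second derivatives and
   Jacobian bounded below, so it is a global diffeomorphism (Hadamard).  In these
   coordinates one Gauss map depends on s only and the other on t only, which gives
   F = conj (g1 s) * g2 t without solving any differential equation: g1 and g2 are
   translates of conj F and F along the two coordinate axes.
   Periods.  A lattice vector (a, b) yields a constant c with g1 (s + a) = c g1 s and
   g2 (t + b) = c g2 t.  Conjugation by c preserves the oriented plane of J and K
   containing both velocities, so it rotates it; since the velocity of g1 stays in a
   half-plane, the rotation is trivial and c = 1 or c = -1.  As g1 is regular, the
   projections of the lattice are then discrete, hence cyclic.
   Direct part.  In the coordinates (x, y) the induced metric is
   4 sin^2 theta dx^2 + 4 cos^2 theta dy^2, where theta = theta_2 solves the wave
   equation. *)
Require Import Defs.
From Stdlib Require Import Reals ZArith.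
From Stdlib Require Import Lra Lia FunctionalExtensionality Classical ClassicalEpsilon.
From Coquelicot Require Import Coquelicot.

Open Scope R_scope.


(** * Smooth functions of two variables *)

(** In the null coordinates [s = x + y], [t = x - y] the Lorentz numbers are the product ring
    [R x R]. A Lorentz quaternion is then a pair of real ones, [Hhat] swaps the pair, and the
    formula of the theorem reads [conj (g1 s) * g2 t]. The factor 2 in [2 alpha e] makes [U] and [V]
    arc length parameters of [g1] and [g2], so that both velocities are unit vectors. If [psi1],
    [psi2] are their angles in the [JK] plane, then [psi1 - psi2 = 2 theta_2]; the range of
    [theta_2] only fixes the orientation of the two velocities, which conjugation by [J] can
    reverse. A rank-one differential determines [alpha] up to sign. The sign is chosen smoothly by
    halving an angle function on the whole plane, and a lattice translation may still reverse it.
    Compactness of the torus supplies uniform bounds only, so the inversion theorem is run with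
    explicit constants: Newton steps converge on a radius independent of the point, and a discrete
    homotopy lifting takes the place of covering spaces. The alternatives (1) and (2) are the two
    values of one sign, shared by [g1] over [S] and [g2] over [T]. *)

(** Relational on purpose: [Derive] is total, so an equation about [partial] alone says nothing
    about differentiability. *)
Definition is_partial (i : axis) (f : R * R -> R) (p : R * R) (l : R) : Prop :=
  match i with
  | ax => is_derive (fun u => f (u, snd p)) (fst p) l
  | ay => is_derive (fun v => f (fst p, v)) (snd p) l
  end.

Lemma is_partial_ex i f p l : is_partial i f p l -> ex_partial i f p.
Proof. destruct i; intros h; exists l; exact h. Qed.

Lemma is_partial_eq i f p l : is_partial i f p l -> partial i f p = l.
Proof. destruct i; apply is_derive_unique. Qed.

Lemma ex_partial_is i f p : ex_partial i f p -> is_partial i f p (partial i f p).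
Proof. destruct i; apply Derive_correct. Qed.

Lemma continuous_2d (f : R * R -> R) (p : R * R) :
  continuous f p <-> continuity_2d_pt (fun x y => f (x, y)) (fst p) (snd p).
Proof.
  rewrite continuity_2d_pt_filterlim; unfold continuous.
  replace (fun z : R * R => f (fst z, snd z)) with f
    by (apply functional_extensionality; now intros []).
  now destruct p.
Qed.

(** The increment is split into a horizontal leg at the new height [v] and a vertical leg at the old
    abscissa [x]. The mean value theorem on each leg reduces the error to the oscillation of one
    partial derivative near the point. *)
Lemma C1_differentiable f :
  (forall i p, ex_partial i f p) -> (forall i p, continuous (partial i f) p) ->
  forall p, differentiable_pt_lim (fun x y => f (x, y)) (fst p) (snd p)
              (partial ax f p) (partial ay f p).
Proof.
  intros ex co [x y] eps; simpl fst; simpl snd.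
  assert (e2 : 0 < eps / 2) by (destruct eps; simpl; lra).
  pose proof (proj1 (continuous_2d _ _) (co ax (x, y)) (mkposreal _ e2)) as [d1 h1].
  pose proof (proj1 (continuous_2d _ _) (co ay (x, y)) (mkposreal _ e2)) as [d2 h2].
  simpl in h1, h2.
  assert (dm : 0 < Rmin d1 d2) by (apply Rmin_pos; apply cond_pos).
  exists (mkposreal _ dm); intros u v hu hv; simpl in hu, hv.
  pose proof (Rmin_l d1 d2); pose proof (Rmin_r d1 d2).
  destruct (MVT_gen (fun t => f (t, v)) x u (fun t => partial ax f (t, v))) as [c [hc e1]].
  { intros t _; exact (ex_partial_is ax f (t, v) (ex ax (t, v))). }
  { intros t _; apply derivable_continuous_pt, ex_derive_Reals_0;
      exact (ex ax (t, v)). }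
  destruct (MVT_gen (fun t => f (x, t)) y v (fun t => partial ay f (x, t))) as [c' [hc' e2']].
  { intros t _; exact (ex_partial_is ay f (x, t) (ex ay (x, t))). }
  { intros t _; apply derivable_continuous_pt, ex_derive_Reals_0;
      exact (ex ay (x, t)). }
  replace (f (u, v) - f (x, y) - (partial ax f (x, y) * (u - x) + partial ay f (x, y) * (v - y)))
    with ((partial ax f (c, v) - partial ax f (x, y)) * (u - x) +
          (partial ay f (x, c') - partial ay f (x, y)) * (v - y)) by lra.
  assert (b1 : Rabs (partial ax f (c, v) - partial ax f (x, y)) <= eps / 2).
  { left; apply h1; simpl; [|lra].
    revert hc; unfold Rmin, Rmax; destruct (Rle_dec x u); intros;
      revert hu; unfold Rabs; repeat destruct Rcase_abs; lra. }
  assert (b2 : Rabs (partial ay f (x, c') - partial ay f (x, y)) <= eps / 2).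
  { left; apply h2; simpl; [rewrite Rminus_diag, Rabs_R0; apply cond_pos|].
    revert hc'; unfold Rmin, Rmax; destruct (Rle_dec y v); intros;
      revert hv; unfold Rabs; repeat destruct Rcase_abs; lra. }
  eapply Rle_trans; [apply Rabs_triang|]; rewrite !Rabs_mult.
  pose proof (Rmax_l (Rabs (u - x)) (Rabs (v - y))).
  pose proof (Rmax_r (Rabs (u - x)) (Rabs (v - y))).
  pose proof (Rabs_pos (u - x)); pose proof (Rabs_pos (v - y)).
  pose proof (Rabs_pos (partial ax f (c, v) - partial ax f (x, y))).
  pose proof (Rabs_pos (partial ay f (x, c') - partial ay f (x, y))).
  set (M := Rmax (Rabs (u - x)) (Rabs (v - y))) in *.
  assert (Rabs (partial ax f (c, v) - partial ax f (x, y)) * Rabs (u - x) <= eps / 2 * M)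
    by (apply Rmult_le_compat; auto).
  assert (Rabs (partial ay f (x, c') - partial ay f (x, y)) * Rabs (v - y) <= eps / 2 * M)
    by (apply Rmult_le_compat; auto).
  lra.
Qed.

(** [Ck (S k)] says nothing directly about continuity of the function itself; the base case obtains
    it from differentiability in two variables. *)
Lemma Ck_S k f : Ck (S k) f -> Ck k f.
Proof.
  revert f; induction k as [|k IH]; intros f [ex h].
  - intros p; apply continuous_2d.
    eapply differentiable_continuity_pt.
    do 2 eexists; apply C1_differentiable; [exact ex | exact h].
  - split; [exact ex | intros i; apply IH, h].
Qed.

Lemma smooth_continuous f p : smooth f -> continuous f p.
Proof. intros h; exact (h O p). Qed.

Lemma smooth_ex f i p : smooth f -> ex_partial i f p.
Proof. intros h; apply (h 1%nat). Qed.

Lemma smooth_is f i p : smooth f -> is_partial i f p (partial i f p).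
Proof. intros h; apply ex_partial_is, smooth_ex, h. Qed.

Lemma smooth_partial f i : smooth f -> smooth (partial i f).
Proof. intros h k; apply (h (S k)). Qed.

Lemma Ck_differentiable k f p : Ck (S k) f ->
  differentiable_pt_lim (fun x y => f (x, y)) (fst p) (snd p)
    (partial ax f p) (partial ay f p).
Proof.
  intros [ex h]; apply C1_differentiable; [exact ex|].
  intros i; assert (H := h i); clear - H.
  induction k; [exact H | apply IHk, Ck_S, H].
Qed.

Lemma Ck_intro k f (d : axis -> R * R -> R) :
  (forall i p, is_partial i f p (d i p)) -> (forall i, Ck k (d i)) -> Ck (S k) f.
Proof.
  intros h hd; split; [intros i p; eapply is_partial_ex, h|].
  intros i; replace (partial i f) with (d i); [apply hd|].
  apply functional_extensionality; intros p; symmetry; apply is_partial_eq, h.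
Qed.

Lemma smooth_intro f (d : axis -> R * R -> R) :
  (forall i p, is_partial i f p (d i p)) -> (forall i, smooth (d i)) -> smooth f.
Proof.
  intros h hd [|k]; [apply Ck_S|]; eapply Ck_intro; eauto; intros i; apply hd.
Qed.

Lemma is_partial_const i c p : is_partial i (fun _ => c) p 0.
Proof. destruct i; exact (is_derive_const (K := R_AbsRing) (V := R_NormedModule) c _). Qed.

Lemma is_partial_plus i f g p l m :
  is_partial i f p l -> is_partial i g p m ->
  is_partial i (fun q => f q + g q) p (l + m).
Proof.
  destruct i; intros hf hg; exact (is_derive_plus (K := R_AbsRing) (V := R_NormedModule) _ _ _ _ _ hf hg).
Qed.

Lemma is_partial_opp i f p l :
  is_partial i f p l -> is_partial i (fun q => - f q) p (- l).
Proof.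
  destruct i; intros hf; exact (is_derive_opp (K := R_AbsRing) (V := R_NormedModule) _ _ _ hf).
Qed.

Lemma is_partial_minus i f g p l m :
  is_partial i f p l -> is_partial i g p m ->
  is_partial i (fun q => f q - g q) p (l - m).
Proof.
  destruct i; intros hf hg; exact (is_derive_minus (K := R_AbsRing) (V := R_NormedModule) _ _ _ _ _ hf hg).
Qed.

Lemma is_partial_mult i f g p l m :
  is_partial i f p l -> is_partial i g p m ->
  is_partial i (fun q => f q * g q) p (l * g p + f p * m).
Proof.
  destruct p; destruct i; intros; simpl in *;
    apply (is_derive_mult (K := R_AbsRing)); auto; intros; apply Rmult_comm.
Qed.

Lemma is_partial_comp1 i (h : R -> R) f p l m :
  is_derive h (f p) m -> is_partial i f p l ->
  is_partial i (fun q => h (f q)) p (m * l).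
Proof.
  destruct p as [x y]; destruct i; intros hh hf; simpl in *;
    rewrite Rmult_comm; now apply (is_derive_comp h).
Qed.

Lemma is_partial_inv i f p l :
  f p <> 0 -> is_partial i f p l ->
  is_partial i (fun q => / f q) p (- (l * (/ f p * / f p))).
Proof.
  intros nz h.
  replace (- (l * (/ f p * / f p))) with (- (1) / (f p) ^ 2 * l) by (field; auto).
  apply (is_partial_comp1 i Rinv f); auto.
  apply (is_derive_inv (fun x => x)); auto; exact (is_derive_id (K := R_AbsRing) _).
Qed.

Lemma is_partial_cos i f p l : is_partial i f p l ->
  is_partial i (fun q => cos (f q)) p (- sin (f p) * l).
Proof. apply is_partial_comp1, is_derive_cos. Qed.

Lemma is_partial_sin i f p l : is_partial i f p l ->
  is_partial i (fun q => sin (f q)) p (cos (f p) * l).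
Proof. apply is_partial_comp1, is_derive_sin. Qed.

Lemma is_partial_sqrt i f p l : 0 < f p -> is_partial i f p l ->
  is_partial i (fun q => sqrt (f q)) p (/ 2 * / sqrt (f p) * l).
Proof.
  intros h; apply is_partial_comp1.
  replace (/ 2 * / sqrt (f p)) with (1 / (2 * sqrt (f p)))
    by (field; apply Rgt_not_eq, sqrt_lt_R0, h).
  apply (is_derive_sqrt (fun x => x)); auto; exact (is_derive_id (K := R_AbsRing) _).
Qed.

Lemma is_partial_fst i p : is_partial i fst p (match i with ax => 1 | ay => 0 end).
Proof.
  destruct i; [exact (is_derive_id (K := R_AbsRing) _) |
    exact (is_derive_const (K := R_AbsRing) (V := R_NormedModule) _ _)].
Qed.

Lemma is_partial_snd i p : is_partial i snd p (match i with ax => 0 | ay => 1 end).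
Proof.
  destruct i; [exact (is_derive_const (K := R_AbsRing) (V := R_NormedModule) _ _) |
    exact (is_derive_id (K := R_AbsRing) _)].
Qed.

Lemma is_partial_comp2 i f (u v : R * R -> R) p lu lv :
  Ck 1 f -> is_partial i u p lu -> is_partial i v p lv ->
  is_partial i (fun q => f (u q, v q)) p
    (partial ax f (u p, v p) * lu + partial ay f (u p, v p) * lv).
Proof.
  intros cf hu hv.
  assert (hd := Ck_differentiable 0 f (u p, v p) cf); simpl fst in hd; simpl snd in hd.
  destruct p as [x y]; destruct i; simpl in *.
  all: apply is_derive_Reals;
    apply (derivable_pt_lim_comp_2d (fun a b => f (a, b))
      (fun t => u _) (fun t => v _)); auto; now apply is_derive_Reals.
Qed.

Lemma Ck_const k c : Ck k (fun _ => c).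
Proof.
  revert c; induction k; intros c.
  - intros p; apply continuous_const.
  - apply (Ck_intro _ _ (fun _ _ => 0)); intros; [apply is_partial_const | apply IHk].
Qed.

Lemma smooth_const c : smooth (fun _ => c).
Proof. intros k; apply Ck_const. Qed.

Lemma smooth_fst : smooth fst.
Proof.
  apply (smooth_intro _ (fun i _ => match i with ax => 1 | ay => 0 end)).
  - intros; apply is_partial_fst.
  - intros []; apply smooth_const.
Qed.

Lemma smooth_snd : smooth snd.
Proof.
  apply (smooth_intro _ (fun i _ => match i with ax => 0 | ay => 1 end)).
  - intros; apply is_partial_snd.
  - intros []; apply smooth_const.
Qed.

Lemma Ck_is k f i p : Ck (S k) f -> is_partial i f p (partial i f p).
Proof. intros [h _]; apply ex_partial_is, h. Qed.

Lemma Ck_plus k f g : Ck k f -> Ck k g -> Ck k (fun p => f p + g p).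
Proof.
  revert f g; induction k; intros f g hf hg.
  - intros p; apply @continuous_plus; auto.
  - apply (Ck_intro _ _ (fun i p => partial i f p + partial i g p)).
    + intros; apply is_partial_plus; eapply Ck_is; eauto.
    + intros i; apply IHk; [apply hf | apply hg].
Qed.

Lemma Ck_opp k f : Ck k f -> Ck k (fun p => - f p).
Proof.
  revert f; induction k; intros f hf.
  - intros p; apply @continuous_opp; auto.
  - apply (Ck_intro _ _ (fun i p => - partial i f p)).
    + intros; apply is_partial_opp; eapply Ck_is; eauto.
    + intros i; apply IHk, hf.
Qed.

Lemma Ck_mult k f g : Ck k f -> Ck k g -> Ck k (fun p => f p * g p).
Proof.
  revert f g; induction k; intros f g hf hg.
  - intros p; apply @continuous_mult; auto.
  - apply (Ck_intro _ _ (fun i p => partial i f p * g p + f p * partial i g p)).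
    + intros; apply is_partial_mult; eapply Ck_is; eauto.
    + intros i; apply Ck_plus; apply IHk.
      * apply hf.
      * apply Ck_S, hg.
      * apply Ck_S, hf.
      * apply hg.
Qed.

Lemma smooth_plus f g : smooth f -> smooth g -> smooth (fun p => f p + g p).
Proof. intros hf hg k; apply Ck_plus; auto. Qed.

Lemma smooth_opp f : smooth f -> smooth (fun p => - f p).
Proof. intros hf k; apply Ck_opp; auto. Qed.

Lemma smooth_minus f g : smooth f -> smooth g -> smooth (fun p => f p - g p).
Proof. intros hf hg; apply smooth_plus; [|apply smooth_opp]; auto. Qed.

Lemma smooth_mult f g : smooth f -> smooth g -> smooth (fun p => f p * g p).
Proof. intros hf hg k; apply Ck_mult; auto. Qed.

(** The partial derivatives of [/ f] are polynomials in [/ f] and the partials of [f], so the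
    induction on the order closes on [/ f] alone. *)
Lemma smooth_inv f : smooth f -> (forall p, f p <> 0) -> smooth (fun p => / f p).
Proof.
  intros hf nz k; induction k.
  - intros p; apply (continuous_comp f Rinv); [apply (hf O)|].
    apply continuity_pt_filterlim, (continuity_pt_inv (fun x => x));
      [apply derivable_continuous_pt, derivable_pt_id | apply nz].
  - apply (Ck_intro _ _ (fun i p => - (partial i f p * (/ f p * / f p)))).
    + intros; apply is_partial_inv; [apply nz | apply smooth_is, hf].
    + intros i; apply Ck_opp, Ck_mult; [apply (smooth_partial f i hf)|].
      now apply Ck_mult.
Qed.

Lemma smooth_sqrt f : smooth f -> (forall p, 0 < f p) -> smooth (fun p => sqrt (f p)).
Proof.
  intros hf pos k; induction k.
  - intros p; apply (continuous_comp f sqrt); [apply (hf O)|].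
    apply continuous_sqrt.
  (* [/ sqrt f] is rewritten as [sqrt f * / f]: the induction hypothesis for [sqrt f] and the
     smoothness of [/ f] then suffice. *)
  - apply (Ck_intro _ _ (fun i p => / 2 * (sqrt (f p) * / f p) * partial i f p)).
    + intros i p.
      replace (sqrt (f p) * / f p) with (/ sqrt (f p)).
      * apply is_partial_sqrt; [apply pos | apply smooth_is, hf].
      * assert (h := sqrt_lt_R0 _ (pos p)).
        rewrite <- (sqrt_sqrt (f p)) at 3 by (left; apply pos); field; lra.
    + intros i; apply Ck_mult; [|apply (smooth_partial f i hf)].
      apply Ck_mult; [apply Ck_const|]; apply Ck_mult; auto.
      apply smooth_inv; auto; intros p; apply Rgt_not_eq, pos.
Qed.

Lemma smooth_cos_sin f : smooth f ->
  smooth (fun p => cos (f p)) /\ smooth (fun p => sin (f p)).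
Proof.
  intros hf; enough (h : forall k, Ck k (fun p => cos (f p)) /\ Ck k (fun p => sin (f p)))
    by (split; intros k; apply h).
  induction k as [|k [hc hs]].
  - split; intros p; (apply continuous_comp; [apply (hf O)|]).
    + apply continuous_cos.
    + apply continuous_sin.
  - split.
    + apply (Ck_intro _ _ (fun i p => - sin (f p) * partial i f p)).
      * intros; apply is_partial_cos, smooth_is, hf.
      * intros i; apply Ck_mult; [now apply Ck_opp | apply (smooth_partial f i hf)].
    + apply (Ck_intro _ _ (fun i p => cos (f p) * partial i f p)).
      * intros; apply is_partial_sin, smooth_is, hf.
      * intros i; apply Ck_mult; [auto | apply (smooth_partial f i hf)].
Qed.

Lemma smooth_cos f : smooth f -> smooth (fun p => cos (f p)).
Proof. apply smooth_cos_sin. Qed.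

Lemma smooth_sin f : smooth f -> smooth (fun p => sin (f p)).
Proof. intros h; now apply smooth_cos_sin. Qed.

(** The induction quantifies over [f], because the chain rule brings in the partials of [f] composed
    with the same [u] and [v]. *)
Lemma Ck_comp2 k f u v : smooth f -> Ck k u -> Ck k v -> Ck k (fun p => f (u p, v p)).
Proof.
  revert f u v; induction k; intros f u v hf hu hv.
  - intros p; apply (continuous_comp_2 u v (fun a b => f (a, b))); auto.
    simpl; assert (h := hf O (u p, v p)).
    eapply continuous_ext; [|exact h]; now intros [].
  - apply (Ck_intro _ _ (fun i p => partial ax f (u p, v p) * partial i u p
                                  + partial ay f (u p, v p) * partial i v p)).
    + intros i p; apply is_partial_comp2; [apply hf | eapply Ck_is; eauto ..].
    + intros i; apply Ck_plus; apply Ck_mult.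
      * apply IHk; [now apply smooth_partial | now apply Ck_S ..].
      * apply hu.
      * apply IHk; [now apply smooth_partial | now apply Ck_S ..].
      * apply hv.
Qed.

Lemma smooth_comp2 f u v : smooth f -> smooth u -> smooth v ->
  smooth (fun p => f (u p, v p)).
Proof. intros hf hu hv k; apply Ck_comp2; auto. Qed.

Lemma smooth_Schwarz f p : smooth f ->
  partial ax (partial ay f) p = partial ay (partial ax f) p.
Proof.
  intros hf; destruct p as [x y].
  apply (Schwarz (fun a b => f (a, b)) x y).
  - exists (mkposreal _ Rlt_0_1); intros u v _ _; repeat split.
    + apply (smooth_ex f ax (u, v) hf).
    + apply (smooth_ex f ay (u, v) hf).
    + apply (smooth_ex _ ax (u, v) (smooth_partial f ay hf)).
    + apply (smooth_ex _ ay (u, v) (smooth_partial f ax hf)).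
  - exact (proj1 (continuous_2d _ (x, y))
      (smooth_continuous _ (x, y) (smooth_partial _ ax (smooth_partial f ay hf)))).
  - exact (proj1 (continuous_2d _ (x, y))
      (smooth_continuous _ (x, y) (smooth_partial _ ay (smooth_partial f ax hf)))).
Qed.

(** * Constancy along an axis and primitives of closed forms *)

Lemma partial_axis_indep i f : smooth f -> (forall p, partial i f p = 0) ->
  forall x y x' y',
  f (x, y) = match i with ax => f (x', y) | ay => f (x, y') end.
Proof.
  intros hf h x y x' y'.
  assert (K : forall k : R -> R, (forall t, is_derive k t 0) -> forall a b, k a = k b).
  { intros k hk a b; destruct (Rtotal_order a b) as [l | [-> | l]]; auto;
      [|symmetry]; apply eq_is_derive; auto; intros; apply hk. }
  destruct i; [apply (K (fun t => f (t, y))) | apply (K (fun t => f (x, t)))]; intros t.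
  - assert (d := smooth_is f ax (t, y) hf); rewrite h in d; exact d.
  - assert (d := smooth_is f ay (x, t) hf); rewrite h in d; exact d.
Qed.

Lemma partial_zero_const f : smooth f -> (forall i p, partial i f p = 0) ->
  forall p q, f p = f q.
Proof.
  intros hf h [x y] [x' y'].
  rewrite (partial_axis_indep ax f hf (h ax) x y x' y).
  apply (partial_axis_indep ay f hf (h ay) x' y x' y').
Qed.

Lemma smooth_curve f (u v : R -> R) x du dv : smooth f ->
  is_derive u x du -> is_derive v x dv ->
  is_derive (fun t => f (u t, v t)) x
    (partial ax f (u x, v x) * du + partial ay f (u x, v x) * dv).
Proof.
  intros hf hu hv.
  exact (is_partial_comp2 ax f (fun p => u (fst p)) (fun p => v (fst p)) (x, 0) du dv
    (hf 1%nat) hu hv).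
Qed.

Lemma smooth_slice f i x y : smooth f ->
  continuous (fun t => match i with ax => f (t, y) | ay => f (x, t) end)
    (match i with ax => x | ay => y end).
Proof.
  intros hf; destruct i; apply (ex_derive_continuous (V := R_NormedModule)).
  - apply (smooth_ex f ax (x, y) hf).
  - apply (smooth_ex f ay (x, y) hf).
Qed.

(** The primitive integrates [P] along the horizontal axis and then [Q] vertically. Its derivative
    in [x] is taken under the integral, where closedness turns the integrand into the [y] derivative
    of [P]. *)
Lemma poincare P Q : smooth P -> smooth Q ->
  (forall p, partial ay P p = partial ax Q p) ->
  exists f, smooth f /\ (forall p, partial ax f p = P p) /\ (forall p, partial ay f p = Q p).
Proof.
  intros hP hQ clo.
  assert (cP : forall t, continuous (fun t => P (t, 0)) t)
    by (intros t; apply (smooth_slice P ax t 0 hP)).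
  assert (cQ : forall x t, continuous (fun t => Q (x, t)) t)
    by (intros x t; apply (smooth_slice Q ay x t hQ)).
  set (f := fun p : R * R => RInt (fun t => P (t, 0)) 0 (fst p)
                           + RInt (fun t => Q (fst p, t)) 0 (snd p)).
  assert (iQ : forall x b, ex_RInt (fun t => Q (x, t)) 0 b).
  { intros x b; apply (ex_RInt_continuous (V := R_CompleteNormedModule)); intros; apply cQ. }
  assert (h : forall i p, is_partial i f p (match i with ax => P p | ay => Q p end)).
  { intros [] [x y]; unfold f; simpl.
    - replace (P (x, y)) with (P (x, 0) + RInt (fun t => Derive (fun u => Q (u, t)) x) 0 y).
      + apply (is_derive_plus (V := R_NormedModule)).
        * apply (is_derive_RInt (V := R_NormedModule) (fun t => P (t, 0)) _ 0); [|apply cP].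
          apply filter_forall; intros b; apply (RInt_correct (V := R_CompleteNormedModule)).
          apply (ex_RInt_continuous (V := R_CompleteNormedModule)); intros; apply cP.
        * apply (is_derive_RInt_param (fun u t => Q (u, t)) 0 y x).
          -- apply filter_forall; intros u t _; apply (smooth_ex Q ax (u, t) hQ).
          -- intros t _; apply (proj1 (continuous_2d (partial ax Q) (x, t))).
             apply smooth_continuous, smooth_partial, hQ.
          -- apply filter_forall; intros u; apply iQ.
      + rewrite (RInt_ext _ (fun t => Derive (fun v => P (x, v)) t)).
        * rewrite RInt_Derive; [ring | |].
          -- intros t _; apply (smooth_ex P ay (x, t) hP).
          -- intros t _; apply (smooth_slice (partial ay P) ay x t), smooth_partial, hP.
        * intros t _; symmetry; apply (clo (x, t)).
    - replace (Q (x, y)) with (0 + Q (x, y)) by ring.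
      apply (is_derive_plus (V := R_NormedModule)); [exact (is_derive_const (K := R_AbsRing) (V := R_NormedModule) _ _)|].
      apply (is_derive_RInt (V := R_NormedModule) (fun t => Q (x, t)) _ 0); [|apply cQ].
      apply filter_forall; intros b; apply (RInt_correct (V := R_CompleteNormedModule)), iQ. }
  exists f; split; [|split; intros p; apply is_partial_eq; [apply (h ax p) | apply (h ay p)]].
  apply (smooth_intro _ (fun i p => match i with ax => P p | ay => Q p end)); auto.
  intros []; auto.
Qed.


Ltac smooth_tac :=
  lazymatch goal with
  | |- smooth (fun _ => ?c) => apply smooth_const
  | |- smooth (fun p => _ + _) => apply smooth_plus; smooth_tac
  | |- smooth (fun p => _ - _) => apply smooth_minus; smooth_tac
  | |- smooth (fun p => - _) => apply smooth_opp; smooth_tac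
  | |- smooth (fun p => _ * _) => apply smooth_mult; smooth_tac
  | |- smooth (fun p => _ / _) => apply smooth_mult; smooth_tac
  | |- smooth (fun p => cos _) => apply smooth_cos; smooth_tac
  | |- smooth (fun p => sin _) => apply smooth_sin; smooth_tac
  | |- smooth (fun p => fst p) => exact smooth_fst
  | |- smooth (fun p => snd p) => exact smooth_snd
  | |- smooth fst => exact smooth_fst
  | |- smooth snd => exact smooth_snd
  | |- smooth (fun p => partial ?i ?f p) => apply (smooth_partial f i); smooth_tac
  | |- smooth (partial ?i ?f) => apply (smooth_partial f i); smooth_tac
  | |- smooth (fun p => ?f (@?u p, @?v p)) => apply (smooth_comp2 f u v); smooth_tac
  | |- _ => try assumption; auto
  end.

Ltac partial_tac :=
  lazymatch goal with
  | |- is_partial _ (fun _ => ?c) _ _ => apply is_partial_const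
  | |- is_partial _ (fun p => _ + _) _ _ => eapply is_partial_plus; partial_tac
  | |- is_partial _ (fun p => _ - _) _ _ => eapply is_partial_minus; partial_tac
  | |- is_partial _ (fun p => - _) _ _ => eapply is_partial_opp; partial_tac
  | |- is_partial _ (fun p => _ * _) _ _ => eapply is_partial_mult; partial_tac
  | |- is_partial _ (fun p => cos _) _ _ => eapply is_partial_cos; partial_tac
  | |- is_partial _ (fun p => sin _) _ _ => eapply is_partial_sin; partial_tac
  | |- is_partial _ (fun p => ?f (@?u p, @?v p)) _ _ =>
      eapply (is_partial_comp2 _ f u v); [ | partial_tac ..]
  | |- is_partial _ (fun p => fst p) _ _ => apply is_partial_fst
  | |- is_partial _ (fun p => snd p) _ _ => apply is_partial_snd
  | |- is_partial _ fst _ _ => apply is_partial_fst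
  | |- is_partial _ snd _ _ => apply is_partial_snd
  | |- _ => apply smooth_is; smooth_tac
  end.

(** * Angle functions and constancy of sign *)

Lemma circle_angle c s : c * c + s * s = 1 -> exists t, cos t = c /\ sin t = s.
Proof.
  intros h.
  assert (hc : -1 <= c <= 1) by nra.
  assert (e : sqrt (1 - Rsqr c) = Rabs s).
  { rewrite <- (sqrt_Rsqr_abs s); f_equal; unfold Rsqr; lra. }
  destruct (Rle_dec 0 s) as [p | n].
  - exists (acos c); rewrite cos_acos, sin_acos, e, Rabs_right; auto; lra.
  - exists (- acos c); rewrite cos_neg, sin_neg, cos_acos, sin_acos, e, Rabs_left; auto; lra.
Qed.

(** The angle must be a primitive of [c ds - s dc], which is closed because [(c, s)] stays on the
    circle. The constant of integration is fixed at the origin. *)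
Lemma angle_lift c s : smooth c -> smooth s -> (forall p, c p * c p + s p * s p = 1) ->
  exists t, smooth t /\ (forall p, cos (t p) = c p) /\ (forall p, sin (t p) = s p) /\
    (forall i p, partial i t p = c p * partial i s p - s p * partial i c p).
Proof.
  intros hc hs h1.
  assert (h2 : forall i p, c p * partial i c p + s p * partial i s p = 0).
  { intros i p.
    assert (e := is_partial_const i 1 p).
    replace (fun _ : R * R => 1) with (fun p => c p * c p + s p * s p) in e
      by (apply functional_extensionality; auto).
    apply is_partial_eq in e; erewrite is_partial_eq in e by partial_tac; lra. }
  set (P := fun i p => c p * partial i s p - s p * partial i c p).
  assert (ci : forall i p, partial i c p = - s p * P i p).
  { intros i p; unfold P; specialize (h1 p); specialize (h2 i p).
    replace (- s p * (c p * partial i s p - s p * partial i c p)) with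
      ((c p * c p + s p * s p) * partial i c p
       - c p * (c p * partial i c p + s p * partial i s p)) by ring.
    rewrite h1, h2; ring. }
  assert (si : forall i p, partial i s p = c p * P i p).
  { intros i p; unfold P; specialize (h1 p); specialize (h2 i p).
    replace (c p * (c p * partial i s p - s p * partial i c p)) with
      ((c p * c p + s p * s p) * partial i s p
       - s p * (c p * partial i c p + s p * partial i s p)) by ring.
    rewrite h1, h2; ring. }
  destruct (poincare (P ax) (P ay)) as [f [hf [fx fy]]].
  { unfold P; smooth_tac. }
  { unfold P; smooth_tac. }
  { intros p; unfold P.
    erewrite is_partial_eq by partial_tac; symmetry;
      erewrite is_partial_eq by partial_tac; symmetry.
    rewrite (smooth_Schwarz c p hc), (smooth_Schwarz s p hs), !ci, !si; ring. }
  assert (fi : forall i p, partial i f p = P i p) by (intros []; auto).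
  destruct (circle_angle _ _ (h1 (0, 0))) as [t0 [e1 e2]].
  set (k := t0 - f (0, 0)).
  set (t := fun p => f p + k).
  assert (ht : smooth t) by (unfold t; smooth_tac).
  assert (ti : forall i p, partial i t p = P i p).
  { intros i p; unfold t; erewrite is_partial_eq by partial_tac; rewrite fi; ring. }
  assert (t00 : t (0, 0) = t0) by (unfold t, k; ring).
  (* [U] and [W] are the scalar product and the determinant of [(c, s)] and [(cos t, sin t)]. Both
     have zero derivatives and the values 1 and 0 at the origin, so the two unit vectors coincide
     everywhere. *)
  assert (U : forall p, c p * cos (t p) + s p * sin (t p) = 1).
  { intros p; rewrite (partial_zero_const (fun p => c p * cos (t p) + s p * sin (t p)))
      with (q := (0, 0)).
    - rewrite t00, e1, e2; apply h1.
    - smooth_tac.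
    - intros i q; erewrite is_partial_eq by partial_tac; rewrite ci, si, ti; ring. }
  assert (W : forall p, s p * cos (t p) - c p * sin (t p) = 0).
  { intros p; rewrite (partial_zero_const (fun p => s p * cos (t p) - c p * sin (t p)))
      with (q := (0, 0)).
    - rewrite t00, e1, e2; ring.
    - smooth_tac.
    - intros i q; erewrite is_partial_eq by partial_tac; rewrite ci, si, ti; ring. }
  exists t; split; [exact ht | split; [|split]]; [ | | exact ti];
    intros p; specialize (U p); specialize (W p); specialize (h1 p).
  - replace (cos (t p)) with ((c p * c p + s p * s p) * cos (t p)) by (rewrite h1; ring).
    replace ((c p * c p + s p * s p) * cos (t p)) with
      (c p * (c p * cos (t p) + s p * sin (t p))
       + s p * (s p * cos (t p) - c p * sin (t p))) by ring.
    rewrite U, W; ring.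
  - replace (sin (t p)) with ((c p * c p + s p * s p) * sin (t p)) by (rewrite h1; ring).
    replace ((c p * c p + s p * s p) * sin (t p)) with
      (s p * (c p * cos (t p) + s p * sin (t p))
       - c p * (s p * cos (t p) - c p * sin (t p))) by ring.
    rewrite U, W; ring.
Qed.

Lemma smooth_constant_sign f : smooth f -> (forall p, f p <> 0) ->
  (forall p, 0 < f p) \/ (forall p, f p < 0).
Proof.
  intros hf nz.
  assert (K : forall p q, 0 < f p -> f q < 0 -> False).
  { intros [x y] [x' y'] hp hq.
    set (k := fun t => f (x + t * (x' - x), y + t * (y' - y))).
    assert (ck : continuity k).
    { intros t; apply continuity_pt_filterlim.
      apply (ex_derive_continuous (V := R_NormedModule)).
      eexists; apply (smooth_curve f (fun t => x + t * (x' - x)) (fun t => y + t * (y' - y)));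
        auto; auto_derive; auto. }
    destruct (IVT_gen k 0 1 0 ck) as [t [_ ht]].
    - unfold k; replace (x + 0 * (x' - x)) with x by ring;
        replace (y + 0 * (y' - y)) with y by ring;
        replace (x + 1 * (x' - x)) with x' by ring;
        replace (y + 1 * (y' - y)) with y' by ring.
      rewrite Rmin_right, Rmax_left; lra.
    - apply (nz _ ht). }
  destruct (Rtotal_order (f (0, 0)) 0) as [l | [e | g]]; [right | now elim (nz (0, 0)) | left];
    intros p; destruct (Rtotal_order (f p) 0) as [l' | [e | g']]; auto;
    exfalso; (now apply (nz p)) || (eapply K; eassumption).
Qed.

(** Uniform continuity with tolerance 1 gives a number [N] of equal steps from the origin to any
    point of the square; each step changes [f] by less than 1, whence the bound
    [Rabs (f (0, 0)) + N]. *)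
Lemma bounded_unit_square f : smooth f ->
  exists M, forall x y, 0 <= x <= 1 -> 0 <= y <= 1 -> Rabs (f (x, y)) <= M.
Proof.
  intros hf.
  destruct (uniform_continuity_2d (fun x y => f (x, y)) 0 1 0 1) with (eps := mkposreal _ Rlt_0_1)
    as [d hd].
  { intros x y _ _; apply (continuous_2d f (x, y)), smooth_continuous, hf. }
  destruct (archimed_cor1 d (cond_pos d)) as [N [hN pN]].
  assert (pN' : 0 < INR N) by (apply lt_0_INR; auto).
  exists (Rabs (f (0, 0)) + INR N); intros x y hx hy.
  assert (B : forall k, (k <= N)%nat ->
    Rabs (f (INR k / INR N * x, INR k / INR N * y)) <= Rabs (f (0, 0)) + INR k).
  { induction k; intros hk.
    - simpl; replace (0 / INR N * x) with 0 by (field; lra);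
        replace (0 / INR N * y) with 0 by (field; lra); lra.
    - specialize (IHk ltac:(lia)).
      assert (hk' : INR k + 1 <= INR N) by (rewrite <- S_INR; apply le_INR, hk).
      assert (rk : forall z, 0 <= z <= 1 -> 0 <= INR k / INR N * z <= 1 /\
        0 <= INR (S k) / INR N * z <= 1 /\
        Rabs (INR (S k) / INR N * z - INR k / INR N * z) < d).
      { intros z hz; pose proof (pos_INR k).
        assert (0 <= INR k / INR N <= 1).
        { split; [apply Rdiv_le_0_compat; lra | apply Rle_div_l; lra]. }
        assert (0 <= INR (S k) / INR N <= 1).
        { rewrite S_INR; split; [apply Rdiv_le_0_compat; lra | apply Rle_div_l; lra]. }
        split; [nra | split; [nra|]].
        replace (INR (S k) / INR N * z - INR k / INR N * z) with (/ INR N * z)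
          by (rewrite S_INR; field; lra).
        assert (0 < / INR N) by (apply Rinv_0_lt_compat; auto).
        rewrite Rabs_right; nra. }
      destruct (rk x hx) as [a1 [a2 a3]]; destruct (rk y hy) as [b1 [b2 b3]].
      assert (h := hd _ _ _ _ a1 b1 a2 b2 a3 b3); simpl in h.
      change (match k with O => 1 | S _ => INR k + 1 end) with (INR (S k)) in *.
      rewrite (S_INR k) at 3.
      pose proof (Rabs_triang_inv (f (INR (S k) / INR N * x, INR (S k) / INR N * y))
        (f (INR k / INR N * x, INR k / INR N * y))); lra. }
  specialize (B N (le_n N)).
  replace (INR N / INR N) with 1 in B by (field; lra).
  now rewrite !Rmult_1_l in B.
Qed.

(** * Lattices and doubly periodic functions *)

Definition det2 (v w : R * R) : R := fst v * snd w - snd v * fst w.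

Lemma lin_indep_det v w : lin_indep v w <-> det2 v w <> 0.
Proof.
  destruct v as [a b], w as [c d]; unfold lin_indep, det2, Ladd, Lscal; simpl; split.
  - intros h e.
    destruct (h d (- b)) as [hd hb]; [f_equal; lra|].
    destruct (h c (- a)) as [hc ha]; [f_equal; lra|].
    destruct (h 1 0); [f_equal; lra | lra].
  - intros nz x y e; injection e; intros e1 e2.
    split; apply (Rmult_eq_reg_l (a * d - b * c)); auto; rewrite Rmult_0_r.
    + replace ((a * d - b * c) * x) with (d * (x * a + y * c) - c * (x * b + y * d)) by ring.
      rewrite e1, e2; ring.
    + replace ((a * d - b * c) * y) with (a * (x * b + y * d) - b * (x * a + y * c)) by ring.
      rewrite e1, e2; ring.
Qed.

Lemma Z_invariant {A : Type} (f : R -> A) c :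
  (forall x, f (x + c) = f x) -> forall (m : Z) x, f (x + IZR m * c) = f x.
Proof.
  intros h.
  assert (n1 : forall n x, f (x + INR n * c) = f x).
  { induction n; intros x; [simpl; f_equal; ring|].
    rewrite S_INR; replace (x + (INR n + 1) * c) with (x + INR n * c + c) by ring.
    now rewrite h. }
  intros m x; destruct (Z.le_ge_cases 0 m) as [p | p].
  - rewrite <- (Z2Nat.id m p), <- INR_IZR_INZ; apply n1.
  - rewrite <- (n1 (Z.to_nat (- m)) (x + IZR m * c)), INR_IZR_INZ, Z2Nat.id by lia.
    f_equal; rewrite opp_IZR; ring.
Qed.

Lemma lattice_invariant {A : Type} (f : R * R -> A) v w :
  (forall p, f (Ladd p v) = f p) -> (forall p, f (Ladd p w) = f p) ->
  forall p u, lattice v w u -> f (Ladd p u) = f p.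
Proof.
  intros hv hw [x y] u [m [n ->]]; unfold Ladd, Lscal in *; simpl in *.
  destruct v as [a b], w as [c d]; simpl in *.
  assert (e1 := Z_invariant (fun r => f (x + r * a, y + r * b)) 1).
  assert (e2 := Z_invariant (fun r => f (x + IZR m * a + r * c, y + IZR m * b + r * d)) 1).
  simpl in *.
  replace (f (x + (IZR m * a + IZR n * c), y + (IZR m * b + IZR n * d)))
    with (f (x + IZR m * a + (0 + IZR n * 1) * c, y + IZR m * b + (0 + IZR n * 1) * d))
    by (do 2 f_equal; ring).
  rewrite e2.
  - replace (f (x + IZR m * a + 0 * c, y + IZR m * b + 0 * d))
      with (f (x + (0 + IZR m * 1) * a, y + (0 + IZR m * 1) * b)) by (do 2 f_equal; ring).
    rewrite e1.
    + do 2 f_equal; ring.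
    + intros r; rewrite <- (hv (x + r * a, y + r * b)); simpl; do 2 f_equal; ring.
  - intros r; rewrite <- (hw (x + IZR m * a + r * c, y + IZR m * b + r * d)); simpl;
      do 2 f_equal; ring.
Qed.

(** Only the absolute value is assumed periodic, since the forms of the converse may change sign
    under a translation. The coordinates [a], [b] in the basis [v], [w] are replaced by their
    fractional parts. *)
Lemma periodic_bounded f v w : smooth f -> lin_indep v w ->
  (forall p, Rabs (f (Ladd p v)) = Rabs (f p)) ->
  (forall p, Rabs (f (Ladd p w)) = Rabs (f p)) ->
  exists M, forall p, Rabs (f p) <= M.
Proof.
  intros hf li hv hw; apply lin_indep_det in li.
  destruct (bounded_unit_square (fun q => f (fst q * fst v + snd q * fst w,
                                             fst q * snd v + snd q * snd w))) as [M hM].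
  { apply (smooth_comp2 f (fun q => fst q * fst v + snd q * fst w)
             (fun q => fst q * snd v + snd q * snd w)); smooth_tac. }
  simpl in hM; exists M; intros [x y].
  set (D := det2 v w) in *.
  set (a := (x * snd w - y * fst w) / D); set (b := (fst v * y - snd v * x) / D).
  assert (ex : x = a * fst v + b * fst w) by (unfold a, b, D, det2 in *; field; auto).
  assert (ey : y = a * snd v + b * snd w) by (unfold a, b, D, det2 in *; field; auto).
  destruct (base_Int_part a) as [a1 a2]; destruct (base_Int_part b) as [b1 b2].
  rewrite <- (hM (a - IZR (Int_part a)) (b - IZR (Int_part b))) by lra.
  apply Req_le; symmetry.
  rewrite <- (lattice_invariant (fun p => Rabs (f p)) v w hv hw _
    (Ladd (Lscal (IZR (Int_part a)) v) (Lscal (IZR (Int_part b)) w))) by (do 2 eexists; reflexivity).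
  unfold Ladd, Lscal; simpl; do 3 f_equal; rewrite ?ex, ?ey at 1; ring.
Qed.


(** * Hadamard's global inversion theorem *)

Definition dist1 (p q : R * R) : R := Rabs (fst q - fst p) + Rabs (snd q - snd p).

Lemma dist1_pos p q : 0 <= dist1 p q.
Proof.
  unfold dist1; pose proof (Rabs_pos (fst q - fst p)); pose proof (Rabs_pos (snd q - snd p)); lra.
Qed.

Lemma dist1_sym p q : dist1 p q = dist1 q p.
Proof. unfold dist1; f_equal; apply Rabs_minus_sym. Qed.

Lemma dist1_triang p q r : dist1 p r <= dist1 p q + dist1 q r.
Proof.
  unfold dist1.
  pose proof (Rabs_triang (fst r - fst q) (fst q - fst p)).
  pose proof (Rabs_triang (snd r - snd q) (snd q - snd p)).
  replace (fst r - fst q + (fst q - fst p)) with (fst r - fst p) in * by ring.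
  replace (snd r - snd q + (snd q - snd p)) with (snd r - snd p) in * by ring.
  lra.
Qed.

Lemma dist1_eq p q : dist1 p q <= 0 -> p = q.
Proof.
  destruct p as [x y], q as [x' y']; unfold dist1; simpl; intros h.
  pose proof (Rabs_pos (x' - x)); pose proof (Rabs_pos (y' - y)).
  f_equal; apply Rminus_diag_uniq_sym; apply Rabs_eq_0; lra.
Qed.

Lemma dist1_refl p : dist1 p p = 0.
Proof. unfold dist1; rewrite !Rminus_diag, Rabs_R0; ring. Qed.

Lemma lipschitz_bound f K p q : smooth f ->
  (forall i p, Rabs (partial i f p) <= K) -> Rabs (f q - f p) <= K * dist1 p q.
Proof.
  intros hf hK; destruct p as [x y], q as [u v]; unfold dist1; simpl.
  destruct (MVT_gen (fun t => f (t, v)) x u (fun t => partial ax f (t, v))) as [c [_ e1]].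
  { intros t _; apply (smooth_is f ax (t, v) hf). }
  { intros t _; apply derivable_continuous_pt, ex_derive_Reals_0, (smooth_ex f ax (t, v) hf). }
  destruct (MVT_gen (fun t => f (x, t)) y v (fun t => partial ay f (x, t))) as [c' [_ e2]].
  { intros t _; apply (smooth_is f ay (x, t) hf). }
  { intros t _; apply derivable_continuous_pt, ex_derive_Reals_0, (smooth_ex f ay (x, t) hf). }
  replace (f (u, v) - f (x, y)) with
    (partial ax f (c, v) * (u - x) + partial ay f (x, c') * (v - y)) by lra.
  eapply Rle_trans; [apply Rabs_triang|]; rewrite !Rabs_mult, Rmult_plus_distr_l.
  apply Rplus_le_compat; apply Rmult_le_compat_r; auto; apply Rabs_pos.
Qed.

Lemma between_Rabs x u c : Rmin x u <= c <= Rmax x u -> Rabs (c - x) <= Rabs (u - x).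
Proof.
  unfold Rmin, Rmax, Rabs; destruct Rle_dec; repeat destruct Rcase_abs; lra.
Qed.

(** Mean values on the same two legs as for differentiability; each error coefficient is a
    difference of values of one first partial, controlled by the bound on second partials. *)
Lemma taylor_bound f K p q : smooth f ->
  (forall i j p, Rabs (partial i (partial j f) p) <= K) ->
  Rabs (f q - f p - (partial ax f p * (fst q - fst p) + partial ay f p * (snd q - snd p)))
    <= K * (dist1 p q * dist1 p q).
Proof.
  intros hf hK; destruct p as [x y], q as [u v].
  assert (K0 : 0 <= K).
  { eapply Rle_trans; [apply Rabs_pos | apply (hK ax ax (0, 0))]. }
  destruct (MVT_gen (fun t => f (t, v)) x u (fun t => partial ax f (t, v))) as [c [hc e1]].
  { intros t _; apply (smooth_is f ax (t, v) hf). }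
  { intros t _; apply derivable_continuous_pt, ex_derive_Reals_0, (smooth_ex f ax (t, v) hf). }
  destruct (MVT_gen (fun t => f (x, t)) y v (fun t => partial ay f (x, t))) as [c' [hc' e2]].
  { intros t _; apply (smooth_is f ay (x, t) hf). }
  { intros t _; apply derivable_continuous_pt, ex_derive_Reals_0, (smooth_ex f ay (x, t) hf). }
  apply between_Rabs in hc; apply between_Rabs in hc'.
  assert (b1 := lipschitz_bound (partial ax f) K (x, y) (c, v) (smooth_partial f ax hf)
                  (fun i p => hK i ax p)).
  assert (b2 := lipschitz_bound (partial ay f) K (x, y) (x, c') (smooth_partial f ay hf)
                  (fun i p => hK i ay p)).
  unfold dist1 in *; simpl fst in *; simpl snd in *.
  rewrite Rminus_diag, Rabs_R0 in b2.
  replace (f (u, v) - f (x, y) - (partial ax f (x, y) * (u - x) + partial ay f (x, y) * (v - y)))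
    with ((partial ax f (c, v) - partial ax f (x, y)) * (u - x) +
          (partial ay f (x, c') - partial ay f (x, y)) * (v - y)) by lra.
  eapply Rle_trans; [apply Rabs_triang|]; rewrite !Rabs_mult.
  pose proof (Rabs_pos (u - x)) as pa; pose proof (Rabs_pos (v - y)) as pb.
  set (a := Rabs (u - x)) in *; set (b := Rabs (v - y)) in *.
  assert (m1 : Rabs (partial ax f (c, v) - partial ax f (x, y)) <= K * (a + b)) by nra.
  assert (m2 : Rabs (partial ay f (x, c') - partial ay f (x, y)) <= K * (a + b)) by nra.
  apply Rmult_le_compat_r with (r := a) in m1; auto.
  apply Rmult_le_compat_r with (r := b) in m2; auto.
  lra.
Qed.

(** A quadratic remainder is what Newton's method yields for an inverse map; this turns it into a
    derivative. *)
Lemma is_derive_quadratic (f : R -> R) x l C rho : 0 < rho ->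
  (forall h, Rabs h <= rho -> Rabs (f (x + h) - f x - l * h) <= C * (Rabs h * Rabs h)) ->
  is_derive f x l.
Proof.
  intros pr hC; apply is_derive_Reals; intros eps pe.
  assert (pd : 0 < Rmin rho (eps / (Rabs C + 1))).
  { apply Rmin_pos; auto; apply Rdiv_lt_0_compat; auto; pose proof (Rabs_pos C); lra. }
  exists (mkposreal _ pd); simpl; intros h nh hh.
  pose proof (Rmin_l rho (eps / (Rabs C + 1))); pose proof (Rmin_r rho (eps / (Rabs C + 1))).
  specialize (hC h ltac:(lra)).
  assert (ph : 0 < Rabs h) by now apply Rabs_pos_lt.
  replace ((f (x + h) - f x) / h - l) with ((f (x + h) - f x - l * h) / h) by (field; auto).
  unfold Rdiv; rewrite Rabs_mult, Rabs_inv.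
  apply (Rmult_lt_reg_r (Rabs h)); auto.
  rewrite Rmult_assoc, Rinv_l, Rmult_1_r by lra.
  eapply Rle_lt_trans; [exact hC|].
  rewrite <- Rmult_assoc; apply Rmult_lt_compat_r; auto.
  pose proof (Rabs_pos C); pose proof (RRle_abs C).
  assert (k : (Rabs C + 1) * Rabs h < eps).
  { apply (Rmult_lt_reg_r (/ (Rabs C + 1))); [apply Rinv_0_lt_compat; lra|].
    replace ((Rabs C + 1) * Rabs h * / (Rabs C + 1)) with (Rabs h) by (field; lra).
    unfold Rdiv in *; lra. }
  nra.
Qed.

(** Telescoping: the limit is [x O] plus an absolutely convergent series dominated by
    [c * (/ 2) ^ n], whose sum is [2 * c]. *)
Lemma geometric_limit (x : nat -> R) c :
  (forall n, Rabs (x (S n) - x n) <= c * (/ 2) ^ n) ->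
  exists l : R, is_lim_seq x l /\ Rabs (l - x O) <= 2 * c.
Proof.
  intros h.
  assert (g : is_series (fun n => c * (/ 2) ^ n) (c * / (1 - / 2))).
  { apply (is_series_scal_l c (fun n => (/ 2) ^ n)), is_series_geom.
    rewrite Rabs_right; lra. }
  assert (ea : ex_series (fun n => Rabs (x (S n) - x n))).
  { apply (ex_series_le (K := R_AbsRing) (V := R_CompleteNormedModule) _ (fun n => c * (/ 2) ^ n)).
    - intros n; unfold norm; simpl; unfold abs; simpl; rewrite Rabs_Rabsolu; apply h.
    - eexists; exact g. }
  assert (e := ex_series_Rabs _ ea).
  exists (x O + Series (fun n => x (S n) - x n)); split.
  - apply is_lim_seq_incr_1.
    apply (is_lim_seq_ext (fun n => x O + sum_n (fun n => x (S n) - x n) n)).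
    + induction n; [rewrite sum_O; ring|].
      rewrite sum_Sn, <- (Rplus_assoc (x O)) in * |- *; unfold plus; simpl; lra.
    + apply (is_lim_seq_plus' (fun _ => x O)); [apply is_lim_seq_const|].
      apply Series_correct in e; exact e.
  - rewrite Rplus_minus_l.
    eapply Rle_trans; [now apply Series_Rabs|].
    replace (2 * c) with (Series (fun n => c * (/ 2) ^ n))
      by (rewrite (is_series_unique _ _ g); field).
    apply Series_le; [intros n; split; [apply Rabs_pos | apply h] | eexists; exact g].
Qed.

Section Hadamard.

Variables (U V : R * R -> R) (K delta : R).
Hypothesis (hU : smooth U) (hV : smooth V) (delta_pos : 0 < delta).
Hypothesis U1 : forall i p, Rabs (partial i U p) <= K.
Hypothesis V1 : forall i p, Rabs (partial i V p) <= K.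
Hypothesis U2 : forall i j p, Rabs (partial i (partial j U) p) <= K.
Hypothesis V2 : forall i j p, Rabs (partial i (partial j V) p) <= K.

Let J p := partial ax U p * partial ay V p - partial ay U p * partial ax V p.
Hypothesis hJ : forall p, delta <= Rabs (J p).

Let Psi p : R * R := (U p, V p).
(** Bound for the inverse differential in [norm1]: entries of size at most [K], a determinant of
    size at least [delta], and two coordinates to add. *)
Let L := 2 * K / delta.

Let K_pos : 0 < K.
Proof.
  assert (0 <= K) by (eapply Rle_trans; [apply Rabs_pos | apply (U1 ax (0, 0))]).
  destruct H as [h | e]; auto; exfalso.
  assert (h := hJ (0, 0)); unfold J in h.
  pose proof (U1 ax (0, 0)); pose proof (U1 ay (0, 0)).
  rewrite <- e in *.
  assert (z : forall x, Rabs x <= 0 -> x = 0).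
  { intros x hx; apply Rabs_eq_0; pose proof (Rabs_pos x); lra. }
  rewrite (z _ H), (z _ H0), !Rmult_0_l, Rminus_diag, Rabs_R0 in h; lra.
Qed.

Let L_pos : 0 < L.
Proof. apply Rdiv_lt_0_compat; lra. Qed.

Let J_nz p : J p <> 0.
Proof. intros e; specialize (hJ p); rewrite e, Rabs_R0 in hJ; lra. Qed.

(** The inverse of the differential of [Psi] at [p], applied to [r] by Cramer's rule. *)
Let step p (r : R * R) : R * R :=
  ((partial ay V p * fst r - partial ay U p * snd r) / J p,
   (partial ax U p * snd r - partial ax V p * fst r) / J p).

Let norm1 (r : R * R) := Rabs (fst r) + Rabs (snd r).

Let step_bound p r : norm1 (step p r) <= L * norm1 r.
Proof.
  unfold norm1, step; cbn [fst snd]; unfold Rdiv; rewrite !Rabs_mult, Rabs_inv.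
  assert (iJ : / Rabs (J p) <= / delta) by (apply Rinv_le_contravar; auto).
  assert (piJ : 0 < / Rabs (J p)) by (apply Rinv_0_lt_compat; specialize (hJ p); lra).
  pose proof (Rabs_pos (fst r)); pose proof (Rabs_pos (snd r)).
  assert (a : Rabs (partial ay V p * fst r - partial ay U p * snd r)
              <= K * (Rabs (fst r) + Rabs (snd r))).
  { eapply Rle_trans; [apply Rabs_triang|]; rewrite Rabs_Ropp, !Rabs_mult.
    pose proof (V1 ay p); pose proof (U1 ay p); nra. }
  assert (b : Rabs (partial ax U p * snd r - partial ax V p * fst r)
              <= K * (Rabs (fst r) + Rabs (snd r))).
  { eapply Rle_trans; [apply Rabs_triang|]; rewrite Rabs_Ropp, !Rabs_mult.
    pose proof (V1 ax p); pose proof (U1 ax p); nra. }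
  unfold L, Rdiv.
  replace (2 * K * / delta * (Rabs (fst r) + Rabs (snd r)))
    with (K * (Rabs (fst r) + Rabs (snd r)) * / delta
          + K * (Rabs (fst r) + Rabs (snd r)) * / delta) by ring.
  apply Rplus_le_compat; apply Rmult_le_compat; auto; try apply Rabs_pos; lra.
Qed.

Let err p q : R * R :=
  (U q - U p - (partial ax U p * (fst q - fst p) + partial ay U p * (snd q - snd p)),
   V q - V p - (partial ax V p * (fst q - fst p) + partial ay V p * (snd q - snd p))).

Let err_bound p q : norm1 (err p q) <= 2 * K * (dist1 p q * dist1 p q).
Proof.
  pose proof (taylor_bound U K p q hU U2); pose proof (taylor_bound V K p q hV V2).
  unfold norm1, err; cbn [fst snd]; lra.
Qed.

(** Exact linearisation: a displacement is the inverse differential of the increment of [Psi], minus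
    that of the Taylor remainder. It serves both local injectivity and the differentiability of the
    inverse. *)
Let step_err p q :
  fst q - fst p = fst (step p (U q - U p, V q - V p)) - fst (step p (err p q)) /\
  snd q - snd p = snd (step p (U q - U p, V q - V p)) - snd (step p (err p q)).
Proof.
  assert (h := J_nz p); unfold step, err; cbn [fst snd]; split; unfold J in *; field; auto.
Qed.

(** Chosen so that [2 * K * L * r0 = / 2]: within this radius the remainder term absorbs at most
    half of the distance in [expand]. *)
Let r0 := / (4 * K * L).

Let r0_pos : 0 < r0.
Proof.
  apply Rinv_0_lt_compat; rewrite Rmult_assoc.
  assert (0 < K * L) by exact (Rmult_lt_0_compat K L K_pos L_pos); lra.
Qed.

Let expand p q : dist1 p q <= r0 -> dist1 p q <= 2 * L * dist1 (Psi p) (Psi q).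
Proof.
  intros h; destruct (step_err p q) as [e1 e2].
  assert (b1 := step_bound p (U q - U p, V q - V p)).
  assert (b2 := step_bound p (err p q)).
  assert (b3 := err_bound p q).
  assert (d : dist1 p q <= norm1 (step p (U q - U p, V q - V p)) + norm1 (step p (err p q))).
  { unfold dist1 at 1, norm1; rewrite e1, e2; clear e1 e2.
    assert (tri : forall a b, Rabs (a - b) <= Rabs a + Rabs b).
    { intros a b; rewrite <- (Rabs_Ropp b); apply Rabs_triang. }
    pose proof (tri (fst (step p (U q - U p, V q - V p))) (fst (step p (err p q)))).
    pose proof (tri (snd (step p (U q - U p, V q - V p))) (snd (step p (err p q)))).
    lra. }
  change (norm1 (U q - U p, V q - V p)) with (dist1 (Psi p) (Psi q)) in b1.
  pose proof (dist1_pos p q); pose proof K_pos; pose proof L_pos.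
  assert (k : 2 * K * L * dist1 p q <= / 2).
  { apply (Rmult_le_compat_l (2 * K * L)) in h; [|nra].
    unfold r0 in h; replace (2 * K * L * / (4 * K * L)) with (/ 2) in h by (field; lra); lra. }
  apply (Rmult_le_compat_l L) in b3; [|lra].
  assert (2 * K * L * dist1 p q * dist1 p q <= / 2 * dist1 p q)
    by (apply Rmult_le_compat_r; auto).
  lra.
Qed.

(** Chosen so that [2 * K * (L * L) * rho = / 2]: a Newton step started with residual at most [rho]
    at least halves it. *)
Let rho := / (4 * K * L * L).

Let rho_pos : 0 < rho.
Proof.
  apply Rinv_0_lt_compat; rewrite !Rmult_assoc.
  assert (k : 0 < L * L) by exact (Rmult_lt_0_compat L L L_pos L_pos).
  assert (0 < K * (L * L)) by exact (Rmult_lt_0_compat K _ K_pos k); lra.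
Qed.

Let newton p z : R * R :=
  let d := step p (fst z - U p, snd z - V p) in (fst p + fst d, snd p + snd d).

Let newton_dist p z : dist1 p (newton p z) <= L * dist1 (Psi p) z.
Proof.
  unfold dist1 at 1, newton; cbn [fst snd].
  replace (fst p + _ - fst p) with (fst (step p (fst z - U p, snd z - V p))) by ring.
  replace (snd p + _ - snd p) with (snd (step p (fst z - U p, snd z - V p))) by ring.
  apply step_bound.
Qed.

(** The linear part of a Newton step hits [z] exactly, so the new residual is precisely the Taylor
    remainder. *)
Let newton_residual p z :
  dist1 (Psi (newton p z)) z <= 2 * K * (L * L) * (dist1 (Psi p) z * dist1 (Psi p) z).
Proof.
  assert (e : dist1 (Psi (newton p z)) z = norm1 (err p (newton p z))).
  { assert (h := J_nz p); rewrite dist1_sym; unfold dist1, norm1, err, newton, step, Psi; cbn [fst snd].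
    f_equal; f_equal; unfold J in *; field; auto. }
  rewrite e; eapply Rle_trans; [apply err_bound|].
  assert (b := newton_dist p z); pose proof (dist1_pos p (newton p z)).
  pose proof (dist1_pos (Psi p) z).
  assert (dist1 p (newton p z) * dist1 p (newton p z) <=
          L * dist1 (Psi p) z * (L * dist1 (Psi p) z)) by (apply Rmult_le_compat; auto).
  pose proof K_pos; nra.
Qed.

Let Psi_lip p q : dist1 (Psi p) (Psi q) <= 2 * K * dist1 p q.
Proof.
  pose proof (lipschitz_bound U K p q hU U1); pose proof (lipschitz_bound V K p q hV V1).
  unfold dist1 at 1; simpl; lra.
Qed.

(** Newton's iteration: residuals halve and the steps are bounded by [L * r * (/ 2) ^ n]. Each
    coordinate of the limit moves by at most [2 * L * r], which gives the factor [4 * L] for the sum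
    of both. *)
Let local_onto p z : dist1 (Psi p) z <= rho ->
  exists q, Psi q = z /\ dist1 p q <= 4 * L * dist1 (Psi p) z.
Proof.
  intros h.
  set (P := fix P n := match n with O => p | S n => newton (P n) z end).
  set (r := dist1 (Psi p) z) in *.
  assert (hr : forall n, dist1 (Psi (P n)) z <= r * (/ 2) ^ n).
  { induction n; [simpl; unfold r; lra|].
    simpl P; eapply Rle_trans; [apply newton_residual|].
    pose proof (dist1_pos (Psi (P n)) z); pose proof K_pos; pose proof L_pos.
    assert (pn : 0 <= (/ 2) ^ n <= 1).
    { clear; induction n; simpl; lra. }
    assert (hn : dist1 (Psi (P n)) z <= rho).
    { eapply Rle_trans; [exact IHn|]; eapply Rle_trans; [|exact h].
      pose proof (dist1_pos (Psi p) z); fold r in H2; nra. }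
    assert (k : 2 * K * (L * L) * dist1 (Psi (P n)) z <= / 2).
    { apply (Rmult_le_compat_l (2 * K * (L * L))) in hn; [|nra].
      unfold rho in hn; replace (2 * K * (L * L) * / (4 * K * L * L)) with (/ 2) in hn
        by (field; lra); lra. }
    simpl; rewrite <- Rmult_assoc.
    apply Rle_trans with (/ 2 * dist1 (Psi (P n)) z); [|lra].
    now apply Rmult_le_compat_r. }
  assert (hd : forall n, dist1 (P n) (P (S n)) <= L * r * (/ 2) ^ n).
  { intros n; simpl P; eapply Rle_trans; [apply newton_dist|].
    pose proof L_pos; specialize (hr n); rewrite Rmult_assoc; apply Rmult_le_compat_l; lra. }
  destruct (geometric_limit (fun n => fst (P n)) (L * r)) as [a [la ba]].
  { intros n; specialize (hd n); unfold dist1 in hd.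
    pose proof (Rabs_pos (snd (P (S n)) - snd (P n))); lra. }
  destruct (geometric_limit (fun n => snd (P n)) (L * r)) as [b [lb bb]].
  { intros n; specialize (hd n); unfold dist1 in hd.
    pose proof (Rabs_pos (fst (P (S n)) - fst (P n))); lra. }
  exists (a, b); split.
  - assert (z0 : is_lim_seq (fun n => dist1 (P n) (a, b)) 0).
    { replace (Finite 0) with (Finite (Rabs (a - a) + Rabs (b - b)))
        by (f_equal; rewrite !Rminus_diag, Rabs_R0; ring).
      apply is_lim_seq_plus'.
      - apply (is_lim_seq_abs _ (a - a)), is_lim_seq_minus'; auto; apply is_lim_seq_const.
      - apply (is_lim_seq_abs _ (b - b)), is_lim_seq_minus'; auto; apply is_lim_seq_const. }
    assert (z1 : is_lim_seq (fun n => r * (/ 2) ^ n) 0).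
    { replace (Finite 0) with (Rbar_mult r 0) by (simpl; f_equal; ring).
      apply is_lim_seq_scal_l, is_lim_seq_geom; rewrite Rabs_right; lra. }
    symmetry; apply dist1_eq.
    assert (z2 : is_lim_seq (fun n => r * (/ 2) ^ n + 2 * K * dist1 (P n) (a, b)) 0).
    { replace (Finite 0) with (Finite (0 + 2 * K * 0)) by (f_equal; ring).
      apply is_lim_seq_plus'; auto.
      apply (is_lim_seq_scal_l _ (2 * K) 0 z0). }
    apply (is_lim_seq_le (fun _ => dist1 z (Psi (a, b)))
      (fun n => r * (/ 2) ^ n + 2 * K * dist1 (P n) (a, b)) (dist1 z (Psi (a, b))) 0); auto.
    + intros n; specialize (hr n).
      pose proof (dist1_triang z (Psi (P n)) (Psi (a, b))).
      pose proof (Psi_lip (P n) (a, b)).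
      rewrite (dist1_sym z (Psi (P n))) in H; lra.
    + apply is_lim_seq_const.
  - unfold dist1; simpl in *; lra.
Qed.

(** As [rho] does not depend on the point, the segment from [Psi (0, 0)] to [z] can be climbed in
    [N] steps, each no longer than [rho]. *)
Let global_onto z : exists q, Psi q = z.
Proof.
  set (w := Psi (0, 0)); set (D := dist1 w z).
  destruct (archimed_cor1 (rho / (D + 1))) as [N [hN pN]].
  { apply Rdiv_lt_0_compat; [apply rho_pos | pose proof (dist1_pos w z); fold D in H; lra]. }
  assert (pN' : 0 < INR N) by (apply lt_0_INR; auto).
  assert (hD : / INR N * D <= rho).
  { pose proof (dist1_pos w z); fold D in H.
    apply Rle_trans with (/ INR N * (D + 1)).
    - assert (0 < / INR N) by (apply Rinv_0_lt_compat; auto); nra.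
    - apply (Rmult_lt_compat_r (D + 1)) in hN; [|lra].
      unfold Rdiv in hN; rewrite Rmult_assoc, Rinv_l, Rmult_1_r in hN; lra. }
  set (y := fun k => (fst w + INR k / INR N * (fst z - fst w),
                      snd w + INR k / INR N * (snd z - snd w))).
  assert (B : forall k, exists q, Psi q = y k).
  { induction k as [|k [q hq]].
    - exists (0, 0); unfold y; simpl; unfold Rdiv; rewrite Rmult_0_l.
      rewrite !Rmult_0_l, !Rplus_0_r; now destruct w.
    - destruct (local_onto q (y (S k))) as [q' [h' _]]; [|now exists q'].
      rewrite hq; eapply Rle_trans; [|exact hD]; apply Req_le.
      unfold dist1, D, y; cbn [fst snd]; rewrite S_INR.
      match goal with |- Rabs ?a + Rabs ?b = _ =>
        replace a with (/ INR N * (fst z - fst w)) by (field; lra);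
        replace b with (/ INR N * (snd z - snd w)) by (field; lra) end.
      rewrite !Rabs_mult, (Rabs_right (/ INR N)); [unfold dist1; ring|].
      apply Rle_ge, Rlt_le, Rinv_0_lt_compat; auto. }
  destruct (B N) as [q hq]; exists q; rewrite hq; unfold y.
  replace (INR N / INR N) with 1 by (field; lra); destruct z; simpl; f_equal; ring.
Qed.

(* The image of the segment from [p] to [q] is a loop; it is contracted to its
   base point in [m] small steps, and each of the [n] sample points is lifted
   along.  Neighbouring samples stay within the injectivity radius [r0]. *)
Let injective p q : Psi p = Psi q -> p = q.
Proof.
  intros eq; set (D := dist1 p q); set (y := Psi p) in *.
  pose proof K_pos; pose proof L_pos; pose proof r0_pos; pose proof rho_pos.
  assert (pKL : 0 < K * L) by (apply Rmult_lt_0_compat; auto).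
  assert (pD : 0 <= D) by apply dist1_pos.
  (* Half the radius of [expand]: neighbours at distance [eta] may drift apart by another [eta]
     during a lift and still be within [r0]. *)
  set (eta := r0 / 2); assert (peta : 0 < eta) by (unfold eta; lra).
  assert (arch : forall c e, 0 <= c -> 0 < e -> exists N, (0 < N)%nat /\ c / INR N <= e).
  { intros c e pc pe; destruct (archimed_cor1 (e / (c + 1))) as [N [hN pN]];
      [apply Rdiv_lt_0_compat; lra|].
    exists N; split; auto.
    apply (Rmult_lt_compat_r (c + 1)) in hN; [|lra].
    unfold Rdiv in *; rewrite Rmult_assoc, Rinv_l, Rmult_1_r in hN by lra.
    assert (0 < / INR N) by (apply Rinv_0_lt_compat, lt_0_INR; auto); nra. }
  (* [n] makes the samples [eta]-close at the start ([n1]) and lets [expand] bring lifted neighbours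
     back to distance [eta] ([n2]). [m] keeps each contraction step within the radius of
     [local_onto] ([m1]) and the joint displacement of two neighbours at most [eta] ([m2]). *)
  destruct (arch (D * (1 + 4 * K * L)) eta) as [n [pn hn]];
    [apply Rmult_le_pos; lra | auto|].
  destruct (arch (2 * K * D * (1 + 8 * L)) (Rmin rho eta)) as [m [pm hm]];
    [apply Rmult_le_pos; [apply Rmult_le_pos|]; lra | apply Rmin_pos; auto |].
  apply lt_0_INR in pn as pn'; apply lt_0_INR in pm as pm'.
  assert (pin : 0 < / INR n) by now apply Rinv_0_lt_compat.
  assert (pim : 0 < / INR m) by now apply Rinv_0_lt_compat.
  set (c := fun i => (fst p + INR i / INR n * (fst q - fst p),
                      snd p + INR i / INR n * (snd q - snd p))).
  assert (cstep : forall i, dist1 (c i) (c (S i)) = D / INR n).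
  { intros i; unfold dist1, c; cbn [fst snd]; rewrite S_INR.
    match goal with |- Rabs ?a + Rabs ?b = _ =>
      replace a with (/ INR n * (fst q - fst p)) by (field; lra);
      replace b with (/ INR n * (snd q - snd p)) by (field; lra) end.
    rewrite !Rabs_mult, (Rabs_right (/ INR n)) by lra; unfold D, dist1; field; lra. }
  assert (cdist : forall i, (i <= n)%nat -> dist1 p (c i) <= D).
  { intros i hi; apply le_INR in hi; pose proof (pos_INR i).
    unfold dist1, c; cbn [fst snd].
    match goal with |- Rabs ?a + Rabs ?b <= _ =>
      replace a with (INR i / INR n * (fst q - fst p)) by ring;
      replace b with (INR i / INR n * (snd q - snd p)) by ring end.
    assert (0 <= INR i / INR n <= 1).
    { split; [apply Rdiv_le_0_compat; lra | apply Rle_div_l; lra]. }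
    rewrite !Rabs_mult, (Rabs_right (INR i / INR n)) by lra.
    pose proof (Rabs_pos (fst q - fst p)); pose proof (Rabs_pos (snd q - snd p)).
    unfold D, dist1; nra. }
  set (w := fun i => Psi (c i)).
  assert (w0 : w O = y).
  { unfold w, c, y; simpl INR; f_equal; unfold Rdiv; rewrite !Rmult_0_l, !Rplus_0_r;
      now destruct p. }
  assert (cn : c n = q).
  { unfold c; replace (INR n / INR n) with 1 by (field; lra).
    destruct q; simpl; f_equal; ring. }
  assert (c0 : c O = p).
  { unfold c; simpl INR; unfold Rdiv; rewrite !Rmult_0_l, !Rplus_0_r; now destruct p. }
  set (H' := fun j i => (fst y + (1 - INR j / INR m) * (fst (w i) - fst y),
                        snd y + (1 - INR j / INR m) * (snd (w i) - snd y))).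
  assert (Hstep : forall j i, (i <= n)%nat ->
    dist1 (H' j i) (H' (S j) i) <= / INR m * (2 * K * D)).
  { intros j i hi; unfold dist1, H'; cbn [fst snd]; rewrite S_INR.
    match goal with |- Rabs ?a + Rabs ?b <= _ =>
      replace a with (- / INR m * (fst (w i) - fst y)) by (field; lra);
      replace b with (- / INR m * (snd (w i) - snd y)) by (field; lra) end.
    rewrite !Rabs_mult, Rabs_Ropp, (Rabs_right (/ INR m)) by lra.
    rewrite <- Rmult_plus_distr_l; apply Rmult_le_compat_l; [lra|].
    apply Rle_trans with (2 * K * dist1 p (c i)); [apply (Psi_lip p (c i))|].
    apply Rmult_le_compat_l; [lra | auto]. }
  assert (Hloop : forall j, (j <= m)%nat -> H' j O = y /\ H' j n = y).
  { intros j _; unfold H'; rewrite w0; unfold w; rewrite cn, <- eq.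
    rewrite !Rminus_diag, !Rmult_0_r, !Rplus_0_r; destruct y; auto. }
  assert (Hnbr : forall j i, (j <= m)%nat ->
    dist1 (H' j i) (H' j (S i)) <= 2 * K * (D / INR n)).
  { intros j i hj; apply le_INR in hj; pose proof (pos_INR j).
    unfold dist1, H'; cbn [fst snd].
    match goal with |- Rabs ?a + Rabs ?b <= _ =>
      replace a with ((1 - INR j / INR m) * (fst (w (S i)) - fst (w i))) by ring;
      replace b with ((1 - INR j / INR m) * (snd (w (S i)) - snd (w i))) by ring end.
    assert (0 <= INR j / INR m <= 1).
    { split; [apply Rdiv_le_0_compat; lra | apply Rle_div_l; lra]. }
    rewrite !Rabs_mult, (Rabs_right (1 - INR j / INR m)) by lra.
    assert (b := Psi_lip (c i) (c (S i))); rewrite cstep in b; unfold dist1 in b.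
    fold (w i) in b; fold (w (S i)) in b.
    pose proof (Rabs_pos (fst (w (S i)) - fst (w i))).
    pose proof (Rabs_pos (snd (w (S i)) - snd (w i))); nra. }
  pose proof (Rmin_l rho eta); pose proof (Rmin_r rho eta).
  assert (p1 : 0 <= / INR m * (2 * K * D)) by (repeat apply Rmult_le_pos; lra).
  assert (p2 : 0 <= / INR m * (2 * K * D) * L) by (apply Rmult_le_pos; lra).
  replace (2 * K * D * (1 + 8 * L) / INR m)
    with (/ INR m * (2 * K * D) + 8 * (/ INR m * (2 * K * D) * L)) in hm by (field; lra).
  assert (m1 : / INR m * (2 * K * D) <= rho) by lra.
  assert (m2 : 8 * (/ INR m * (2 * K * D) * L) <= eta) by lra.
  assert (p3 : 0 <= D / INR n) by (apply Rdiv_le_0_compat; lra).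
  assert (p4 : 0 <= K * L * (D / INR n)) by (apply Rmult_le_pos; lra).
  replace (D * (1 + 4 * K * L) / INR n) with (D / INR n + 4 * (K * L * (D / INR n))) in hn
    by (field; lra).
  assert (n1 : D / INR n <= eta) by lra.
  assert (n2 : 2 * L * (2 * K * (D / INR n)) <= eta) by lra.
  (* The end points of the lifted polygon never move: the loop rests at its base point there, and
     [local_onto] moves a point by at most a multiple of the zero distance. *)
  assert (B : forall j, (j <= m)%nat -> exists P : nat -> R * R,
    (forall i, (i <= n)%nat -> Psi (P i) = H' j i) /\ P O = p /\ P n = q /\
    (forall i, (i < n)%nat -> dist1 (P i) (P (S i)) <= eta)).
  { induction j as [|j IH]; intros hj.
    - exists c; split; [|split; [exact c0 | split; [exact cn|]]].
      + intros i _; unfold H'; simpl INR; unfold Rdiv; rewrite Rmult_0_l.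
        change (Psi (c i)) with (w i); destruct (w i); simpl; f_equal; ring.
      + intros i _; rewrite cstep; exact n1.
    - destruct (IH ltac:(lia)) as [P [hP [P0 [Pn Pd]]]].
      assert (ex : forall i, exists q', (i <= n)%nat -> Psi q' = H' (S j) i /\
        dist1 (P i) q' <= 4 * L * dist1 (H' j i) (H' (S j) i)).
      { intros i; destruct (le_dec i n) as [hi | hi]; [|exists p; lia].
        destruct (local_onto (P i) (H' (S j) i)) as [q' h'].
        - rewrite hP by auto; eapply Rle_trans; [apply Hstep; auto | exact m1].
        - rewrite hP in h' by auto; exists q'; auto. }
      set (P' := fun i => proj1_sig (constructive_indefinite_description _ (ex i))).
      assert (hP' : forall i, (i <= n)%nat -> Psi (P' i) = H' (S j) i /\
        dist1 (P i) (P' i) <= 4 * L * dist1 (H' j i) (H' (S j) i)).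
      { intros i; unfold P'; destruct constructive_indefinite_description; auto. }
      exists P'; split; [intros i hi; now apply hP'|].
      destruct (Hloop j ltac:(lia)) as [l1 l2]; destruct (Hloop (S j) hj) as [l3 l4].
      split; [|split].
      + rewrite <- P0; symmetry; apply dist1_eq.
        destruct (hP' O ltac:(lia)) as [_ h]; rewrite l1, l3, dist1_refl in h; lra.
      + rewrite <- Pn; symmetry; apply dist1_eq.
        destruct (hP' n ltac:(lia)) as [_ h]; rewrite l2, l4, dist1_refl in h; lra.
      + intros i hi.
        destruct (hP' i ltac:(lia)) as [a1 a2]; destruct (hP' (S i) ltac:(lia)) as [b1 b2].
        assert (s1 := Hstep j i ltac:(lia)); assert (s2 := Hstep j (S i) ltac:(lia)).
        specialize (Pd i hi).
        assert (t1 := dist1_triang (P' i) (P i) (P' (S i))).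
        assert (t2 := dist1_triang (P i) (P (S i)) (P' (S i))).
        rewrite (dist1_sym (P' i) (P i)) in t1.
        apply (Rmult_le_compat_l (4 * L)) in s1; [|lra].
        apply (Rmult_le_compat_l (4 * L)) in s2; [|lra].
        assert (near : dist1 (P' i) (P' (S i)) <= r0) by (unfold eta in *; lra).
        apply expand in near; rewrite a1, b1 in near.
        assert (s3 := Hnbr (S j) i hj); apply (Rmult_le_compat_l (2 * L)) in s3; lra. }
  destruct (B m (le_n m)) as [P [hP [P0 [Pn Pd]]]].
  (* At the last level every sample lies over [y], so [expand] forces neighbouring lifts to
     coincide. *)
  assert (cst : forall i, (i <= n)%nat -> P i = p).
  { induction i; intros hi; auto.
    rewrite <- (IHi ltac:(lia)); symmetry; apply dist1_eq.
    assert (Hm : forall i, H' m i = y).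
    { intros k; unfold H'; replace (INR m / INR m) with 1 by (field; lra).
      rewrite Rminus_diag, !Rmult_0_l, !Rplus_0_r; now destruct y. }
    assert (near : dist1 (P i) (P (S i)) <= r0) by (specialize (Pd i hi); unfold eta in *; lra).
    apply expand in near; rewrite !hP, !Hm, dist1_refl in near by lia; lra. }
  rewrite <- Pn; symmetry; apply cst; auto.
Qed.

(** The inverse exists by choice. [local_onto] together with injectivity makes it Lipschitz at small
    scale with constant [4 * L], so remainders that are quadratic upstairs are quadratic downstairs
    as well. *)
Lemma hadamard : exists Phi1 Phi2 : R * R -> R, smooth Phi1 /\ smooth Phi2 /\
  (forall p, (Phi1 (U p, V p), Phi2 (U p, V p)) = p) /\
  (forall z, (U (Phi1 z, Phi2 z), V (Phi1 z, Phi2 z)) = z).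
Proof.
  set (Phi := fun z => proj1_sig (constructive_indefinite_description _ (global_onto z))).
  assert (h1 : forall z, Psi (Phi z) = z).
  { intros z; unfold Phi; destruct constructive_indefinite_description; auto. }
  assert (h2 : forall p, Phi (Psi p) = p).
  { intros p; apply injective, h1. }
  assert (near : forall z z', dist1 z z' <= rho -> dist1 (Phi z) (Phi z') <= 4 * L * dist1 z z').
  { intros z z' h; destruct (local_onto (Phi z) z') as [q [e d]].
    - now rewrite h1.
    - rewrite h1 in d; replace (Phi z') with q; auto; apply injective; now rewrite h1. }
  pose proof K_pos; pose proof L_pos; pose proof rho_pos.
  (* Origin of the constant: the remainder is at most [2 * K] times the square of a distance that is
     itself at most [4 * L] times the distance of the images, and [step] costs a factor [L]. *)
  assert (lin : forall z z', dist1 z z' <= rho ->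
    Rabs (fst (Phi z') - fst (Phi z) - fst (step (Phi z) (fst z' - fst z, snd z' - snd z)))
      <= L * (2 * K * (16 * L * L)) * (dist1 z z' * dist1 z z') /\
    Rabs (snd (Phi z') - snd (Phi z) - snd (step (Phi z) (fst z' - fst z, snd z' - snd z)))
      <= L * (2 * K * (16 * L * L)) * (dist1 z z' * dist1 z z')).
  { intros z z' h; assert (d := near z z' h).
    destruct (step_err (Phi z) (Phi z')) as [e1 e2].
    assert (b2 := step_bound (Phi z) (err (Phi z) (Phi z'))).
    assert (b3 := err_bound (Phi z) (Phi z')).
    assert (eU : forall x, U (Phi x) = fst x) by (intros x; exact (f_equal fst (h1 x))).
    assert (eV : forall x, V (Phi x) = snd x) by (intros x; exact (f_equal snd (h1 x))).
    rewrite !eU, !eV in e1, e2; rewrite e1, e2; clear e1 e2.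
    pose proof (dist1_pos (Phi z) (Phi z')); pose proof (dist1_pos z z').
    assert (b4 : dist1 (Phi z) (Phi z') * dist1 (Phi z) (Phi z') <=
                 4 * L * dist1 z z' * (4 * L * dist1 z z')) by (apply Rmult_le_compat; auto).
    apply (Rmult_le_compat_l (2 * K)) in b4; [|lra].
    apply (Rle_trans _ _ _ b3) in b4.
    apply (Rmult_le_compat_l L) in b4; [|lra].
    apply (Rle_trans _ _ _ b2) in b4.
    unfold norm1 in b4.
    pose proof (Rabs_pos (fst (step (Phi z) (err (Phi z) (Phi z'))))).
    pose proof (Rabs_pos (snd (step (Phi z) (err (Phi z) (Phi z'))))).
    match goal with |- Rabs ?a <= _ /\ Rabs ?b <= _ =>
      replace a with (- fst (step (Phi z) (err (Phi z) (Phi z')))) by ring;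
      replace b with (- snd (step (Phi z) (err (Phi z) (Phi z')))) by ring end.
    rewrite !Rabs_Ropp; lra. }
  set (d1 := fun i (p : R * R) => match i with ax => partial ay V p * / J p
                                             | ay => - partial ay U p * / J p end).
  set (d2 := fun i (p : R * R) => match i with ax => - partial ax V p * / J p
                                             | ay => partial ax U p * / J p end).
  assert (D12 : forall i z, is_partial i (fun z => fst (Phi z)) z (d1 i (Phi z)) /\
                            is_partial i (fun z => snd (Phi z)) z (d2 i (Phi z))).
  { assert (dx : forall x y h, dist1 (x, y) (x + h, y) = Rabs h).
    { intros x y h; unfold dist1; cbn [fst snd].
      rewrite Rplus_minus_l, Rminus_diag, Rabs_R0; ring. }
    assert (dy : forall x y h, dist1 (x, y) (x, y + h) = Rabs h).
    { intros x y h; unfold dist1; cbn [fst snd].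
      rewrite Rplus_minus_l, Rminus_diag, Rabs_R0; ring. }
    intros [] [x y]; split;
      apply (is_derive_quadratic _ _ _ (L * (2 * K * (16 * L * L))) rho); auto; intros h hh;
      cbn [fst snd].
    1, 2: destruct (lin (x, y) (x + h, y)) as [l1 l2]; [now rewrite dx | rewrite dx in l1, l2].
    3, 4: destruct (lin (x, y) (x, y + h)) as [l1 l2]; [now rewrite dy | rewrite dy in l1, l2].
    all: first [refine (Rle_trans _ _ _ (Req_le _ _ _) l1); f_equal; f_equal; []
               | refine (Rle_trans _ _ _ (Req_le _ _ _) l2); f_equal; f_equal; []].
    all:  unfold d1, d2, step; cbn [fst snd]; rewrite Rplus_minus_l, Rminus_diag;
      unfold Rdiv; ring. }
  assert (sJ : smooth (fun p => / J p)) by (apply smooth_inv; auto; unfold J; smooth_tac).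
  assert (sd1 : forall i, smooth (d1 i)) by (intros []; unfold d1; smooth_tac).
  assert (sd2 : forall i, smooth (d2 i)) by (intros []; unfold d2; smooth_tac).
  assert (cont : forall z, continuous (fun z => fst (Phi z)) z /\ continuous (fun z => snd (Phi z)) z).
  { intros z; split; apply continuous_2d; intros eps.
    all: assert (pd : 0 < Rmin (rho / 2) (eps / (8 * L + 1) / 2)) by
      (apply Rmin_pos; [lra|]; apply Rdiv_lt_0_compat; [|lra]; apply Rdiv_lt_0_compat;
       [apply cond_pos | lra]).
    all: exists (mkposreal _ pd); cbn [pos fst snd]; intros u v hu hv.
    all: pose proof (Rmin_l (rho / 2) (eps / (8 * L + 1) / 2));
      pose proof (Rmin_r (rho / 2) (eps / (8 * L + 1) / 2)).
    all: assert (n := near z (u, v)).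
    all: assert (dz : dist1 z (u, v) < 2 * Rmin (rho / 2) (eps / (8 * L + 1) / 2))
      by (unfold dist1; cbn [fst snd]; lra).
    all: specialize (n ltac:(lra)).
    all: assert (4 * L * dist1 z (u, v) < eps) by
     (assert (k : dist1 z (u, v) < eps / (8 * L + 1)) by lra;
      apply (Rmult_lt_compat_r (8 * L + 1)) in k; [|lra];
      unfold Rdiv in k; rewrite Rmult_assoc, Rinv_l, Rmult_1_r in k by lra;
      pose proof (dist1_pos z (u, v)); nra).
    all: rewrite <- surjective_pairing; refine (Rle_lt_trans _ _ _ (Rle_trans _ _ _ _ n) H4);
      unfold dist1; pose proof (Rabs_pos (fst (Phi (u, v)) - fst (Phi z)));
      pose proof (Rabs_pos (snd (Phi (u, v)) - snd (Phi z))); lra. }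
  (* Bootstrap: the partials of [Phi] are the smooth functions [d1], [d2] evaluated at [Phi], so
     each order follows from the previous one. *)
  assert (sm : forall k, Ck k (fun z => fst (Phi z)) /\ Ck k (fun z => snd (Phi z))).
  { induction k as [|k [c1 c2]]; [split; intros z; apply cont|].
    split.
    - apply (Ck_intro _ _ (fun i z => d1 i (Phi z))); [intros i z; apply D12|].
      intros i; replace (fun z => d1 i (Phi z)) with (fun z => d1 i (fst (Phi z), snd (Phi z)))
        by (apply functional_extensionality; intros z; now destruct (Phi z)).
      apply (Ck_comp2 k (d1 i)); auto.
    - apply (Ck_intro _ _ (fun i z => d2 i (Phi z))); [intros i z; apply D12|].
      intros i; replace (fun z => d2 i (Phi z)) with (fun z => d2 i (fst (Phi z), snd (Phi z)))
        by (apply functional_extensionality; intros z; now destruct (Phi z)).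
      apply (Ck_comp2 k (d2 i)); auto. }
  exists (fun z => fst (Phi z)), (fun z => snd (Phi z)).
  split; [intros k; apply sm | split; [intros k; apply sm | split]].
  - intros p; change (U p, V p) with (Psi p); rewrite h2; now destruct p.
  - intros z; rewrite <- (h1 z) at 5; unfold Psi; now destruct (Phi z).
Qed.

End Hadamard.


(** * Quaternions *)

Definition qm (x y : quat R) : quat R :=
  Quat (q0 x * q0 y - q1 x * q1 y - q2 x * q2 y - q3 x * q3 y)
       (q0 x * q1 y + q1 x * q0 y + q2 x * q3 y - q3 x * q2 y)
       (q0 x * q2 y - q1 x * q3 y + q2 x * q0 y + q3 x * q1 y)
       (q0 x * q3 y + q1 x * q2 y - q2 x * q1 y + q3 x * q0 y).
Definition qc (x : quat R) : quat R := Quat (q0 x) (- q1 x) (- q2 x) (- q3 x).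
Definition qs (r : R) : quat R -> quat R := qmap (Rmult r).
Definition qadd : quat R -> quat R -> quat R := qmap2 Rplus.
Definition qsub (x y : quat R) : quat R := qadd x (qs (-1) y).
Definition qim (x : quat R) : quat R := Quat 0 (q1 x) (q2 x) (q3 x).
Definition qone : quat R := Quat 1 0 0 0.

Ltac qring :=
  intros; repeat match goal with x : quat R |- _ => destruct x end;
  cbv [qm qc qs qadd qsub qim qone qdot qmap qmap2 q0 q1 q2 q3];
  first [ring | f_equal; ring].

Lemma qmA x y z : qm x (qm y z) = qm (qm x y) z. Proof. qring. Qed.
Lemma qc_qm x y : qc (qm x y) = qm (qc y) (qc x). Proof. qring. Qed.
Lemma qc_qc x : qc (qc x) = x. Proof. qring. Qed.
Lemma qm1l x : qm qone x = x. Proof. qring. Qed.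
Lemma qm1r x : qm x qone = x. Proof. qring. Qed.
Lemma qm_qc_qs x : qm x (qc x) = qs (qdot x x) qone. Proof. qring. Qed.
Lemma qc_qm_qs x : qm (qc x) x = qs (qdot x x) qone. Proof. qring. Qed.
Lemma qs1 x : qs 1 x = x. Proof. qring. Qed.
Lemma qdot_comm x y : qdot x y = qdot y x. Proof. qring. Qed.
Lemma qdot_qc x y : qdot (qc x) (qc y) = qdot x y. Proof. qring. Qed.
Lemma qdot_qm_r x y z : qdot (qm x z) (qm y z) = qdot x y * qdot z z. Proof. qring. Qed.
Lemma qdot_qm_l x y z : qdot (qm z x) (qm z y) = qdot x y * qdot z z. Proof. qring. Qed.
Lemma qdot_q0 x y : qdot x y = q0 (qm x (qc y)). Proof. qring. Qed.
Lemma qdot_qadd_l x y z : qdot (qadd x y) z = qdot x z + qdot y z. Proof. qring. Qed.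
Lemma qdot_qadd_r x y z : qdot x (qadd y z) = qdot x y + qdot x z. Proof. qring. Qed.
Lemma qdot_qs_l r x y : qdot (qs r x) y = r * qdot x y. Proof. qring. Qed.
Lemma qdot_qs_r r x y : qdot x (qs r y) = r * qdot x y. Proof. qring. Qed.

Lemma S3_qc x : S3 x -> S3 (qc x).
Proof. unfold S3; now rewrite qdot_qc. Qed.

Lemma S3_qm x y : S3 x -> S3 y -> S3 (qm x y).
Proof. unfold S3; intros hx hy; rewrite qdot_qm_r, hx, hy; ring. Qed.

Lemma S3_inv x : S3 x -> qm x (qc x) = qone /\ qm (qc x) x = qone.
Proof. unfold S3; intros h; rewrite qm_qc_qs, qc_qm_qs, h, qs1; auto. Qed.

Lemma S3_cancel_r x y : S3 y -> qm (qm x y) (qc y) = x.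
Proof. intros h; rewrite <- qmA, (proj1 (S3_inv y h)); apply qm1r. Qed.

Lemma S3_cancel_r' x y : S3 y -> qm (qm x (qc y)) y = x.
Proof. intros h; rewrite <- qmA, (proj2 (S3_inv y h)); apply qm1r. Qed.

Lemma S3_cancel_l x y : S3 y -> qm (qc y) (qm y x) = x.
Proof. intros h; rewrite qmA, (proj2 (S3_inv y h)); apply qm1l. Qed.

Lemma S3_cancel_l' x y : S3 y -> qm y (qm (qc y) x) = x.
Proof. intros h; rewrite qmA, (proj1 (S3_inv y h)); apply qm1l. Qed.

Lemma quat_ext (x y : quat R) :
  q0 x = q0 y -> q1 x = q1 y -> q2 x = q2 y -> q3 x = q3 y -> x = y.
Proof. destruct x, y; simpl; now intros -> -> -> ->. Qed.

Lemma smooth4_partial F i : smooth4 F -> smooth4 (partial4 i F).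
Proof.
  intros (h0 & h1 & h2 & h3); repeat split; cbn [q0 q1 q2 q3 partial4];
    [apply (smooth_partial (fun r => q0 (F r))) | apply (smooth_partial (fun r => q1 (F r)))
    | apply (smooth_partial (fun r => q2 (F r))) | apply (smooth_partial (fun r => q3 (F r)))];
    auto.
Qed.

Lemma smooth4_const c : smooth4 (fun _ => c).
Proof. repeat split; apply smooth_const. Qed.

Ltac smooth4_tac :=
  repeat match goal with h : smooth4 _ |- _ => destruct h as (? & ? & ? & ?) end;
  repeat split; cbn [q0 q1 q2 q3 qm qc qs qadd qsub qim qdot qmap qmap2];
  smooth_tac.

Lemma smooth4_qm A B : smooth4 A -> smooth4 B -> smooth4 (fun p => qm (A p) (B p)).
Proof. intros; smooth4_tac. Qed.

Lemma smooth4_qc A : smooth4 A -> smooth4 (fun p => qc (A p)).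
Proof. intros; smooth4_tac. Qed.

Lemma smooth4_qim A : smooth4 A -> smooth4 (fun p => qim (A p)).
Proof. intros; smooth4_tac. Qed.

Lemma smooth4_qs f A : smooth f -> smooth4 A -> smooth4 (fun p => qs (f p) (A p)).
Proof. intros; smooth4_tac. Qed.

Lemma smooth4_qadd A B : smooth4 A -> smooth4 B -> smooth4 (fun p => qadd (A p) (B p)).
Proof. intros; smooth4_tac. Qed.

Lemma smooth_qdot A B : smooth4 A -> smooth4 B -> smooth (fun p => qdot (A p) (B p)).
Proof. intros; unfold qdot; smooth4_tac. Qed.

Lemma smooth4_comp A u v : smooth4 A -> smooth u -> smooth v ->
  smooth4 (fun p => A (u p, v p)).
Proof.
  intros (h0 & h1 & h2 & h3) hu hv; repeat split;
    [apply (smooth_comp2 (fun r => q0 (A r))) | apply (smooth_comp2 (fun r => q1 (A r)))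
    | apply (smooth_comp2 (fun r => q2 (A r))) | apply (smooth_comp2 (fun r => q3 (A r)))];
    auto.
Qed.

Ltac partial4_tac :=
  repeat match goal with h : smooth4 _ |- _ => destruct h as (? & ? & ? & ?) end;
  unfold partial4, qdot, qm, qc, qs, qadd, qsub, qmap, qmap2; cbn [q0 q1 q2 q3];
  try apply quat_ext; cbn [q0 q1 q2 q3];
  (etransitivity; [apply is_partial_eq; partial_tac | cbn beta; try ring]).

Lemma partial_qdot i A B p : smooth4 A -> smooth4 B ->
  partial i (fun r => qdot (A r) (B r)) p
    = qdot (partial4 i A p) (B p) + qdot (A p) (partial4 i B p).
Proof. intros; partial4_tac. Qed.

Lemma partial4_qm i A B p : smooth4 A -> smooth4 B ->
  partial4 i (fun r => qm (A r) (B r)) p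
    = qadd (qm (partial4 i A p) (B p)) (qm (A p) (partial4 i B p)).
Proof. intros; partial4_tac. Qed.

Lemma partial4_qc i A p : smooth4 A -> partial4 i (fun r => qc (A r)) p = qc (partial4 i A p).
Proof. intros; partial4_tac. Qed.

Lemma partial4_qs i f A p : smooth f -> smooth4 A ->
  partial4 i (fun r => qs (f r) (A r)) p
    = qadd (qs (partial i f p) (A p)) (qs (f p) (partial4 i A p)).
Proof. intros; partial4_tac. Qed.

Lemma partial4_const i c p : partial4 i (fun _ => c) p = Quat 0 0 0 0.
Proof. partial4_tac. Qed.

Lemma partial4_comp i A u v p : smooth4 A -> smooth u -> smooth v ->
  partial4 i (fun r => A (u r, v r)) p
    = qadd (qs (partial i u p) (partial4 ax A (u p, v p)))
           (qs (partial i v p) (partial4 ay A (u p, v p))).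
Proof.
  intros (h0 & h1 & h2 & h3) hu hv.
  assert (c : forall f, smooth f -> partial i (fun r => f (u r, v r)) p =
    partial i u p * partial ax f (u p, v p) + partial i v p * partial ay f (u p, v p)).
  { intros f hf.
    rewrite (is_partial_eq i _ p _ (is_partial_comp2 i f u v p _ _ (hf 1%nat)
      (smooth_is u i p hu) (smooth_is v i p hv))); ring. }
  unfold partial4, qadd, qs, qmap, qmap2; cbn [q0 q1 q2 q3]; f_equal.
  - apply (c (fun r => q0 (A r)) h0).
  - apply (c (fun r => q1 (A r)) h1).
  - apply (c (fun r => q2 (A r)) h2).
  - apply (c (fun r => q3 (A r)) h3).
Qed.

Lemma partial4_Schwarz F p : smooth4 F ->
  partial4 ax (partial4 ay F) p = partial4 ay (partial4 ax F) p.
Proof.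
  intros (h0 & h1 & h2 & h3); apply quat_ext.
  - exact (smooth_Schwarz (fun r => q0 (F r)) p h0).
  - exact (smooth_Schwarz (fun r => q1 (F r)) p h1).
  - exact (smooth_Schwarz (fun r => q2 (F r)) p h2).
  - exact (smooth_Schwarz (fun r => q3 (F r)) p h3).
Qed.

(** * The Gauss equation *)

Lemma partial_metric F i j k p : smooth4 F ->
  partial i (induced_metric F j k) p
    = qdot (partial4 i (partial4 j F) p) (partial4 k F p)
    + qdot (partial4 j F p) (partial4 i (partial4 k F) p).
Proof. intros h; unfold induced_metric; apply partial_qdot; now apply smooth4_partial. Qed.

Lemma smooth_metric F i j : smooth4 F -> smooth (induced_metric F i j).
Proof. intros h; unfold induced_metric; apply smooth_qdot; now apply smooth4_partial. Qed.

Lemma metric_sym F i j p : induced_metric F i j p = induced_metric F j i p.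
Proof. apply qdot_comm. Qed.

(** For an induced metric the usual combination of three derivatives collapses, by symmetry of
    second derivatives, to twice the scalar product of [F_ij] with [F_l]. *)
Lemma christoffel_first_kind F k i j p : smooth4 F ->
  christoffel (induced_metric F) k i j p =
    metric_inv (induced_metric F) k ax p * qdot (partial4 i (partial4 j F) p) (partial4 ax F p)
  + metric_inv (induced_metric F) k ay p * qdot (partial4 i (partial4 j F) p) (partial4 ay F p).
Proof.
  intros hF; unfold christoffel, sum_axis; rewrite !partial_metric by auto.
  assert (sy := partial4_Schwarz F p hF).
  assert (b : forall l,
    qdot (partial4 i (partial4 j F) p) (partial4 l F p)
    + qdot (partial4 j F p) (partial4 i (partial4 l F) p)
    + (qdot (partial4 j (partial4 i F) p) (partial4 l F p)
       + qdot (partial4 i F p) (partial4 j (partial4 l F) p))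
    - (qdot (partial4 l (partial4 i F) p) (partial4 j F p)
       + qdot (partial4 i F p) (partial4 l (partial4 j F) p))
    = 2 * qdot (partial4 i (partial4 j F) p) (partial4 l F p)).
  { assert (s : forall u v, partial4 u (partial4 v F) p = partial4 v (partial4 u F) p)
      by (intros [] []; auto).
    intros l; rewrite (s j i), (s l i), (s l j), (qdot_comm (partial4 j F p)); ring. }
  rewrite !b; field.
Qed.

Lemma smooth_christoffel F k i j : smooth4 F ->
  (forall p, metric_det (induced_metric F) p <> 0) ->
  smooth (christoffel (induced_metric F) k i j).
Proof.
  intros hF nz.
  replace (christoffel (induced_metric F) k i j) with
    (fun p => metric_inv (induced_metric F) k ax p * qdot (partial4 i (partial4 j F) p) (partial4 ax F p)
  + metric_inv (induced_metric F) k ay p * qdot (partial4 i (partial4 j F) p) (partial4 ay F p))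
    by (apply functional_extensionality; intros p; now rewrite christoffel_first_kind).
  assert (sm := fun i j => smooth_metric F i j hF).
  assert (sd : smooth (fun p => / metric_det (induced_metric F) p)).
  { apply smooth_inv; auto; unfold metric_det.
    apply smooth_minus; apply smooth_mult; apply sm. }
  assert (si : forall l, smooth (metric_inv (induced_metric F) k l)).
  { intros l; unfold metric_inv; destruct k, l; (apply smooth_mult; [|exact sd]);
      try apply smooth_opp; apply sm. }
  apply smooth_plus; apply smooth_mult; auto; apply smooth_qdot;
    repeat apply smooth4_partial; auto.
Qed.

(** Undoing the inverse metric: the Christoffel symbols are the coefficients of the tangential part
    of [F_ij]. *)
Lemma christoffel_lower F i j l p : smooth4 F ->
  metric_det (induced_metric F) p <> 0 ->
  qdot (partial4 i (partial4 j F) p) (partial4 l F p) =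
    christoffel (induced_metric F) ax i j p * induced_metric F ax l p
  + christoffel (induced_metric F) ay i j p * induced_metric F ay l p.
Proof.
  intros hF nz; rewrite !christoffel_first_kind by auto.
  unfold metric_inv, metric_det in *; rewrite (metric_sym F ay ax) in *.
  destruct l; rewrite ?(metric_sym F ay ax); field; auto.
Qed.

(** Vanishing curvature stated without a normal vector: each side is a scalar product of second
    derivatives from which the tangential part has been removed. It arises from [christoffel_lower],
    differentiated in two ways that share the same third derivative of [F]. *)
Lemma flat_gauss_christoffel F p : smooth4 F ->
  (forall p, metric_det (induced_metric F) p <> 0) -> flat (induced_metric F) ->
  let G := christoffel (induced_metric F) in
  let F2 i j := partial4 i (partial4 j F) p in
  qdot (F2 ax ay) (F2 ax ay)
    - (G ax ax ay p * qdot (partial4 ax F p) (F2 ax ay)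
       + G ay ax ay p * qdot (partial4 ay F p) (F2 ax ay))
  = qdot (F2 ax ax) (F2 ay ay)
    - (G ax ax ax p * qdot (partial4 ax F p) (F2 ay ay)
       + G ay ax ax p * qdot (partial4 ay F p) (F2 ay ay)).
Proof.
  intros hF nz fl G F2; set (h := induced_metric F) in *.
  assert (sG : forall k i j, smooth (G k i j)) by (intros; now apply smooth_christoffel).
  assert (sm : forall i j, smooth (h i j)) by (intros; now apply smooth_metric).
  assert (s1 : forall i, smooth4 (partial4 i F)) by (intros; now apply smooth4_partial).
  assert (s2 : forall i j, smooth4 (partial4 i (partial4 j F)))
    by (intros; now repeat apply smooth4_partial).
  assert (D : forall u i j l,
    qdot (partial4 u (partial4 i (partial4 j F)) p) (partial4 l F p) + qdot (F2 i j) (F2 u l) =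
    (partial u (G ax i j) p * h ax l p
      + G ax i j p * (qdot (F2 u ax) (partial4 l F p) + qdot (partial4 ax F p) (F2 u l)))
    + (partial u (G ay i j) p * h ay l p
      + G ay i j p * (qdot (F2 u ay) (partial4 l F p) + qdot (partial4 ay F p) (F2 u l)))).
  { intros u i j l.
    assert (e : (fun p => qdot (partial4 i (partial4 j F) p) (partial4 l F p)) =
                (fun p => G ax i j p * h ax l p + G ay i j p * h ay l p)).
    { apply functional_extensionality; intros; now apply christoffel_lower. }
    assert (e1 := partial_qdot u (partial4 i (partial4 j F)) (partial4 l F) p (s2 i j) (s1 l)).
    rewrite e in e1; rewrite (is_partial_eq u (fun p => G ax i j p * h ax l p + G ay i j p * h ay l p) p _
      (is_partial_plus _ _ _ _ _ _
       (is_partial_mult _ _ _ _ _ _ (smooth_is _ u p (sG ax i j)) (smooth_is _ u p (sm ax l)))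
       (is_partial_mult _ _ _ _ _ _ (smooth_is _ u p (sG ay i j)) (smooth_is _ u p (sm ay l))))) in e1.
    unfold h in e1; rewrite !partial_metric in e1 by auto; fold h in e1.
    unfold F2; lra. }
  (* The third derivatives in [E1] and [E2] agree by Schwarz. The derivatives of Christoffel symbols
     left over are eliminated by the two curvature equations [R1] and [R2], lowered with the
     metric. *)
  assert (E1 := D ax ay ax ay); assert (E2 := D ay ax ax ay).
  assert (sy : F2 ay ax = F2 ax ay) by (symmetry; now apply partial4_Schwarz).
  rewrite (partial4_Schwarz (partial4 ax F) p (s1 ax)) in E1.
  assert (R1 := fl ax ax ax ay p); assert (R2 := fl ay ax ax ay p).
  unfold riemann, sum_axis in R1, R2; fold G in R1, R2.
  assert (L : forall i j, qdot (F2 i j) (partial4 ay F p) =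
    G ax i j p * h ax ay p + G ay i j p * h ay ay p)
    by (intros; now apply christoffel_lower).
  rewrite sy, !L in E1, E2.
  apply (f_equal (fun r => r * h ax ay p)) in R1; apply (f_equal (fun r => r * h ay ay p)) in R2.
  assert (gs : forall k, G k ay ax = G k ax ay).
  { intros k; apply functional_extensionality; intros q; unfold G.
    unfold h; rewrite !christoffel_first_kind by auto.
    now rewrite (partial4_Schwarz F q hF). }
  rewrite !gs in *; lra.
Qed.


(** * Imaginary quaternions *)

Definition imag (x : quat R) : Prop := q0 x = 0.
Definition triple (x y z : quat R) : R := qdot (qm x y) z.

Ltac quat_cbv := cbv [qm qc qs qadd qsub qim qone qdot qmap qmap2 q0 q1 q2 q3].
Ltac quat_cbv_in h := cbv [qm qc qs qadd qsub qim qone qdot qmap qmap2 q0 q1 q2 q3] in h.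

Ltac qdot_expand :=
  unfold qsub; repeat rewrite ?qdot_qadd_l, ?qdot_qadd_r, ?qdot_qs_l, ?qdot_qs_r.

Ltac imag_ring :=
  intros; repeat match goal with x : quat R |- _ => destruct x end;
  unfold imag in *; cbn [q0 q1 q2 q3] in *; subst;
  cbv [triple qm qc qs qadd qsub qim qone qdot qmap qmap2 q0 q1 q2 q3];
  first [ring | f_equal; ring].

Lemma qdot_self_pos x : 0 <= qdot x x.
Proof. destruct x; unfold qdot; cbn; nra. Qed.

Lemma qdot_self_zero x : qdot x x = 0 -> x = Quat 0 0 0 0.
Proof.
  destruct x as [a b c d]; unfold qdot; cbn; intros h.
  f_equal; nra.
Qed.

Lemma qsub_zero x y : qsub x y = Quat 0 0 0 0 -> x = y.
Proof.
  quat_cbv; destruct x, y; intros h; injection h; intros.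
  f_equal; lra.
Qed.

(** [triple] is the determinant of three imaginary parts, so a product of two of them is a Gram
    determinant, here expanded along its first row. *)
Lemma gram3 u a b v x y : imag u -> imag a -> imag b -> imag v -> imag x -> imag y ->
  triple u a b * triple v x y =
    qdot u v * (qdot a x * qdot b y - qdot a y * qdot b x)
  - qdot u x * (qdot a v * qdot b y - qdot a y * qdot b v)
  + qdot u y * (qdot a v * qdot b x - qdot a x * qdot b v).
Proof. imag_ring. Qed.

(** [qim (qm a b)] is the cross product, so this is Cramer's rule in dual-basis form. *)
Lemma cramer3 u a b q : imag u -> imag a -> imag b -> imag q ->
  qs (triple u a b) q =
    qadd (qs (qdot q u) (qim (qm a b)))
   (qadd (qs (qdot q a) (qim (qm b u))) (qs (qdot q b) (qim (qm u a)))).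
Proof. imag_ring. Qed.

Lemma triple_sqr u a b : imag u -> imag a -> imag b ->
  qdot u u = 1 -> qdot u a = 0 -> qdot u b = 0 ->
  triple u a b * triple u a b = qdot a a * qdot b b - qdot a b * qdot a b.
Proof.
  intros; rewrite gram3 by auto; rewrite (qdot_comm a u), (qdot_comm b u), (qdot_comm b a), H2, H3, H4; ring.
Qed.

Lemma imag_basis u a b q : imag u -> imag a -> imag b -> imag q ->
  triple u a b <> 0 -> qdot q u = 0 -> qdot q a = 0 -> qdot q b = 0 -> q = Quat 0 0 0 0.
Proof.
  intros hu ha hb hq nz e1 e2 e3.
  assert (c := cramer3 u a b q hu ha hb hq); rewrite e1, e2, e3 in c.
  apply qdot_self_zero.
  apply (Rmult_eq_reg_l (triple u a b * triple u a b)); [|now apply Rmult_integral_contrapositive].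
  replace (triple u a b * triple u a b * qdot q q)
    with (qdot (qs (triple u a b) q) (qs (triple u a b) q)) by qring.
  rewrite c; qring.
Qed.

Lemma tangent_imag f v : qdot v f = 0 -> imag (qm v (qc f)).
Proof. intros h; unfold imag; now rewrite <- qdot_q0. Qed.

Lemma qdot_trivialize f v w : S3 f -> qdot (qm v (qc f)) (qm w (qc f)) = qdot v w.
Proof. intros h; rewrite qdot_qm_r, qdot_qc, h; ring. Qed.

(** [T] is the part of [A] visible in the frame [a, b, f, n], and [A - T] is orthogonal to all four
    vectors. Right translation by [qc f] makes that difference imaginary, orthogonal to an imaginary
    basis, hence zero. *)
Lemma frame_decomp f n a b A B g1 g2 : S3 f -> S3 n -> qdot n f = 0 ->
  qdot a f = 0 -> qdot b f = 0 -> qdot n a = 0 -> qdot n b = 0 ->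
  qdot a a * qdot b b - qdot a b * qdot a b <> 0 ->
  qdot A a = g1 * qdot a a + g2 * qdot b a ->
  qdot A b = g1 * qdot a b + g2 * qdot b b ->
  qdot A B = g1 * qdot a B + g2 * qdot b B + qdot A f * qdot f B + qdot A n * qdot n B.
Proof.
  intros hf hn nf af bf na nb nz ea eb.
  set (T := qadd (qs g1 a) (qadd (qs g2 b) (qadd (qs (qdot A f) f) (qs (qdot A n) n)))).
  assert (lin : forall v, qdot T v = g1 * qdot a v + g2 * qdot b v + qdot A f * qdot f v + qdot A n * qdot n v).
  { intros v; unfold T; rewrite !qdot_qadd_l, !qdot_qs_l; ring. }
  set (Q := qsub A T).
  assert (dQ : forall v, qdot Q v = qdot A v - qdot T v).
  { intros v; unfold Q, qsub; rewrite qdot_qadd_l, qdot_qs_l; ring. }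
  assert (Qf : qdot Q f = 0) by (rewrite dQ, lin, af, bf, nf, hf; ring).
  assert (Qn : qdot Q n = 0) by
    (rewrite dQ, lin, (qdot_comm a n), (qdot_comm b n), (qdot_comm f n), na, nb, nf, hn; ring).
  assert (Qa : qdot Q a = 0) by
    (rewrite dQ, lin, (qdot_comm f a), na, af, ea; ring).
  assert (Qb : qdot Q b = 0) by
    (rewrite dQ, lin, (qdot_comm f b), nb, bf, eb; ring).
  assert (z : qm Q (qc f) = Quat 0 0 0 0).
  { apply (imag_basis (qm n (qc f)) (qm a (qc f)) (qm b (qc f)));
      try (apply tangent_imag; assumption); rewrite ?qdot_trivialize; auto.
    intros t; apply nz.
    rewrite <- (qdot_trivialize f a a), <- (qdot_trivialize f b b), <- (qdot_trivialize f a b) by auto.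
    rewrite <- (triple_sqr (qm n (qc f))), t;
      try (apply tangent_imag; assumption); rewrite ?qdot_trivialize; auto; ring. }
  assert (Q0 : A = T).
  { apply qsub_zero; fold Q; rewrite <- (S3_cancel_r' Q f hf), z; qring. }
  rewrite Q0 at 1; apply lin.
Qed.

(** * Surfaces in the sphere and their unit normals *)

(* [ad_gauss] is the Gauss equation of a flat surface: the second fundamental
   form has determinant -1 relative to the first. *)
Record adapted (F N : R * R -> quat R) : Prop := {
  ad_F : smooth4 F;
  ad_N : smooth4 N;
  ad_F1 : forall p, S3 (F p);
  ad_N1 : forall p, S3 (N p);
  ad_NF : forall p, qdot (N p) (F p) = 0;
  ad_tan : forall i p, qdot (N p) (partial4 i F p) = 0;
  ad_det : forall p, 0 < metric_det (induced_metric F) p;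
  ad_gauss : forall p,
    let b i j := qdot (N p) (partial4 i (partial4 j F) p) in
    b ax ax * b ay ay - b ax ay * b ax ay = - metric_det (induced_metric F) p
}.

Lemma partial_qdot_const i A B c p : smooth4 A -> smooth4 B ->
  (forall p, qdot (A p) (B p) = c) ->
  qdot (partial4 i A p) (B p) + qdot (A p) (partial4 i B p) = 0.
Proof.
  intros hA hB h; rewrite <- partial_qdot by auto.
  replace (fun r => qdot (A r) (B r)) with (fun _ : R * R => c)
    by (apply functional_extensionality; intros; now rewrite h).
  apply is_partial_eq, is_partial_const.
Qed.

Lemma sphere_tangent i F p : smooth4 F -> (forall p, S3 (F p)) ->
  qdot (partial4 i F p) (F p) = 0.
Proof.
  intros hF h; assert (e := partial_qdot_const i F F 1 p hF hF h).
  rewrite (qdot_comm (F p)) in e; lra.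
Qed.

(** One Gram-Schmidt step: the combination of [b] and [a] orthogonal to [a] is nonzero by the
    immersion property, and its squared length is [qdot a a] times the determinant. *)
Lemma immersion_det F p : immersion F -> 0 < metric_det (induced_metric F) p.
Proof.
  intros im; unfold metric_det, induced_metric; specialize (im p).
  set (a := partial4 ax F p) in *; set (b := partial4 ay F p) in *.
  rewrite (qdot_comm b a).
  assert (pa : 0 < qdot a a).
  { destruct (qdot_self_pos a) as [h | h]; auto; exfalso.
    symmetry in h; apply qdot_self_zero in h.
    destruct (im 1 0); [|lra].
    rewrite h; quat_cbv; f_equal; ring. }
  assert (pb : 0 < qdot (qsub (qs (qdot a a) b) (qs (qdot a b) a))
                        (qsub (qs (qdot a a) b) (qs (qdot a b) a))).
  { match goal with |- 0 < qdot ?x ?x => set (v := x) end.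
    destruct (qdot_self_pos v) as [h | h]; auto; exfalso.
    symmetry in h; apply qdot_self_zero in h.
    destruct (im (- qdot a b) (qdot a a)); [|lra].
    rewrite <- h; unfold v; generalize (qdot a b) (qdot a a); intros;
      destruct a, b; quat_cbv; f_equal; ring. }
  apply (Rmult_lt_reg_l (qdot a a)); auto; rewrite Rmult_0_r.
  replace (qdot a a * _) with (qdot (qsub (qs (qdot a a) b) (qs (qdot a b) a))
                        (qsub (qs (qdot a a) b) (qs (qdot a b) a))); auto.
  qdot_expand; rewrite (qdot_comm b a); ring.
Qed.

(** The cross product of the two partials, formed after right translation to the identity, divided
    by the area element and translated back. *)
Definition unit_normal (F : R * R -> quat R) (p : R * R) : quat R :=
  qs (/ sqrt (metric_det (induced_metric F) p))
    (qm (qim (qm (qm (partial4 ax F p) (qc (F p))) (qm (partial4 ay F p) (qc (F p))))) (F p)).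

(** [frame_decomp] replaces the tangentially corrected products in [flat_gauss_christoffel] by
    radial and normal contributions. The radial ones form the metric determinant, that is, the
    curvature 1 of the sphere. *)
Lemma flat_adapted F : smooth4 F -> (forall p, S3 (F p)) -> immersion F ->
  flat (induced_metric F) -> adapted F (unit_normal F).
Proof.
  intros hF h1 im fl.
  assert (pd := fun p => immersion_det F p im).
  assert (sF : forall i, smooth4 (partial4 i F)) by (intros; now apply smooth4_partial).
  assert (sN : smooth4 (unit_normal F)).
  { apply smooth4_qs.
    - assert (sd : smooth (metric_det (induced_metric F))).
      { unfold metric_det; apply smooth_minus; apply smooth_mult; now apply smooth_metric. }
      apply smooth_inv; [now apply smooth_sqrt|].
      intros p; apply Rgt_not_eq, sqrt_lt_R0, pd.
    - apply smooth4_qm; auto; apply smooth4_qim, smooth4_qm; apply smooth4_qm; auto;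
        now apply smooth4_qc. }
  assert (tan := fun i p => sphere_tangent i F p hF h1).
  assert (N1 : forall p, S3 (unit_normal F p)).
  { intros p; unfold S3, unit_normal; specialize (pd p).
    rewrite qdot_qs_l, qdot_qs_r, qdot_qm_r, (h1 p).
    match goal with |- / ?s * (/ ?s * (?d * 1)) = 1 =>
      replace d with (s * s) end.
    - field; apply Rgt_not_eq, sqrt_lt_R0, pd.
    - rewrite sqrt_sqrt by lra; unfold metric_det, induced_metric.
      rewrite (qdot_comm (partial4 ay F p) (partial4 ax F p)).
      rewrite <- (qdot_trivialize (F p) (partial4 ax F p) (partial4 ax F p)),
        <- (qdot_trivialize (F p) (partial4 ay F p) (partial4 ay F p)),
        <- (qdot_trivialize (F p) (partial4 ax F p) (partial4 ay F p)) by auto.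
      assert (i1 := tangent_imag _ _ (tan ax p)); assert (i2 := tangent_imag _ _ (tan ay p)).
      revert i1 i2; generalize (qm (partial4 ax F p) (qc (F p))) (qm (partial4 ay F p) (qc (F p))).
      imag_ring. }
  assert (NF : forall p, qdot (unit_normal F p) (F p) = 0).
  { intros p; unfold unit_normal; rewrite qdot_qs_l.
    match goal with |- _ * qdot (qm ?c ?f) ?f = 0 =>
      replace (qdot (qm c f) f) with (q0 c * qdot f f) by (clear; qring) end.
    cbn [q0 qim]; ring. }
  assert (Nt : forall i p, qdot (unit_normal F p) (partial4 i F p) = 0).
  { intros i p; unfold unit_normal; rewrite qdot_qs_l.
    rewrite <- (S3_cancel_r' (partial4 i F p) (F p)) at 1 by auto.
    rewrite qdot_qm_r.
    assert (i1 := tangent_imag _ _ (tan ax p)); assert (i2 := tangent_imag _ _ (tan ay p)).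
    revert i1 i2; destruct i;
      generalize (qm (partial4 ax F p) (qc (F p))) (qm (partial4 ay F p) (qc (F p)));
      generalize (qdot (F p) (F p)); imag_ring. }
  split; auto.
  intros p b.
  assert (nz : forall p, metric_det (induced_metric F) p <> 0) by (intros q; specialize (pd q); lra).
  assert (g := flat_gauss_christoffel F p hF nz fl); cbv zeta in g.
  assert (low := fun i j l => christoffel_lower F i j l p hF (nz p)).
  assert (nz' : qdot (partial4 ax F p) (partial4 ax F p) * qdot (partial4 ay F p) (partial4 ay F p)
    - qdot (partial4 ax F p) (partial4 ay F p) * qdot (partial4 ax F p) (partial4 ay F p) <> 0).
  { specialize (nz p); unfold metric_det, induced_metric in nz.
    now rewrite (qdot_comm (partial4 ay F p) (partial4 ax F p)) in nz. }
  assert (dec := fun i j B => frame_decomp (F p) (unit_normal F p) (partial4 ax F p) (partial4 ay F p)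
    (partial4 i (partial4 j F) p) B _ _ (h1 p) (N1 p) (NF p) (tan ax p) (tan ay p)
    (Nt ax p) (Nt ay p) nz' (low i j ax) (low i j ay)).
  (* Differentiating the orthogonality of [F_j] and [F] shows that the radial component of the
     Hessian is minus the metric. *)
  assert (hess : forall i j, qdot (partial4 i (partial4 j F) p) (F p) = - induced_metric F i j p).
  { intros i j; assert (e := partial_qdot_const i (partial4 j F) F 0 p (sF j) hF (tan j)).
    unfold induced_metric; rewrite (qdot_comm (partial4 i F p)); lra. }
  rewrite (dec ax ay) in g.
  rewrite (dec ax ax (partial4 ay (partial4 ay F) p)) in g.
  rewrite !(qdot_comm (F p)), !hess, !(qdot_comm _ (unit_normal F p)) in g.
  fold (b ax ay) (b ax ax) (b ay ay) in g.
  unfold metric_det; rewrite (metric_sym F ay ax); lra.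
Qed.

Lemma partial4_conj_eq i j F p : smooth4 F ->
  partial4 i (partial4 j (fun r => qc (F r))) p = qc (partial4 i (partial4 j F) p).
Proof.
  intros hF; replace (partial4 j (fun r => qc (F r))) with (fun r => qc (partial4 j F r)).
  - now apply partial4_qc, smooth4_partial.
  - apply functional_extensionality; intros q; now rewrite partial4_qc.
Qed.

(** Conjugation is a linear isometry that exchanges left and right translations, so every result on
    one Gauss map transfers to the other. *)
Lemma adapted_conj F N : adapted F N -> adapted (fun p => qc (F p)) (fun p => qc (N p)).
Proof.
  intros [hF hN F1 N1 NF tan det gauss].
  assert (m : forall i j p, induced_metric (fun p => qc (F p)) i j p = induced_metric F i j p).
  { intros; unfold induced_metric; now rewrite !partial4_qc, qdot_qc. }
  assert (d : forall p, metric_det (induced_metric (fun p => qc (F p))) p = metric_det (induced_metric F) p)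
    by (intros; unfold metric_det; now rewrite !m).
  split; intros; rewrite ?qdot_qc, ?d; auto.
  - now apply smooth4_qc.
  - now apply smooth4_qc.
  - now apply S3_qc.
  - now apply S3_qc.
  - rewrite partial4_qc, qdot_qc by auto; apply tan.
  - unfold b; rewrite !partial4_conj_eq, !qdot_qc by auto; apply gauss.
Qed.

(* The right-translated normal: the Gauss map of [F] for one of the two
   trivialisations of the tangent bundle; the other one is the Gauss map of the
   conjugate surface. *)
Definition gauss_map (F N : R * R -> quat R) (p : R * R) : quat R := qm (N p) (qc (F p)).

Definition triv (F : R * R -> quat R) (i : axis) (p : R * R) : quat R :=
  qm (partial4 i F p) (qc (F p)).

Lemma triv_conj i F p : smooth4 F -> (forall p, S3 (F p)) ->
  qm (F p) (qc (partial4 i F p)) = qs (-1) (triv F i p).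
Proof.
  intros hF h1.
  assert (e := partial4_qm i F (fun r => qc (F r)) p hF (smooth4_qc F hF)); cbn beta in e.
  replace (fun r => qm (F r) (qc (F r))) with (fun _ : R * R => qone) in e
    by (apply functional_extensionality; intros q; now rewrite (proj1 (S3_inv _ (h1 q)))).
  rewrite partial4_const, partial4_qc in e by auto.
  unfold triv; revert e; generalize (qm (partial4 i F p) (qc (F p))) (qm (F p) (qc (partial4 i F p))).
  intros [a b c d] [a' b' c' d'] e; quat_cbv_in e; injection e; intros.
  quat_cbv; f_equal; lra.
Qed.

Lemma gauss_map_partial F N i p : smooth4 F -> smooth4 N -> (forall p, S3 (F p)) ->
  partial4 i (gauss_map F N) p
    = qsub (qm (partial4 i N p) (qc (F p))) (qm (gauss_map F N p) (triv F i p)).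
Proof.
  intros hF hN h1; unfold gauss_map; rewrite partial4_qm, partial4_qc by auto using smooth4_qc.
  unfold qsub; f_equal.
  replace (N p) with (qm (qm (N p) (qc (F p))) (F p)) at 1 by (apply S3_cancel_r', h1).
  rewrite <- (qmA (qm (N p) (qc (F p)))), triv_conj by auto.
  qring.
Qed.

Section Adapted.

Variables F N : R * R -> quat R.
Hypothesis ad : adapted F N.

Let nu := gauss_map F N.

Lemma smooth4_gauss_map : smooth4 nu.
Proof. apply smooth4_qm; [apply ad | apply smooth4_qc, ad]. Qed.

Lemma gauss_map_imag p : imag (nu p).
Proof. apply tangent_imag, ad. Qed.

Lemma gauss_map_unit p : S3 (nu p).
Proof. apply S3_qm; [apply ad | apply S3_qc, ad]. Qed.

Lemma triv_imag i p : imag (triv F i p).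
Proof. apply tangent_imag, sphere_tangent; apply ad. Qed.

Lemma gauss_map_triv i p : qdot (nu p) (triv F i p) = 0.
Proof. unfold nu, gauss_map, triv; rewrite qdot_trivialize by apply ad; apply ad. Qed.

Lemma triple_triv_sqr p : triple (nu p) (triv F ax p) (triv F ay p) *
  triple (nu p) (triv F ax p) (triv F ay p) = metric_det (induced_metric F) p.
Proof.
  rewrite triple_sqr; auto using gauss_map_imag, triv_imag, gauss_map_triv.
  - unfold triv; rewrite !qdot_trivialize by apply ad.
    unfold metric_det, induced_metric; now rewrite (qdot_comm (partial4 ay F p) (partial4 ax F p)).
  - apply gauss_map_unit.
Qed.

(** The first term is symmetric in [i], [k] and the second antisymmetric. The determinant of this
    matrix is therefore that of the second fundamental form plus the square of the area term, a sum
    which [ad_gauss] makes zero. *)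
Lemma gauss_map_weingarten i k p :
  qdot (partial4 i nu p) (triv F k p) =
  - qdot (N p) (partial4 i (partial4 k F) p) - triple (nu p) (triv F i p) (triv F k p).
Proof.
  unfold nu; rewrite gauss_map_partial by apply ad; fold nu; unfold qsub; rewrite qdot_qadd_l, qdot_qs_l.
  fold (triple (nu p) (triv F i p) (triv F k p)).
  unfold triv at 1; rewrite qdot_trivialize by apply ad.
  assert (e := partial_qdot_const i N (partial4 k F) 0 p (ad_N _ _ ad)
    (smooth4_partial _ k (ad_F _ _ ad)) (ad_tan _ _ ad k)); lra.
Qed.

Lemma gauss_map_partial_perp i p : qdot (nu p) (partial4 i nu p) = 0 /\ imag (partial4 i nu p).
Proof.
  split.
  - assert (e := partial_qdot_const i nu nu 1 p smooth4_gauss_map smooth4_gauss_map gauss_map_unit).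
    rewrite (qdot_comm (partial4 i nu p)) in e; lra.
  - unfold imag; cbn [partial4 q0].
    replace (fun r => q0 (nu r)) with (fun _ : R * R => 0)
      by (apply functional_extensionality; intros; now rewrite gauss_map_imag).
    apply is_partial_eq, is_partial_const.
Qed.

Lemma triple_alt u x y : imag u -> imag x -> imag y ->
  triple u x x = 0 /\ triple u y x = - triple u x y.
Proof. intros; split; imag_ring. Qed.

(* The Gauss equation says that the Gauss map has rank one. *)
Lemma gauss_map_rank p :
  let n1 := partial4 ax nu p in let n2 := partial4 ay nu p in
  qdot n1 n1 * qdot n2 n2 = qdot n1 n2 * qdot n1 n2 /\ 0 < qdot n1 n1 + qdot n2 n2.
Proof.
  intros n1 n2.
  destruct (gauss_map_partial_perp ax p) as [p1 i1].
  destruct (gauss_map_partial_perp ay p) as [p2 i2]; fold n1 in p1, i1; fold n2 in p2, i2.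
  assert (iu := gauss_map_imag p); assert (ix := triv_imag ax p); assert (iy := triv_imag ay p).
  assert (w := triple_triv_sqr p); assert (pd := ad_det _ _ ad p).
  assert (g := ad_gauss _ _ ad p); cbv zeta in g.
  assert (m := fun i k => gauss_map_weingarten i k p).
  assert (mxx := m ax ax); assert (mxy := m ax ay); assert (myx := m ay ax); assert (myy := m ay ay).
  destruct (triple_alt _ _ _ iu ix iy) as [t1 t2]; destruct (triple_alt _ _ _ iu iy ix) as [t3 _].
  rewrite t1 in mxx; rewrite t2 in myx; rewrite t3 in myy.
  rewrite <- (partial4_Schwarz F p (ad_F _ _ ad)) in myx.
  fold n1 in mxx, mxy; fold n2 in myx, myy.
  set (W := triple (nu p) (triv F ax p) (triv F ay p)) in *.
  assert (u1 := gauss_map_unit p); unfold S3 in u1.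
  (* Since [nu] is a unit vector orthogonal to all the others, the Gram determinant reduces to the
     two by two matrix of [gauss_map_weingarten]. *)
  assert (G := gram3 (nu p) n1 n2 (nu p) (triv F ax p) (triv F ay p) iu i1 i2 iu ix iy).
  rewrite !gauss_map_triv, u1, mxx, mxy, myx, myy in G; fold W in G.
  assert (z : triple (nu p) n1 n2 = 0).
  { apply (Rmult_eq_reg_r W); [|intros e; rewrite e in w; lra]; rewrite G; lra. }
  assert (s := triple_sqr (nu p) n1 n2 iu i1 i2 u1 p1 p2); rewrite z in s.
  split; [lra|].
  assert (h1 := qdot_self_pos n1); assert (h2 := qdot_self_pos n2).
  (* If both partials vanished, the two off-diagonal entries would be zero, and their difference is
     twice the nonzero area term. *)
  destruct (Req_dec (qdot n1 n1 + qdot n2 n2) 0) as [e | e]; [exfalso | lra].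
  assert (e1 : n1 = Quat 0 0 0 0) by (apply qdot_self_zero; lra).
  assert (e2 : n2 = Quat 0 0 0 0) by (apply qdot_self_zero; lra).
  assert (q0z : forall x, qdot (Quat 0 0 0 0) x = 0) by qring.
  rewrite e1, q0z in mxy; rewrite e2, q0z in myx.
  assert (W = 0) by lra; rewrite H in w; lra.
Qed.

End Adapted.

(** With a Gram matrix of rank one and trace [T], the two vectors are the cosine and sine multiples
    of one vector of length [sqrt T]. The Gram matrix determines only the double angle; lifting it
    over the plane and halving it makes a smooth choice of sign. *)
Lemma rank_one_factor (n1 n2 : R * R -> quat R) : smooth4 n1 -> smooth4 n2 ->
  (forall p, qdot (n1 p) (n1 p) * qdot (n2 p) (n2 p) = qdot (n1 p) (n2 p) * qdot (n1 p) (n2 p)) ->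
  (forall p, 0 < qdot (n1 p) (n1 p) + qdot (n2 p) (n2 p)) ->
  exists a b e, smooth a /\ smooth b /\ smooth4 e /\ (forall p, S3 (e p)) /\
    (forall p, n1 p = qs (2 * a p) (e p)) /\ (forall p, n2 p = qs (2 * b p) (e p)).
Proof.
  intros h1 h2 rk pos.
  set (P := fun p => qdot (n1 p) (n1 p)); set (Q := fun p => qdot (n1 p) (n2 p));
    set (R' := fun p => qdot (n2 p) (n2 p)).
  assert (sP : smooth P) by now apply smooth_qdot.
  assert (sQ : smooth Q) by now apply smooth_qdot.
  assert (sR : smooth R') by now apply smooth_qdot.
  set (T := fun p => P p + R' p).
  assert (sT : smooth T) by (unfold T; smooth_tac).
  assert (pT : forall p, 0 < T p) by exact pos.
  assert (rk' : forall p, P p * R' p = Q p * Q p) by exact rk.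
  assert (siT : smooth (fun p => / T p)) by (apply smooth_inv; auto; intros p; specialize (pT p); lra).
  destruct (angle_lift (fun p => (P p - R' p) * / T p) (fun p => 2 * Q p * / T p))
    as [t [st_ [ct [si _]]]]; [smooth_tac | smooth_tac | |].
  { intros p; specialize (pT p); specialize (rk' p); unfold T in *.
    replace ((P p - R' p) * / (P p + R' p) * ((P p - R' p) * / (P p + R' p)) +
      2 * Q p * / (P p + R' p) * (2 * Q p * / (P p + R' p)))
      with (((P p - R' p) * (P p - R' p) + 4 * (Q p * Q p)) / ((P p + R' p) * (P p + R' p)))
      by (field; lra).
    rewrite <- rk'; field; lra. }
  set (r := fun p => sqrt (T p)).
  assert (pr : forall p, 0 < r p) by (intros; apply sqrt_lt_R0; auto).
  assert (rr : forall p, r p * r p = T p) by (intros; apply sqrt_sqrt; left; auto).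
  assert (sr : smooth r) by now apply smooth_sqrt.
  assert (sir : smooth (fun p => / r p)) by (apply smooth_inv; auto; intros p; specialize (pr p); lra).
  set (c := fun p => cos (/ 2 * t p)); set (s := fun p => sin (/ 2 * t p)).
  assert (sc : smooth c) by (unfold c; smooth_tac).
  assert (ss : smooth s) by (unfold s; smooth_tac).
  assert (dbl : forall p, T p * (c p * c p) = P p /\ T p * (s p * s p) = R' p /\ T p * (c p * s p) = Q p).
  { intros p; specialize (pT p).
    assert (e1 := ct p); assert (e2 := si p).
    replace (t p) with (2 * (/ 2 * t p)) in e1, e2 by field.
    rewrite sin_2a in e2; rewrite cos_2a in e1; fold (c p) (s p) in e1, e2.
    assert (e3 := sin2_cos2 (/ 2 * t p)); unfold Rsqr in e3; fold (c p) (s p) in e3.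
    assert (e4 : T p * (c p * c p - s p * s p) = P p - R' p) by (rewrite e1; field; lra).
    assert (e5 : T p * (2 * s p * c p) = 2 * Q p) by (rewrite e2; field; lra).
    assert (e6 : T p * (s p * s p + c p * c p) = T p) by (rewrite e3; ring).
    unfold T in *; lra. }
  (* Equality case of Cauchy-Schwarz: the squared norm of the difference is
     [R' * (P * R' - Q * Q)]. *)
  assert (k1 : forall p, qs (R' p) (n1 p) = qs (Q p) (n2 p)).
  { intros p; apply qsub_zero, qdot_self_zero; specialize (rk' p).
    qdot_expand; rewrite (qdot_comm (n2 p) (n1 p)).
    fold (P p) (Q p) (R' p).
    transitivity (R' p * (P p * R' p - Q p * Q p)); [ring|]; rewrite rk'; ring. }
  assert (k2 : forall p, qs (P p) (n2 p) = qs (Q p) (n1 p)).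
  { intros p; apply qsub_zero, qdot_self_zero; specialize (rk' p).
    qdot_expand; rewrite (qdot_comm (n2 p) (n1 p)).
    fold (P p) (Q p) (R' p).
    transitivity (P p * (P p * R' p - Q p * Q p)); [ring|]; rewrite rk'; ring. }
  assert (half_angle : forall p u v,
    (T p * (s p * s p) * u = T p * (c p * s p) * v ->
      u = 2 * (/ 2 * (r p * c p)) * (/ r p * (c p * u + s p * v))) /\
    (T p * (c p * c p) * v = T p * (c p * s p) * u ->
      v = 2 * (/ 2 * (r p * s p)) * (/ r p * (c p * u + s p * v)))).
  { intros p u v; specialize (pr p); specialize (pT p).
    assert (e3 := sin2_cos2 (/ 2 * t p)); unfold Rsqr in e3; fold (c p) (s p) in e3.
    split; intros E.
    - transitivity (c p * c p * u + c p * s p * v); [|field; lra].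
      assert (s p * s p * u = c p * s p * v) by (apply (Rmult_eq_reg_l (T p)); lra).
      replace u with ((s p * s p + c p * c p) * u) at 1 by (rewrite e3; ring); lra.
    - transitivity (c p * s p * u + s p * s p * v); [|field; lra].
      assert (c p * c p * v = c p * s p * u) by (apply (Rmult_eq_reg_l (T p)); lra).
      replace v with ((s p * s p + c p * c p) * v) at 1 by (rewrite e3; ring); lra. }
  set (e := fun p => qs (/ r p) (qadd (qs (c p) (n1 p)) (qs (s p) (n2 p)))).
  exists (fun p => / 2 * (r p * c p)), (fun p => / 2 * (r p * s p)), e.
  split; [smooth_tac | split; [smooth_tac | split; [|split; [|split]]]].
  - apply smooth4_qs; auto; apply smooth4_qadd; apply smooth4_qs; auto.
  - intros p; unfold S3, e; qdot_expand; rewrite (qdot_comm (n2 p) (n1 p)).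
    fold (P p) (Q p) (R' p).
    specialize (pr p); specialize (rr p); destruct (dbl p) as [d1 [d2 d3]].
    rewrite <- d1, <- d2, <- d3, <- rr.
    assert (e3 := sin2_cos2 (/ 2 * t p)); unfold Rsqr in e3; fold (c p) (s p) in e3.
    transitivity ((s p * s p + c p * c p) * (s p * s p + c p * c p)); [field; lra|].
    rewrite e3; ring.
  - intros p; specialize (k1 p); specialize (pr p); specialize (pT p).
    destruct (dbl p) as [_ [d2 d3]]; rewrite <- d2, <- d3 in k1.
    unfold e; revert k1; destruct (n1 p), (n2 p); quat_cbv.
    intros k1; injection k1; intros; f_equal; apply (half_angle p); lra.
  - intros p; specialize (k2 p); specialize (pr p); specialize (pT p).
    destruct (dbl p) as [d1 [_ d3]]; rewrite <- d1, <- d3 in k2.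
    unfold e; revert k2; destruct (n1 p), (n2 p); quat_cbv.
    intros k2; injection k2; intros; f_equal; apply (half_angle p); lra.
Qed.

(* Along its rank-one direction the Gauss map is a curve, and [alpha] is half its
   length element; it is closed because [e] has constant norm. *)
Lemma gauss_map_factor F N : adapted F N ->
  exists (alpha : axis -> R * R -> R) e, (forall i, smooth (alpha i)) /\ smooth4 e /\
    (forall p, S3 (e p)) /\
    (forall i p, partial4 i (gauss_map F N) p = qs (2 * alpha i p) (e p)) /\
    (forall p, partial ay (alpha ax) p = partial ax (alpha ay) p).
Proof.
  intros ad; assert (sn := smooth4_gauss_map F N ad).
  destruct (rank_one_factor (partial4 ax (gauss_map F N)) (partial4 ay (gauss_map F N)))
    as (a & b & e & sa & sb & se & e1 & h1 & h2); try (now apply smooth4_partial).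
  { intros p; apply (gauss_map_rank F N ad p). }
  { intros p; apply (gauss_map_rank F N ad p). }
  exists (fun i => match i with ax => a | ay => b end), e.
  split; [intros []; auto | split; [auto | split; [auto | split; [intros []; auto|]]]].
  intros p.
  assert (sy := partial4_Schwarz (gauss_map F N) p sn).
  replace (partial4 ay (gauss_map F N)) with (fun p => qs (2 * b p) (e p)) in sy
    by (apply functional_extensionality; auto).
  replace (partial4 ax (gauss_map F N)) with (fun p => qs (2 * a p) (e p)) in sy
    by (apply functional_extensionality; auto).
  rewrite !partial4_qs in sy by (auto; smooth_tac).
  apply (f_equal (fun v => qdot v (e p))) in sy.
  rewrite !qdot_qadd_l, !qdot_qs_l, !sphere_tangent in sy by auto.
  rewrite (e1 p) in sy.
  assert (d : forall i f, smooth f -> partial i (fun p => 2 * f p) p = 2 * partial i f p).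
  { intros i f hf; etransitivity; [apply is_partial_eq; partial_tac | cbn beta; ring]. }
  rewrite !d in sy by auto; lra.
Qed.

(** One matrix is factored both as [b] times [G] and as [E] times [a]. Were [a] and [b] parallel it
    would be symmetric, and the hypothesis on [a1 * E2] and [a2 * E1] says that it is not. *)
Lemma rank_one_independent a1 a2 b1 b2 E1 E2 G1 G2 :
  b1 * G1 = a1 * E1 -> b1 * G2 = a2 * E1 -> b2 * G1 = a1 * E2 -> b2 * G2 = a2 * E2 ->
  a1 * E2 <> a2 * E1 -> a1 * b2 - a2 * b1 <> 0.
Proof.
  intros e11 e12 e21 e22 nz z; apply nz.
  assert (z1 : a1 * (a1 * E2 - a2 * E1) = 0).
  { replace (a1 * (a1 * E2 - a2 * E1)) with (a1 * (a1 * E2) - a2 * (a1 * E1)) by ring.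
    rewrite <- e21, <- e11; replace (a1 * (b2 * G1) - a2 * (b1 * G1))
      with ((a1 * b2 - a2 * b1) * G1) by ring; rewrite z; ring. }
  assert (z2 : a2 * (a1 * E2 - a2 * E1) = 0).
  { replace (a2 * (a1 * E2 - a2 * E1)) with (a1 * (a2 * E2) - a2 * (a2 * E1)) by ring.
    rewrite <- e22, <- e12; replace (a1 * (b2 * G2) - a2 * (b1 * G2))
      with ((a1 * b2 - a2 * b1) * G2) by ring; rewrite z; ring. }
  apply Rmult_integral in z1; destruct z1 as [z1 | z1]; [|lra].
  apply Rmult_integral in z2; destruct z2 as [z2 | z2]; [|lra].
  rewrite z1, z2; ring.
Qed.

(** The Weingarten matrices of the two Gauss maps are transposes of each other, with a nonzero
    antisymmetric part; their rank-one factors [alpha] and [beta] therefore cannot be parallel. *)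
Lemma gauss_maps_independent F N alpha beta e e' : adapted F N ->
  (forall i p, partial4 i (gauss_map F N) p = qs (2 * alpha i p) (e p)) ->
  (forall i p, partial4 i (gauss_map (fun p => qc (F p)) (fun p => qc (N p))) p
                 = qs (2 * beta i p) (e' p)) ->
  forall p : R * R, alpha ax p * beta ay p - alpha ay p * beta ax p <> 0.
Proof.
  intros ad ha hb p.
  assert (ad' := adapted_conj F N ad).
  assert (hF := ad_F _ _ ad); assert (F1 := ad_F1 _ _ ad).
  set (x := fun k => triv F k p); set (x' := fun k => triv (fun p => qc (F p)) k p).
  assert (ix := triv_imag F N ad); assert (iu := gauss_map_imag F N ad p).
  (* Passing from right to left translation reverses the sign of the triple product, while the
     second fundamental form stays the same. *)
  assert (tr : forall i k, triple (gauss_map (fun p => qc (F p)) (fun p => qc (N p)) p) (x' i) (x' k)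
    = triple (gauss_map F N p) (x k) (x i)).
  { intros i k.
    transitivity (qdot (qm (triv F i p) (gauss_map F N p)) (triv F k p)).
    - unfold triple, x', triv, gauss_map; rewrite !partial4_qc, !qc_qc by auto.
      replace (qm (qm (qc (N p)) (F p)) (qm (qc (partial4 i F p)) (F p)))
        with (qm (qc (qm (partial4 i F p) (qm (qc (F p)) (N p)))) (F p))
        by (rewrite !qc_qm, qc_qc, !qmA; auto).
      rewrite qdot_qm_r, qdot_qc, (F1 p), Rmult_1_r.
      rewrite qmA, qmA, qdot_trivialize; auto.
    - unfold x; assert (i1 := ix i p); assert (i2 := ix k p); revert iu i1 i2.
      generalize (gauss_map F N p) (triv F i p) (triv F k p); imag_ring. }
  assert (m : forall i k, qdot (partial4 i (gauss_map F N) p) (x k) =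
    qdot (partial4 k (gauss_map (fun p => qc (F p)) (fun p => qc (N p))) p) (x' i)).
  { intros i k; unfold x, x'; rewrite (gauss_map_weingarten F N ad), (gauss_map_weingarten _ _ ad').
    fold (x i) (x k) (x' i) (x' k); rewrite tr.
    rewrite partial4_conj_eq, qdot_qc by auto; f_equal; f_equal; f_equal.
    destruct i, k; auto; [|symmetry]; now apply partial4_Schwarz. }
  assert (q2 : forall r u v, qdot (qs (2 * r) u) v = 2 * (r * qdot u v))
    by (intros; rewrite qdot_qs_l; ring).
  assert (m' : forall i k, beta i p * qdot (e' p) (x' k) = alpha k p * qdot (e p) (x i)).
  { intros i k; assert (M := m k i); rewrite ha, hb, !q2 in M; lra. }
  apply (rank_one_independent _ _ _ _ (qdot (e p) (x ax)) (qdot (e p) (x ay))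
    (qdot (e' p) (x' ax)) (qdot (e' p) (x' ay))); auto.
  (* A symmetric matrix would make the area term vanish, against the positivity of the metric
     determinant. *)
  intros z.
  assert (w1 := gauss_map_weingarten F N ad ax ay p); assert (w2 := gauss_map_weingarten F N ad ay ax p).
  rewrite ha, q2 in w1, w2; fold (x ax) (x ay) in w1, w2.
  rewrite <- (partial4_Schwarz F p hF) in w2.
  destruct (triple_alt (gauss_map F N p) (x ax) (x ay)) as [_ t]; auto; [apply ix | apply ix|].
  rewrite t in w2.
  assert (w := triple_triv_sqr F N ad p); fold (x ax) (x ay) in w.
  assert (z0 : triple (gauss_map F N p) (x ax) (x ay) = 0) by lra.
  rewrite z0 in w; assert (pd := ad_det _ _ ad p); lra.
Qed.


(** * Asymptotic coordinates *)

Lemma gauss_map_conj F N p : gauss_map (fun p => qc (F p)) (fun p => qc (N p)) p = qm (qc (N p)) (F p).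
Proof. unfold gauss_map; now rewrite qc_qc. Qed.

Lemma imag_anticomm u x : imag u -> imag x -> qdot u x = 0 -> qm u x = qs (-1) (qm x u).
Proof.
  destruct u as [u0 u1 u2 u3], x as [x0 x1 x2 x3]; unfold imag; cbn [q0]; intros -> ->.
  quat_cbv; intros h; f_equal; lra.
Qed.

Lemma imag_square u : imag u -> S3 u -> qm u u = qs (-1) qone.
Proof.
  destruct u as [u0 u1 u2 u3]; unfold imag, S3; cbn [q0]; intros ->.
  quat_cbv; intros h; f_equal; lra.
Qed.

Lemma imag_conj u : imag u -> qc u = qs (-1) u.
Proof. destruct u as [u0 u1 u2 u3]; unfold imag; cbn [q0]; intros ->; quat_cbv; f_equal; ring. Qed.

(** Let [X] be [triv G i]. As the other Gauss map is constant along [i], [G] and [N] satisfy the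
    same equation with left factor [X], so the derivative of [nu] is [X nu - nu X = 2 X nu]. Solving
    for [X] expresses it through [nu] and its derivative: its length is 1, and it is constant along
    [j]. *)
Lemma asymptotic_direction G N i j : smooth4 G -> smooth4 N ->
  (forall p, S3 (G p)) -> (forall p, S3 (N p)) -> (forall p, qdot (N p) (G p) = 0) ->
  (forall p, qdot (N p) (partial4 i G p) = 0) ->
  (forall p, partial4 j (gauss_map G N) p = Quat 0 0 0 0) ->
  (forall p, qdot (partial4 i (gauss_map G N) p) (partial4 i (gauss_map G N) p) = 4) ->
  (forall p, partial4 i (gauss_map (fun p => qc (G p)) (fun p => qc (N p))) p = Quat 0 0 0 0) ->
  (forall p, S3 (partial4 i G p)) /\ (forall p, partial4 j (triv G i) p = Quat 0 0 0 0).
Proof.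
  intros hG hN G1 N1 NG Nt vj vi mi.
  set (nu := gauss_map G N) in *.
  assert (snu : smooth4 nu) by (apply smooth4_qm; auto; now apply smooth4_qc).
  assert (inu : forall p, imag (nu p)) by (intros p; apply tangent_imag; auto).
  assert (unu : forall p, S3 (nu p)) by (intros p; apply S3_qm; auto; now apply S3_qc).
  assert (ix : forall p, imag (triv G i p)) by (intros p; apply tangent_imag, sphere_tangent; auto).
  assert (perp : forall p, qdot (nu p) (triv G i p) = 0).
  { intros p; unfold nu, gauss_map, triv; rewrite qdot_trivialize; auto. }
  assert (Ni : forall p, partial4 i N p = qm (triv G i p) (N p)).
  { intros p; specialize (mi p).
    rewrite gauss_map_partial in mi by (auto using smooth4_qc, S3_qc).
    unfold triv in mi; rewrite !partial4_qc, gauss_map_conj, !qc_qc in mi by auto.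
    apply qsub_zero in mi; apply (f_equal (fun q => qm q (qc (G p)))) in mi.
    rewrite S3_cancel_r in mi by auto.
    replace (qm (qm (qm (qc (N p)) (G p)) (qm (qc (partial4 i G p)) (G p))) (qc (G p)))
      with (qm (qc (N p)) (qm (G p) (qc (partial4 i G p)))) in mi.
    - rewrite triv_conj in mi by auto.
      apply (f_equal qc) in mi; rewrite qc_qc, qc_qm, qc_qc in mi; rewrite mi.
      specialize (ix p); revert ix; generalize (triv G i p) (N p).
      intros t n it; rewrite <- (qc_qc t) at 2; rewrite (imag_conj t it); qring.
    - rewrite !qmA, S3_cancel_r; auto. }
  assert (vs : forall p, partial4 i nu p = qs 2 (qm (triv G i p) (nu p))).
  { intros p; unfold nu; rewrite gauss_map_partial by auto; fold nu.
    rewrite Ni, <- qmA; change (qm (N p) (qc (G p))) with (nu p).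
    rewrite (imag_anticomm (nu p) (triv G i p)) by auto; qring. }
  assert (X : triv G i = fun p => qs (- / 2) (qm (partial4 i nu p) (nu p))).
  { apply functional_extensionality; intros p; rewrite vs.
    transitivity (qs (-1) (qm (triv G i p) (qm (nu p) (nu p)))).
    - rewrite imag_square by auto; generalize (triv G i p); qring.
    - generalize (triv G i p) (nu p); quat_cbv; intros; f_equal; field. }
  split.
  - intros p; unfold S3; rewrite <- (qdot_trivialize (G p)) by auto.
    change (qm (partial4 i G p) (qc (G p))) with (triv G i p).
    specialize (vi p); rewrite vs, qdot_qs_l, qdot_qs_r, qdot_qm_r, unu in vi; lra.
  - intros p; rewrite X.
    assert (z : partial4 j (partial4 i nu) p = Quat 0 0 0 0).
    { transitivity (partial4 i (partial4 j nu) p).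
      - destruct i, j; auto; [symmetry|]; now apply partial4_Schwarz.
      - replace (partial4 j nu) with (fun _ : R * R => Quat 0 0 0 0)
          by (apply functional_extensionality; intros; now rewrite vj).
        apply partial4_const. }
    rewrite partial4_qs, partial4_qm, z, vj; auto using smooth_const, smooth4_partial, smooth4_qm.
    rewrite (is_partial_eq _ _ _ _ (is_partial_const j (- / 2) p)); qring.
Qed.

Lemma partial4_zero_indep i A : smooth4 A -> (forall p, partial4 i A p = Quat 0 0 0 0) ->
  forall x y x' y', A (x, y) = match i with ax => A (x', y) | ay => A (x, y') end.
Proof.
  intros (h0 & h1 & h2 & h3) z x y x' y'.
  assert (z0 := fun p => f_equal q0 (z p)); assert (z1 := fun p => f_equal q1 (z p));
    assert (z2 := fun p => f_equal q2 (z p)); assert (z3 := fun p => f_equal q3 (z p)).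
  assert (e0 := partial_axis_indep i _ h0 z0 x y x' y');
    assert (e1 := partial_axis_indep i _ h1 z1 x y x' y');
    assert (e2 := partial_axis_indep i _ h2 z2 x y x' y');
    assert (e3 := partial_axis_indep i _ h3 z3 x y x' y').
  destruct i; now apply quat_ext.
Qed.

(** A curve is treated as a function on the plane that depends on the first coordinate only, so the
    two-variable calculus applies unchanged. *)
Definition curve4 (f : R -> quat R) : Prop := smooth4 (fun p => f (fst p)).
Definition qderive (f : R -> quat R) (s : R) : quat R := partial4 ax (fun p => f (fst p)) (s, 0).

Lemma curve4_slice_x A y : smooth4 A -> curve4 (fun s => A (s, y)).
Proof. intros h; apply (smooth4_comp A fst (fun _ => y)); auto using smooth_fst, smooth_const. Qed.

Lemma curve4_slice_y A x : smooth4 A -> curve4 (fun s => A (x, s)).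
Proof. intros h; apply (smooth4_comp A (fun _ => x) fst); auto using smooth_fst, smooth_const. Qed.

Lemma curve4_comp f u : curve4 f -> smooth u -> smooth4 (fun p => f (u p)).
Proof. intros h hu; exact (smooth4_comp _ u (fun _ => 0) h hu (smooth_const 0)). Qed.

Lemma partial4_curve i f u p : curve4 f -> smooth u ->
  partial4 i (fun p => f (u p)) p = qs (partial i u p) (qderive f (u p)).
Proof.
  intros h hu.
  assert (e := partial4_comp i (fun p => f (fst p)) u (fun _ => 0) p h hu (smooth_const 0)).
  cbn [fst] in e; rewrite e.
  rewrite (is_partial_eq _ _ _ _ (is_partial_const i 0 p)).
  change (partial4 ax (fun p => f (fst p)) (u p, 0)) with (qderive f (u p)).
  generalize (qderive f (u p)) (partial4 ay (fun p => f (fst p)) (u p, 0)) (partial i u p); qring.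
Qed.

(** As functions of [s], [G (s, t)] and [G (s, 0)] satisfy the same linear equation with imaginary
    left coefficient, so [qc (G (s, 0)) * G (s, t)] does not depend on [s]. *)
Lemma product_decomposition G : smooth4 G -> (forall p, S3 (G p)) ->
  (forall p, partial4 ay (triv G ax) p = Quat 0 0 0 0) ->
  forall s t, G (s, t) = qm (G (s, 0)) (qm (qc (G (0, 0))) (G (0, t))).
Proof.
  intros hG G1 z s t.
  assert (s0 : smooth4 (fun p => G (fst p, 0))) by now apply curve4_slice_x.
  set (K := fun p => qm (qc (G (fst p, 0))) (G p)).
  assert (sK : smooth4 K) by (apply smooth4_qm; auto; now apply smooth4_qc).
  assert (sX : smooth4 (triv G ax)) by (apply smooth4_qm; [now apply smooth4_partial | now apply smooth4_qc]).
  assert (zK : forall p, partial4 ax K p = Quat 0 0 0 0).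
  { intros p; unfold K; rewrite partial4_qm, partial4_qc by auto using smooth4_qc.
    change (partial4 ax (fun r => G (fst r, 0)) p) with (partial4 ax G (fst p, 0)).
    replace (partial4 ax G (fst p, 0)) with (qm (triv G ax p) (G (fst p, 0))).
    - replace (partial4 ax G p) with (qm (triv G ax p) (G p)) by (apply S3_cancel_r'; auto).
      assert (it : imag (triv G ax p)) by (apply tangent_imag, sphere_tangent; auto).
      rewrite qc_qm, (imag_conj _ it); qring.
    - destruct p as [x y]; cbn [fst].
      rewrite (partial4_zero_indep ay _ sX z x y 0 0); apply S3_cancel_r'; auto. }
  assert (e := partial4_zero_indep ax K sK zK s t 0 0); unfold K in e; cbn [fst] in e.
  rewrite <- e, S3_cancel_l'; auto.
Qed.

Definition qI : quat R := Quat 0 1 0 0.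
Definition qJ : quat R := Quat 0 0 1 0.

(** The vector [v = 1 - I u] satisfies [v u = u + I = I v], and it vanishes only for [u = -I], a
    case handled by conjugation with [J]. *)
Lemma rotate_to_I u : imag u -> S3 u -> exists c, S3 c /\ qm (qm c u) (qc c) = qI.
Proof.
  intros iu hu.
  destruct (Req_dec (q1 u) (-1)) as [e | ne].
  - exists qJ; split; [unfold S3, qJ; quat_cbv; ring|].
    destruct u as [u0 u1 u2 u3]; unfold imag, S3 in *; cbn [q0 q1] in *; subst; revert hu; quat_cbv.
    intros hu; assert (u2 = 0) by nra; assert (u3 = 0) by nra; subst.
    unfold qI, qJ; f_equal; ring.
  - set (v := qsub qone (qm qI u)).
    assert (pv : qdot v v = 2 * (1 + q1 u)).
    { destruct u as [u0 u1 u2 u3]; unfold imag, S3, v, qI in *; cbn [q0 q1] in *; subst; revert hu;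
        quat_cbv; intros hu; nra. }
    assert (p1 : 0 < 1 + q1 u).
    { destruct u as [u0 u1 u2 u3]; unfold imag, S3 in *; cbn [q0 q1] in *; subst; revert hu;
        quat_cbv; intros hu; nra. }
    set (r := sqrt (qdot v v)).
    assert (pr : 0 < r) by (apply sqrt_lt_R0; lra).
    assert (rr : r * r = qdot v v) by (apply sqrt_sqrt; lra).
    assert (comm : qm v u = qm qI v).
    { unfold v; transitivity (qadd u qI).
      - transitivity (qsub u (qm qI (qm u u))); [qring|].
        rewrite imag_square by auto; unfold qI; qring.
      - unfold qI; destruct u as [u0 u1 u2 u3]; quat_cbv; f_equal; ring. }
    exists (qs (/ r) v); split.
    + unfold S3; rewrite qdot_qs_l, qdot_qs_r, <- rr; field; lra.
    + transitivity (qs (/ r * / r) (qm (qm v u) (qc v))); [qring|].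
      rewrite comm, <- qmA, qm_qc_qs, <- rr.
      unfold qI; quat_cbv; f_equal; field; lra.
Qed.

Lemma plane_angle (f : R -> quat R) : curve4 f -> (forall s, S3 (f s)) ->
  (forall s, q0 (f s) = 0) -> (forall s, q1 (f s) = 0) ->
  exists psi : R -> R, smooth (fun p => psi (fst p)) /\
    forall s, f s = Quat 0 0 (cos (psi s)) (sin (psi s)).
Proof.
  intros (_ & _ & h2 & h3) u z0 z1.
  destruct (angle_lift _ _ h2 h3) as (t & ht & ct & st_ & _).
  { intros p; specialize (u (fst p)); unfold S3, qdot in u; rewrite z0, z1 in u; lra. }
  exists (fun s => t (s, 0)); split.
  - apply (smooth_comp2 t fst (fun _ => 0)); auto using smooth_fst, smooth_const.
  - intros s; rewrite ct, st_; apply quat_ext; cbn [q0 q1 q2 q3 fst]; auto.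
Qed.

Definition velocity (f : R -> quat R) (s : R) : quat R := qm (qderive f s) (qc (f s)).

Lemma velocity_curve f : curve4 f -> curve4 (velocity f).
Proof.
  intros h; apply smooth4_qm; [|now apply smooth4_qc].
  exact (smooth4_partial _ ax h).
Qed.

Lemma qderive_velocity f s : S3 (f s) -> qderive f s = qm (velocity f s) (f s).
Proof. intros h; symmetry; now apply S3_cancel_r'. Qed.

Lemma qderive_const_qm c f s : curve4 f -> qderive (fun s => qm c (f s)) s = qm c (qderive f s).
Proof.
  intros h; unfold qderive.
  rewrite (partial4_qm ax (fun _ => c) (fun p => f (fst p))) by auto using smooth4_const.
  rewrite partial4_const; qring.
Qed.

Lemma velocity_const_qm c f s : curve4 f ->
  velocity (fun s => qm c (f s)) s = qm (qm c (velocity f s)) (qc c).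
Proof.
  intros h; unfold velocity; rewrite qderive_const_qm, qc_qm by auto; now rewrite !qmA.
Qed.

Lemma velocity_imag f s : curve4 f -> (forall s, S3 (f s)) -> imag (velocity f s).
Proof.
  intros h h1; apply tangent_imag.
  exact (sphere_tangent ax (fun p => f (fst p)) (s, 0) h (fun p => h1 (fst p))).
Qed.

Lemma product_partial g1 g2 p : curve4 g1 -> curve4 g2 -> (forall s, S3 (g1 s)) -> (forall s, S3 (g2 s)) ->
  let G := fun p => qm (qc (g1 (fst p))) (g2 (snd p)) in
  partial4 ax G p = qs (-1) (qm (qc (g1 (fst p))) (qm (velocity g1 (fst p)) (g2 (snd p)))) /\
  partial4 ay G p = qm (qc (g1 (fst p))) (qm (velocity g2 (snd p)) (g2 (snd p))).
Proof.
  intros h1 h2 u1 u2 G; unfold G.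
  rewrite !(partial4_qm _ (fun p => qc (g1 (fst p))) (fun p => g2 (snd p))), !(partial4_qc _ (fun p => g1 (fst p)))
    by auto using smooth4_qc, curve4_comp, smooth_fst, smooth_snd.
  rewrite !partial4_curve by auto using smooth_fst, smooth_snd.
  rewrite !(is_partial_eq _ _ _ _ (is_partial_fst _ p)), !(is_partial_eq _ _ _ _ (is_partial_snd _ p)).
  rewrite !qderive_velocity by auto.
  split.
  - assert (i := velocity_imag g1 (fst p) h1 u1); apply imag_conj in i.
    transitivity (qm (qc (qm (velocity g1 (fst p)) (g1 (fst p)))) (g2 (snd p))); [qring|].
    rewrite qc_qm, i; qring.
  - qring.
Qed.

Lemma plane_det_sqr x y : q0 x = 0 -> q1 x = 0 -> q0 y = 0 -> q1 y = 0 ->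
  (q2 x * q3 y - q3 x * q2 y) * (q2 x * q3 y - q3 x * q2 y)
    = qdot x x * qdot y y - qdot x y * qdot x y.
Proof. unfold qdot; intros -> -> -> ->; ring. Qed.

(** [ap_orient] is the condition on [theta_2]: the difference of the two angles is [2 theta_2], and
    its sine is negative exactly when [theta_2] lies between [PI / 2] and [PI] modulo [PI]. *)
Record asymptotic_pair (g1 g2 : R -> quat R) (psi1 psi2 : R -> R) : Prop := {
  ap_curve1 : curve4 g1;
  ap_curve2 : curve4 g2;
  ap_S3_1 : forall s, S3 (g1 s);
  ap_S3_2 : forall t, S3 (g2 t);
  ap_smooth1 : smooth (fun p => psi1 (fst p));
  ap_smooth2 : smooth (fun p => psi2 (fst p));
  ap_velocity1 : forall s, velocity g1 s = Quat 0 0 (cos (psi1 s)) (sin (psi1 s));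
  ap_velocity2 : forall t, velocity g2 t = Quat 0 0 (cos (psi2 t)) (sin (psi2 t));
  ap_orient : forall s t, sin (psi1 s - psi2 t) < 0
}.

(** [mu] is constant along the [s] axis and [nu] along the [t] axis. Hence the velocities of both
    axis curves are orthogonal to the single vector [mu (0, 0)], and rotating that vector to [I]
    puts them in the [JK] plane. *)
Lemma asymptotic_split G N : smooth4 G -> smooth4 N ->
  (forall p, S3 (G p)) -> (forall p, S3 (N p)) -> (forall p, qdot (N p) (G p) = 0) ->
  (forall i p, qdot (N p) (partial4 i G p) = 0) ->
  (forall p, metric_det (induced_metric G) p <> 0) ->
  let nu := gauss_map G N in let mu := gauss_map (fun p => qc (G p)) (fun p => qc (N p)) in
  (forall p, partial4 ay nu p = Quat 0 0 0 0) ->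
  (forall p, qdot (partial4 ax nu p) (partial4 ax nu p) = 4) ->
  (forall p, partial4 ax mu p = Quat 0 0 0 0) ->
  (forall p, qdot (partial4 ay mu p) (partial4 ay mu p) = 4) ->
  exists g1 g2 psi1 psi2, asymptotic_pair g1 g2 psi1 psi2 /\
    forall p, G p = qm (qc (g1 (fst p))) (g2 (snd p)).
Proof.
  intros hG hN G1 N1 NG Nt nz nu mu nuy nux mux muy.
  destruct (asymptotic_direction G N ax ay) as [Gs1 trz]; auto.
  destruct (asymptotic_direction (fun p => qc (G p)) (fun p => qc (N p)) ay ax) as [Gt1' _];
    try (intros; apply S3_qc; auto); try (now apply smooth4_qc); auto.
  { intros; now rewrite qdot_qc. }
  { intros; rewrite partial4_qc, qdot_qc; auto. }
  { intros p; rewrite <- (nuy p); f_equal; apply functional_extensionality; intros q.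
    unfold nu, gauss_map; now rewrite !qc_qc. }
  assert (Gt1 : forall p, S3 (partial4 ay G p)).
  { intros p; specialize (Gt1' p); unfold S3 in *; now rewrite partial4_qc, qdot_qc in Gt1'. }
  assert (dec := product_decomposition G hG G1 trz).
  assert (snu : smooth4 nu) by (apply smooth4_qm; auto; now apply smooth4_qc).
  assert (smu : smooth4 mu) by (apply smooth4_qm; now repeat apply smooth4_qc).
  assert (mu0 : forall s, qm (qc (N (s, 0))) (G (s, 0)) = mu (0, 0)).
  { intros s; rewrite <- gauss_map_conj; apply (partial4_zero_indep ax mu smu mux s 0 0 0). }
  assert (nu0 : forall t, nu (0, t) = nu (0, 0)).
  { intros t; apply (partial4_zero_indep ay nu snu nuy 0 t 0 0). }
  set (k1 := fun s => qc (G (s, 0))); set (k2 := fun t => qm (qc (G (0, 0))) (G (0, t))).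
  assert (ck1 : curve4 k1) by (apply smooth4_qc, (curve4_slice_x G 0 hG)).
  assert (ck2' := curve4_slice_y G 0 hG).
  assert (ck2 : curve4 k2) by (apply smooth4_qm; auto using smooth4_const).
  assert (uk1 : forall s, S3 (k1 s)) by (intros; now apply S3_qc).
  assert (uk2 : forall s, S3 (k2 s)) by (intros; apply S3_qm; auto; now apply S3_qc).
  assert (d1 : forall s, qderive k1 s = qc (partial4 ax G (s, 0))).
  { intros s; exact (partial4_qc ax (fun p => G (fst p, 0)) (s, 0) (curve4_slice_x G 0 hG)). }
  assert (d2 : forall t, qderive k2 t = qm (qc (G (0, 0))) (partial4 ay G (0, t))).
  { intros t; exact (qderive_const_qm (qc (G (0, 0))) (fun t => G (0, t)) t ck2'). }
  assert (imu : imag (mu (0, 0))) by (unfold mu; rewrite gauss_map_conj;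
    transitivity (qdot (N (0, 0)) (G (0, 0))); [qring | apply NG]).
  assert (v1 : forall s, S3 (velocity k1 s)).
  { intros s; apply S3_qm; [rewrite d1; now apply S3_qc | now apply S3_qc]. }
  assert (v2 : forall s, S3 (velocity k2 s)).
  { intros s; apply S3_qm; [rewrite d2; apply S3_qm; auto; now apply S3_qc | now apply S3_qc]. }
  assert (o1 : forall s, qdot (velocity k1 s) (mu (0, 0)) = 0).
  { intros s; rewrite <- (mu0 s); unfold velocity, k1 at 2; rewrite d1, qc_qc, qdot_qm_r, qdot_qc.
    rewrite qdot_comm, Nt; ring. }
  assert (o2 : forall s, qdot (velocity k2 s) (mu (0, 0)) = 0).
  { intros s.
    (* Up to sign, [mu] at the origin is the conjugate of [nu] by [G (0, 0)]; this carries
       orthogonality along the [t] axis to the same vector. *)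
    assert (e : mu (0, 0) = qs (-1) (qm (qm (qc (G (0, 0))) (nu (0, s))) (G (0, 0)))).
    { rewrite nu0; unfold nu, gauss_map; rewrite <- !qmA, (proj2 (S3_inv _ (G1 (0, 0)))), qm1r.
      rewrite <- (qc_qc (mu (0, 0))), (imag_conj _ imu); unfold mu; rewrite gauss_map_conj; qring. }
    rewrite e, qdot_qs_r; unfold velocity, k2 at 2; rewrite d2, qc_qm, qc_qc, qmA, qdot_qm_r.
    rewrite <- (qmA (qc (G (0, 0)))), qdot_qm_l, qdot_comm.
    unfold nu, gauss_map; rewrite qdot_qm_r, Nt; ring. }
  destruct (rotate_to_I (mu (0, 0)) imu) as (c0 & uc0 & ec0).
  { unfold mu; rewrite gauss_map_conj; apply S3_qm; auto; now apply S3_qc. }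
  assert (Gk : forall p, G p = qm (qc (k1 (fst p))) (k2 (snd p))).
  { intros [s t]; unfold k1, k2; rewrite qc_qc; apply dec. }
  (* One of [c0] and [J c0] gives the required orientation. *)
  assert (fin : exists c, S3 c /\ (qm (qm c (mu (0, 0))) (qc c) = qI \/ qm (qm c (mu (0, 0))) (qc c) = qs (-1) qI) /\
    forall s t, 0 < q2 (qm (qm c (velocity k1 s)) (qc c)) * q3 (qm (qm c (velocity k2 t)) (qc c))
                  - q3 (qm (qm c (velocity k1 s)) (qc c)) * q2 (qm (qm c (velocity k2 t)) (qc c))).
  { set (w := fun c f s => qm (qm c (velocity f s)) (qc c)).
    set (D := fun c (p : R * R) => q2 (w c k1 (fst p)) * q3 (w c k2 (snd p))
                                 - q3 (w c k1 (fst p)) * q2 (w c k2 (snd p))).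
    assert (sw : forall f u, curve4 f -> smooth u -> smooth4 (fun p => w c0 f (u p))).
    { intros f u hf hu; unfold w.
      apply smooth4_qm; [apply smooth4_qm|]; try apply smooth4_const.
      apply (curve4_comp (velocity f)); auto using velocity_curve. }
    assert (sD : smooth (D c0)).
    { destruct (sw k1 fst ck1 smooth_fst) as (_ & _ & a2 & a3).
      destruct (sw k2 snd ck2 smooth_snd) as (_ & _ & b2 & b3).
      unfold D; smooth_tac. }
    assert (z0 : forall x, imag x -> q0 (qm (qm c0 x) (qc c0)) = 0) by
      (intros x ix; transitivity (q0 x * qdot c0 c0); [qring | rewrite ix; ring]).
    assert (z1 : forall x, qdot x (mu (0, 0)) = 0 -> q1 (qm (qm c0 x) (qc c0)) = 0).
    { intros x ox; transitivity (qdot (qm (qm c0 x) (qc c0)) qI); [unfold qI; qring|].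
      rewrite <- ec0, qdot_qm_r, qdot_qm_l, ox; ring. }
    (* The square of [D c0] is the metric determinant of [G], because the partials of [G] are
       isometric images of the two velocities. *)
    assert (nD : forall p, D c0 p <> 0).
    { intros [s t] e; apply (nz (s, t)).
      destruct (product_partial k1 k2 (s, t) ck1 ck2 uk1 uk2) as [e1 e2].
      replace (fun p => qm (qc (k1 (fst p))) (k2 (snd p))) with G in e1, e2
        by (apply functional_extensionality; auto).
      unfold D, w in e; cbn [fst snd] in e, e1, e2.
      apply (f_equal (fun r => r * r)) in e; rewrite plane_det_sqr in e;
        auto using velocity_imag.
      rewrite !qdot_qm_r, !qdot_qm_l, qdot_qc, v1, v2, uc0 in e.
      unfold metric_det, induced_metric; rewrite (qdot_comm (partial4 ay G (s, t)) (partial4 ax G (s, t))).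
      rewrite Gs1, Gt1, e1, e2, qdot_qs_l, qdot_qm_l, qdot_qm_r, qdot_qc, uk1, uk2; lra. }
    destruct (smooth_constant_sign (D c0) sD nD) as [pos | neg].
    - exists c0; split; [auto | split; [auto|]]; intros s t; exact (pos (s, t)).
    - exists (qm qJ c0); split; [apply S3_qm; auto; unfold S3, qJ; quat_cbv; ring | split].
      + right; transitivity (qm (qm qJ (qm (qm c0 (mu (0, 0))) (qc c0))) (qc qJ)).
        * rewrite qc_qm; now rewrite !qmA.
        * rewrite ec0; unfold qI, qJ; quat_cbv; f_equal; ring.
      + intros s t; specialize (neg (s, t)); unfold D, w in neg; cbn [fst snd] in neg.
        assert (J : forall x, qm (qm (qm qJ c0) x) (qc (qm qJ c0)) =
          qm (qm qJ (qm (qm c0 x) (qc c0))) (qc qJ)) by (intros; rewrite qc_qm; now rewrite !qmA).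
        rewrite !J; revert neg.
        generalize (qm (qm c0 (velocity k1 s)) (qc c0)) (qm (qm c0 (velocity k2 t)) (qc c0)).
        unfold qJ; intros [a0 a1 a2 a3] [b0 b1 b2 b3]; quat_cbv; lra. }
  destruct fin as (c & uc & ec & or).
  set (g1 := fun s => qm c (k1 s)); set (g2 := fun s => qm c (k2 s)).
  assert (cg1 : curve4 g1) by (apply smooth4_qm; auto using smooth4_const).
  assert (cg2 : curve4 g2) by (apply smooth4_qm; auto using smooth4_const).
  assert (ug1 : forall s, S3 (g1 s)) by (intros; now apply S3_qm).
  assert (ug2 : forall s, S3 (g2 s)) by (intros; now apply S3_qm).
  assert (w1 : forall s, velocity g1 s = qm (qm c (velocity k1 s)) (qc c))
    by (intros; now apply velocity_const_qm).
  assert (w2 : forall s, velocity g2 s = qm (qm c (velocity k2 s)) (qc c))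
    by (intros; now apply velocity_const_qm).
  assert (z1 : forall x, qdot x (mu (0, 0)) = 0 -> q1 (qm (qm c x) (qc c)) = 0).
  { intros x ox.
    assert (e : qdot (qm (qm c x) (qc c)) (qm (qm c (mu (0, 0))) (qc c)) = 0)
      by (rewrite qdot_qm_r, qdot_qm_l, ox; ring).
    revert e; generalize (qm (qm c x) (qc c)); intros [a0 a1 a2 a3].
    destruct ec as [-> | ->]; unfold qI; quat_cbv; lra. }
  destruct (plane_angle (velocity g1)) as (psi1 & sp1 & ep1); auto using velocity_curve.
  { intros; rewrite w1; apply S3_qm; [apply S3_qm | apply S3_qc]; auto. }
  { intros; now apply velocity_imag. }
  { intros; rewrite w1; auto. }
  destruct (plane_angle (velocity g2)) as (psi2 & sp2 & ep2); auto using velocity_curve.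
  { intros; rewrite w2; apply S3_qm; [apply S3_qm | apply S3_qc]; auto. }
  { intros; now apply velocity_imag. }
  { intros; rewrite w2; auto. }
  exists g1, g2, psi1, psi2; split;
    [refine (Build_asymptotic_pair _ _ _ _ cg1 cg2 ug1 ug2 sp1 sp2 ep1 ep2 _)|].
  2: intros p; rewrite Gk; unfold g1, g2; rewrite qc_qm, <- qmA, S3_cancel_l; auto.
  - intros s t; specialize (or s t); rewrite <- w1, <- w2, ep1, ep2 in or; cbn [q2 q3] in or.
    rewrite sin_minus; lra.
Qed.


(** * Null coordinates on the Lorentz numbers *)

(** Null coordinates, inverse to [st]. In them Lorentz multiplication is componentwise, so power
    series and differential equations split into two real ones. *)
Definition lp (a : lorentz) : R := fst a + snd a.
Definition lm (a : lorentz) : R := fst a - snd a.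

Ltac lorentz_ring :=
  intros; unfold st, lp, lm, Lconj, Lreal, Lsigma, Lsub, Lscal, Lmul, Ladd, Lopp in *; cbn [fst snd];
  first [apply injective_projections; cbn [fst snd]; field | field].

Lemma st_lp_lm a : st (lp a) (lm a) = a.
Proof. destruct a; lorentz_ring. Qed.
Lemma lp_st s t : lp (st s t) = s. Proof. lorentz_ring. Qed.
Lemma lm_st s t : lm (st s t) = t. Proof. lorentz_ring. Qed.
Lemma fst_st s t : fst (st s t) = / 2 * (s + t). Proof. lorentz_ring. Qed.
Lemma snd_st s t : snd (st s t) = / 2 * (s - t). Proof. lorentz_ring. Qed.
Lemma Ladd_st s t s' t' : Ladd (st s t) (st s' t') = st (s + s') (t + t').
Proof. lorentz_ring. Qed.
Lemma Lmul_st s t s' t' : Lmul (st s t) (st s' t') = st (s * s') (t * t').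
Proof. lorentz_ring. Qed.
Lemma Lscal_st r s t : Lscal r (st s t) = st (r * s) (r * t).
Proof. lorentz_ring. Qed.
Lemma Lreal_st r : Lreal r = st r r.
Proof. lorentz_ring. Qed.
Lemma Lsigma_st : Lsigma = st 1 (-1).
Proof. lorentz_ring. Qed.
Lemma st_inj s t s' t' : st s t = st s' t' -> s = s' /\ t = t'.
Proof.
  intros h; assert (a := f_equal lp h); assert (b := f_equal lm h).
  now rewrite !lp_st in a; rewrite !lm_st in b.
Qed.

Lemma Lpow_st s t n : Lpow (st s t) n = st (s ^ n) (t ^ n).
Proof. induction n; cbn [Lpow pow]; [apply Lreal_st | now rewrite IHn, Lmul_st]. Qed.

Lemma is_series_cos x : is_series (fun n => (-1) ^ n / INR (fact (2 * n)) * x ^ (2 * n)) (cos x).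
Proof.
  unfold cos; destruct (exist_cos (Rsqr x)) as [l h]; apply is_series_Reals.
  unfold cos_in, cos_n in h; unfold infinite_sum in *; intros eps pe.
  destruct (h eps pe) as [n hn]; exists n; intros m hm; specialize (hn m hm).
  erewrite sum_eq; [exact hn|].
  intros i _; cbv beta; rewrite pow_mult, Rsqr_pow2; reflexivity.
Qed.

Lemma is_series_sin x :
  is_series (fun n => (-1) ^ n / INR (fact (2 * n + 1)) * x ^ (2 * n + 1)) (sin x).
Proof.
  unfold sin; destruct (exist_sin (Rsqr x)) as [l h].
  assert (s : is_series (fun n => sin_n n * (Rsqr x) ^ n) l) by (apply is_series_Reals, h).
  apply (is_series_scal_l x) in s.
  eapply is_series_ext; [|exact s].
  intros n; change (x * (sin_n n * Rsqr x ^ n) = (-1) ^ n / INR (fact (2 * n + 1)) * x ^ (2 * n + 1)).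
  unfold sin_n; rewrite pow_add, pow_mult, Rsqr_pow2, pow_1; ring.
Qed.

Lemma Series_st (u v : nat -> R) lu lv : is_series u lu -> is_series v lv ->
  Lseries (fun n => st (u n) (v n)) = st lu lv.
Proof.
  intros hu hv; unfold Lseries; rewrite (surjective_pairing (st lu lv)), fst_st, snd_st.
  f_equal; apply is_series_unique.
  - apply (is_series_ext (fun n => / 2 * (u n + v n))); [intros; now rewrite fst_st|].
    apply (is_series_scal_l (/ 2) (fun n => u n + v n)), (is_series_plus u v); auto.
  - apply (is_series_ext (fun n => / 2 * (u n - v n))); [intros; now rewrite snd_st|].
    apply (is_series_scal_l (/ 2) (fun n => u n - v n)), (is_series_minus u v); auto.
Qed.

Lemma Lcos_st s t : Lcos (st s t) = st (cos s) (cos t).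
Proof.
  rewrite <- (Series_st _ _ _ _ (is_series_cos s) (is_series_cos t)); unfold Lcos; f_equal.
  apply functional_extensionality; intros n; now rewrite Lpow_st, Lscal_st.
Qed.

Lemma Lsin_st s t : Lsin (st s t) = st (sin s) (sin t).
Proof.
  rewrite <- (Series_st _ _ _ _ (is_series_sin s) (is_series_sin t)); unfold Lsin; f_equal.
  apply functional_extensionality; intros n; now rewrite Lpow_st, Lscal_st.
Qed.

(** The Lorentz quaternion with components [xi_+] and [xi_-]. Products and [Hbar] act on each
    component, whereas [Hhat] exchanges the two. *)
Definition Hst : quat R -> quat R -> HL := qmap2 st.

Lemma HL_ext (x y : HL) : q0 x = q0 y -> q1 x = q1 y -> q2 x = q2 y -> q3 x = q3 y -> x = y.
Proof. destruct x, y; simpl; now intros -> -> -> ->. Qed.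

Ltac H_ring :=
  intros; repeat match goal with x : quat R |- _ => destruct x end;
  apply HL_ext; unfold Hst, Hmul, Hadd, Hbar, Hhat, Hscal, qm, qc, R4_HL, HJ, HK,
    qmap2, qmap; cbn [q0 q1 q2 q3];
  unfold st, Lconj, Lreal, Lsigma, Lsub, Lscal, Lmul, Ladd, Lopp; apply injective_projections; cbn [fst snd]; field.

Lemma Hmul_st a b c d : Hmul (Hst a b) (Hst c d) = Hst (qm a c) (qm b d).
Proof. H_ring. Qed.
Lemma Hbar_st a b : Hbar (Hst a b) = Hst (qc a) (qc b).
Proof. H_ring. Qed.
Lemma Hhat_st a b : Hhat (Hst a b) = Hst b a.
Proof. H_ring. Qed.
Lemma R4_HL_st x : R4_HL x = Hscal Lsigma (Hst x (qc x)).
Proof. H_ring. Qed.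
Lemma JK_plane_st a b c d :
  Hadd (Hscal (st a b) HJ) (Hscal (st c d) HK) = Hst (Quat 0 0 a c) (Quat 0 0 b d).
Proof. H_ring. Qed.

Lemma Hform_st a b c d : Hform (Hst a b) (Hst c d) = st (qdot a c) (qdot b d).
Proof.
  unfold Hform, Hst, qmap2, qdot; cbn [q0 q1 q2 q3]; lorentz_ring.
Qed.

Lemma S3L_st a b : S3L (Hst a b) <-> S3 a /\ S3 b.
Proof.
  unfold S3L, S3; rewrite Hform_st, Lreal_st; split; [apply st_inj | now intros [-> ->]].
Qed.

Lemma Hinv_S3L x : S3L x -> Hinv x = Hbar x.
Proof.
  intros h; unfold Hinv; rewrite h.
  destruct x as [[] [] [] []]; apply HL_ext; unfold Hscal, Hbar, qmap, Linv, Lreal;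
    cbn [q0 q1 q2 q3]; lorentz_ring.
Qed.

Lemma Hst_inj a b c d : Hst a b = Hst c d -> a = c /\ b = d.
Proof.
  intros h; assert (h0 := f_equal q0 h); assert (h1 := f_equal q1 h);
    assert (h2 := f_equal q2 h); assert (h3 := f_equal q3 h).
  apply st_inj in h0; apply st_inj in h1; apply st_inj in h2; apply st_inj in h3.
  now split; apply quat_ext.
Qed.

(** The product of [Hbar] and [Hhat] has components [conj A * B] and [conj B * A]. They are
    conjugate to each other, and sigma times such pairs is the embedded copy of R^4. *)
Lemma torus_formula_st g a A B : g a = Hst A B -> torus_formula g a = R4_HL (qm (qc A) B).
Proof.
  intros h; unfold torus_formula; rewrite h, Hbar_st, Hhat_st, Hmul_st, R4_HL_st.
  now rewrite qc_qm, qc_qc.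
Qed.

Lemma smooth_lp f : Lsmooth f -> smooth (fun p => lp (f p)).
Proof. intros [h1 h2]; now apply smooth_plus. Qed.

Lemma smooth_lm f : Lsmooth f -> smooth (fun p => lm (f p)).
Proof. intros [h1 h2]; now apply smooth_minus. Qed.

(** Conformality decouples: the difference of the two partials annihilates the plus component, and
    their sum annihilates the minus component. *)
Lemma conformal_null f : conformal f -> forall p,
  partial ay (fun p => lp (f p)) p = partial ax (fun p => lp (f p)) p /\
  partial ay (fun p => lm (f p)) p = - partial ax (fun p => lm (f p)) p /\
  Lderive f p = st (partial ax (fun p => lp (f p)) p) (partial ax (fun p => lm (f p)) p).
Proof.
  intros [[h1 h2] cf] p; specialize (cf p).
  assert (ep : forall i, partial i (fun p => lp (f p)) p =
    partial i (fun b => fst (f b)) p + partial i (fun b => snd (f b)) p).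
  { intros i; apply is_partial_eq, (is_partial_plus i (fun b => fst (f b)) (fun b => snd (f b)));
      now apply smooth_is. }
  assert (em : forall i, partial i (fun p => lm (f p)) p =
    partial i (fun b => fst (f b)) p - partial i (fun b => snd (f b)) p).
  { intros i; apply is_partial_eq, (is_partial_minus i (fun b => fst (f b)) (fun b => snd (f b)));
      now apply smooth_is. }
  rewrite !ep, !em; unfold Lderive; unfold Lpartial in *; revert cf.
  generalize (partial ay (fun b => fst (f b)) p) (partial ay (fun b => snd (f b)) p)
    (partial ax (fun b => fst (f b)) p) (partial ax (fun b => snd (f b)) p).
  intros a b c d; unfold Lmul, Lsigma; cbn [fst snd]; intros h; injection h; intros.
  split; [lra | split; [lra|]]; unfold st; lorentz_ring.
Qed.

Lemma smooth_lp_id : smooth lp.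
Proof. apply smooth_plus; [apply smooth_fst | apply smooth_snd]. Qed.

Lemma smooth_lm_id : smooth lm.
Proof. apply smooth_minus; [apply smooth_fst | apply smooth_snd]. Qed.

Lemma partial_lp_lm p : partial ax lp p = 1 /\ partial ay lp p = 1 /\
  partial ax lm p = 1 /\ partial ay lm p = -1.
Proof.
  assert (d1 := fun i => is_partial_eq i lp p _
    (is_partial_plus _ _ _ _ _ _ (is_partial_fst i p) (is_partial_snd i p))).
  assert (d2 := fun i => is_partial_eq i lm p _
    (is_partial_minus _ _ _ _ _ _ (is_partial_fst i p) (is_partial_snd i p))).
  rewrite !d1, !d2; repeat split; ring.
Qed.

Lemma null_conformal (f1 f2 : R -> R) (d1 d2 : R -> R) :
  smooth (fun p => f1 (fst p)) -> smooth (fun p => f2 (fst p)) ->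
  (forall s, is_derive f1 s (d1 s)) -> (forall s, is_derive f2 s (d2 s)) ->
  conformal (fun a => st (f1 (lp a)) (f2 (lm a))) /\
  forall a, Lderive (fun a => st (f1 (lp a)) (f2 (lm a))) a = st (d1 (lp a)) (d2 (lm a)).
Proof.
  intros h1 h2 e1 e2.
  assert (s1 : smooth (fun a => f1 (lp a)))
    by exact (smooth_comp2 _ lp (fun _ => 0) h1 smooth_lp_id (smooth_const 0)).
  assert (s2 : smooth (fun a => f2 (lm a)))
    by exact (smooth_comp2 _ lm (fun _ => 0) h2 smooth_lm_id (smooth_const 0)).
  assert (p1 : forall i p, is_partial i (fun a => f1 (lp a)) p (d1 (lp p) * partial i lp p)).
  { intros i p; apply is_partial_comp1; auto; apply smooth_is, smooth_lp_id. }
  assert (p2 : forall i p, is_partial i (fun a => f2 (lm a)) p (d2 (lm p) * partial i lm p)).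
  { intros i p; apply is_partial_comp1; auto; apply smooth_is, smooth_lm_id. }
  assert (ef : (fun a => fst (st (f1 (lp a)) (f2 (lm a)))) = fun a => / 2 * (f1 (lp a) + f2 (lm a)))
    by (apply functional_extensionality; intros; apply fst_st).
  assert (es : (fun a => snd (st (f1 (lp a)) (f2 (lm a)))) = fun a => / 2 * (f1 (lp a) - f2 (lm a)))
    by (apply functional_extensionality; intros; apply snd_st).
  assert (P : forall i p, Lpartial i (fun a => st (f1 (lp a)) (f2 (lm a))) p =
    st (d1 (lp p) * partial i lp p) (d2 (lm p) * partial i lm p)).
  { intros i p; unfold Lpartial.
    rewrite (surjective_pairing (st (d1 (lp p) * partial i lp p) (d2 (lm p) * partial i lm p))), fst_st, snd_st.
    f_equal; [refine (eq_trans (f_equal (fun f => partial i f p) ef) _)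
             | refine (eq_trans (f_equal (fun f => partial i f p) es) _)]; apply is_partial_eq.
    - replace (/ 2 * _) with (0 * (f1 (lp p) + f2 (lm p)) + / 2 * (d1 (lp p) * partial i lp p + d2 (lm p) * partial i lm p)) by ring.
      apply (is_partial_mult i (fun _ => / 2)); [apply is_partial_const | now apply is_partial_plus].
    - replace (/ 2 * _) with (0 * (f1 (lp p) - f2 (lm p)) + / 2 * (d1 (lp p) * partial i lp p - d2 (lm p) * partial i lm p)) by ring.
      apply (is_partial_mult i (fun _ => / 2)); [apply is_partial_const | now apply is_partial_minus]. }
  split.
  - split.
    + split; [refine (eq_ind_r smooth _ ef) | refine (eq_ind_r smooth _ es)]; smooth_tac.
    + intros a; rewrite !P, Lsigma_st, Lmul_st.
      destruct (partial_lp_lm a) as (-> & -> & -> & ->); f_equal; ring.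
  - intros a; unfold Lderive; rewrite P.
    destruct (partial_lp_lm a) as (-> & _ & -> & _); f_equal; ring.
Qed.

(** * From a conformal map to a flat torus *)

Definition principal_metric (th : R * R -> R) : metric_field := fun i j p =>
  match i, j with
  | ax, ax => 4 * (sin (th p) * sin (th p))
  | ay, ay => 4 * (cos (th p) * cos (th p))
  | _, _ => 0
  end.

(** Each Christoffel symbol is a derivative of [th] times the cotangent or minus the tangent of
    [th]. In the curvature the terms quadratic in first derivatives cancel, and the rest is
    proportional to the wave operator applied to [th]. *)
Lemma principal_metric_flat th : smooth th ->
  (forall p, partial ax (partial ax th) p = partial ay (partial ay th) p) ->
  (forall p, sin (th p) <> 0) -> (forall p, cos (th p) <> 0) ->
  flat (principal_metric th).
Proof.
  intros hth wave ns nc.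
  set (h := principal_metric th).
  set (swap := fun i j : axis => match i, j with ax, ax | ay, ay => ax | _, _ => ay end).
  set (swap' := fun i j : axis => match i, j with ax, ax | ay, ay => ay | _, _ => ax end).
  assert (dxx : forall i p, partial i (fun p => 4 * (sin (th p) * sin (th p))) p =
    8 * (sin (th p) * cos (th p) * partial i th p)).
  { intros i p; etransitivity; [apply is_partial_eq; partial_tac | cbn beta; ring]. }
  assert (dyy : forall i p, partial i (fun p => 4 * (cos (th p) * cos (th p))) p =
    - 8 * (sin (th p) * cos (th p) * partial i th p)).
  { intros i p; etransitivity; [apply is_partial_eq; partial_tac | cbn beta; ring]. }
  assert (d0 : forall i p, partial i (fun _ : R * R => 0) p = 0)
    by (intros; apply is_partial_eq, is_partial_const).
  assert (dh : forall u i j p, partial u (h i j) p = match i, j with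
    | ax, ax => 8 * (sin (th p) * cos (th p) * partial u th p)
    | ay, ay => - 8 * (sin (th p) * cos (th p) * partial u th p)
    | _, _ => 0 end).
  { intros u [] [] p; [apply dxx | apply d0 | apply d0 | apply dyy]. }
  assert (G : forall k i j, christoffel h k i j = fun p => match k with
    | ax => cos (th p) * / sin (th p) * partial (swap i j) th p
    | ay => - (sin (th p) * / cos (th p)) * partial (swap' i j) th p end).
  { intros k i j; apply functional_extensionality; intros p.
    specialize (ns p); specialize (nc p).
    unfold christoffel, sum_axis; rewrite !dh; unfold metric_inv, metric_det, h, principal_metric.
    destruct k, i, j; unfold swap, swap'; field; auto. }
  assert (gx : forall u a p, partial u (fun p => cos (th p) * / sin (th p) * partial a th p) p =
    (- 1 - cos (th p) * cos (th p) * (/ sin (th p) * / sin (th p))) * partial u th p * partial a th p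
    + cos (th p) * / sin (th p) * partial u (partial a th) p).
  { intros u a p; specialize (ns p).
    etransitivity; [apply is_partial_eq|].
    - eapply is_partial_mult; [eapply is_partial_mult; [partial_tac | apply is_partial_inv; auto; partial_tac]|].
      apply smooth_is, smooth_partial, hth.
    - cbn beta; field; auto. }
  assert (gy : forall u a p, partial u (fun p => - (sin (th p) * / cos (th p)) * partial a th p) p =
    - (1 + sin (th p) * sin (th p) * (/ cos (th p) * / cos (th p))) * partial u th p * partial a th p
    - sin (th p) * / cos (th p) * partial u (partial a th) p).
  { intros u a p; specialize (nc p).
    etransitivity; [apply is_partial_eq|].
    - eapply is_partial_mult; [eapply is_partial_opp, is_partial_mult; [partial_tac | apply is_partial_inv; auto; partial_tac]|].
      apply smooth_is, smooth_partial, hth.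
    - cbn beta; field; auto. }
  intros l k i j p; unfold riemann, sum_axis; rewrite !G.
  specialize (ns p); specialize (nc p); specialize (wave p).
  assert (sch := smooth_Schwarz th p hth).
  destruct l; rewrite ?gx, ?gy; destruct k, i, j; unfold swap, swap';
    rewrite ?wave, ?sch; field; auto.
Qed.

Lemma powerRZ_opp1_sqr m : powerRZ (-1) m * powerRZ (-1) m = 1.
Proof.
  rewrite <- powerRZ_mult_distr by (right; lra).
  replace (-1 * -1) with 1 by ring; apply powerRZ_R1.
Qed.

Lemma powerRZ_opp1_parity m n : (2 | m - n)%Z -> powerRZ (-1) m * powerRZ (-1) n = 1.
Proof.
  intros [k h]; replace m with (n + (k + k))%Z by lia.
  rewrite !powerRZ_add by lra.
  replace (powerRZ (-1) n * (powerRZ (-1) k * powerRZ (-1) k) * powerRZ (-1) n)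
    with ((powerRZ (-1) n * powerRZ (-1) n) * (powerRZ (-1) k * powerRZ (-1) k)) by ring.
  rewrite !powerRZ_opp1_sqr; ring.
Qed.

Definition Hp (x : HL) : quat R := qmap lp x.
Definition Hm (x : HL) : quat R := qmap lm x.

Lemma Hst_eta x : Hst (Hp x) (Hm x) = x.
Proof. apply HL_ext; apply st_lp_lm. Qed.

Lemma Hp_st a b : Hp (Hst a b) = a.
Proof. apply quat_ext; apply lp_st. Qed.

Lemma Hm_st a b : Hm (Hst a b) = b.
Proof. apply quat_ext; apply lm_st. Qed.

Lemma Hconformal_null g : Hconformal g ->
  smooth4 (fun p => Hp (g p)) /\ smooth4 (fun p => Hm (g p)) /\ forall p,
  partial4 ay (fun p => Hp (g p)) p = partial4 ax (fun p => Hp (g p)) p /\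
  partial4 ay (fun p => Hm (g p)) p = qs (-1) (partial4 ax (fun p => Hm (g p)) p) /\
  Hderive g p = Hst (partial4 ax (fun p => Hp (g p)) p) (partial4 ax (fun p => Hm (g p)) p).
Proof.
  intros (h0 & h1 & h2 & h3); split; [|split].
  - repeat split; [apply (smooth_lp (fun p => q0 (g p))) | apply (smooth_lp (fun p => q1 (g p)))
      | apply (smooth_lp (fun p => q2 (g p))) | apply (smooth_lp (fun p => q3 (g p)))];
      [apply h0 | apply h1 | apply h2 | apply h3].
  - repeat split; [apply (smooth_lm (fun p => q0 (g p))) | apply (smooth_lm (fun p => q1 (g p)))
      | apply (smooth_lm (fun p => q2 (g p))) | apply (smooth_lm (fun p => q3 (g p)))];
      [apply h0 | apply h1 | apply h2 | apply h3].
  - intros p.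
    destruct (conformal_null _ h0 p) as (a0 & b0 & c0); destruct (conformal_null _ h1 p) as (a1 & b1 & c1);
      destruct (conformal_null _ h2 p) as (a2 & b2 & c2); destruct (conformal_null _ h3 p) as (a3 & b3 & c3).
    split; [|split].
    + apply quat_ext; assumption.
    + apply quat_ext; cbn [q0 q1 q2 q3 qs qmap partial4 Hm];
        [rewrite b0 | rewrite b1 | rewrite b2 | rewrite b3]; ring.
    + apply HL_ext; assumption.
Qed.

(** [u] and [v] are the right logarithmic derivatives of the components [A] and [B]. Up to left and
    right translations the partials of [F] are [v - u] and [- (v + u)], orthogonal because [u] and
    [v] are unit vectors; their lengths follow from the angle [2 * th] between [u] and [v]. *)
Lemma torus_data_flat s1 t1 s2 t2 S T g psi g1 g2 :
  torus_data s1 t1 s2 t2 S T g psi g1 g2 ->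
  exists F : lorentz -> quat R,
    (forall a, R4_HL (F a) = torus_formula g a) /\
    flat_torus_in_S3 (st s1 t1) (st s2 t2) F.
Proof.
  intros [li pS pT hS hT cg sg cpsi eq spl u1 u2 per th2].
  destruct (Hconformal_null g cg) as (sA & sB & dAB).
  set (A := fun p : R * R => Hp (g p)) in *; set (B := fun p : R * R => Hm (g p)) in *.
  assert (gAB : forall p, g p = Hst (A p) (B p)) by (intros; symmetry; apply Hst_eta).
  assert (A1 : forall p, S3 (A p)) by (intros p; specialize (sg p); rewrite gAB in sg; now apply S3L_st in sg).
  assert (B1 : forall p, S3 (B p)) by (intros p; specialize (sg p); rewrite gAB in sg; now apply S3L_st in sg).
  assert (eA : forall p, A p = g1 (lp p)).
  { intros p; unfold A; rewrite <- (st_lp_lm p) at 1; rewrite spl; apply Hp_st. }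
  assert (eB : forall p, B p = g2 (lm p)).
  { intros p; unfold B; rewrite <- (st_lp_lm p) at 1; rewrite spl; apply Hm_st. }
  set (th := fun p => snd (psi p)).
  set (u := fun p => Quat 0 0 (cos (lp (psi p))) (sin (lp (psi p)))).
  set (v := fun p => Quat 0 0 (cos (lm (psi p))) (sin (lm (psi p)))).
  assert (uv : forall p, partial4 ax A p = qm (u p) (A p) /\ partial4 ax B p = qm (v p) (B p)).
  { intros p; specialize (eq p); destruct (dAB p) as (_ & _ & d).
    rewrite Hinv_S3L, d, gAB, Hbar_st, Hmul_st in eq by auto.
    rewrite <- (st_lp_lm (psi p)), Lcos_st, Lsin_st, JK_plane_st in eq.
    apply Hst_inj in eq; destruct eq as [e1 e2].
    unfold u, v; rewrite <- e1, <- e2; split; symmetry; now apply S3_cancel_r'. }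
  set (F := fun p => qm (qc (A p)) (B p)).
  assert (sF : smooth4 F) by (apply smooth4_qm; auto; now apply smooth4_qc).
  assert (iu : forall p, qc (u p) = qs (-1) (u p)) by (intros; now apply imag_conj).
  assert (Fx : forall p, partial4 ax F p = qm (qm (qc (A p)) (qsub (v p) (u p))) (B p)).
  { intros p; unfold F; rewrite partial4_qm, partial4_qc by auto using smooth4_qc.
    destruct (uv p) as [-> ->]; rewrite qc_qm, iu; qring. }
  assert (Fy : forall p, partial4 ay F p = qm (qm (qc (A p)) (qs (-1) (qadd (v p) (u p)))) (B p)).
  { intros p; unfold F; rewrite partial4_qm, partial4_qc by auto using smooth4_qc.
    destruct (dAB p) as (-> & -> & _); destruct (uv p) as [-> ->]; rewrite qc_qm, iu; qring. }
  assert (dot : forall p x y, qdot (qm (qm (qc (A p)) x) (B p)) (qm (qm (qc (A p)) y) (B p)) = qdot x y).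
  { intros p x y; rewrite qdot_qm_r, qdot_qm_l, qdot_qc, A1, B1; ring. }
  assert (met : induced_metric F = principal_metric th).
  { apply functional_extensionality; intros i; apply functional_extensionality; intros j;
      apply functional_extensionality; intros p; unfold induced_metric.
    assert (ap : lp (psi p) = fst (psi p) + th p) by reflexivity.
    assert (am : lm (psi p) = fst (psi p) - th p) by reflexivity.
    assert (t1' := sin2_cos2 (fst (psi p))); assert (t2' := sin2_cos2 (th p)); unfold Rsqr in *.
    assert (u' : qdot (u p) (u p) = 1).
    { unfold u; quat_cbv; assert (t := sin2_cos2 (lp (psi p))); unfold Rsqr in t; lra. }
    assert (v' : qdot (v p) (v p) = 1).
    { unfold v; quat_cbv; assert (t := sin2_cos2 (lm (psi p))); unfold Rsqr in t; lra. }
    assert (uv' : qdot (u p) (v p) = cos (th p) * cos (th p) - sin (th p) * sin (th p)).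
    { rewrite <- cos_plus; replace (th p + th p) with (lp (psi p) - lm (psi p)) by (rewrite ap, am; ring).
      rewrite cos_minus; unfold u, v; quat_cbv; ring. }
    destruct i, j; rewrite ?Fx, ?Fy, dot; qdot_expand; rewrite ?(qdot_comm (v p) (u p)), u', v', uv';
      unfold principal_metric; lra. }
  assert (spsi := cpsi); destruct spsi as [[sp1 sp2] cf].
  (* The range of [theta_2] enters through [sin (2 * th) < 0], which excludes zeros of both sine and
     cosine. *)
  assert (nsc : forall p, sin (th p) <> 0 /\ cos (th p) <> 0).
  { intros p; destruct (th2 p) as [k hk]; fold (th p) in hk.
    assert (h : sin (2 * (th p)) < 0).
    { replace (2 * th p) with (2 * (th p - IZR k * PI) + 2 * IZR k * PI) by ring.
      assert (per1 : sin (2 * (th p - IZR k * PI) + 2 * IZR k * PI) = sin (2 * (th p - IZR k * PI))).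
      { assert (e : sin (2 * (th p - IZR k * PI) + IZR k * (2 * PI)) = sin (2 * (th p - IZR k * PI)))
            by (apply (Z_invariant sin (2 * PI)); intros x; rewrite sin_plus, sin_2PI, cos_2PI; ring).
        rewrite <- e; f_equal; ring. }
      rewrite per1; apply sin_lt_0; lra. }
    rewrite sin_2a in h; split; intros z; rewrite z in h; lra. }
  exists F; split.
  { intros a; unfold F; symmetry; now apply torus_formula_st. }
  split.
  - exact li.
  - exact sF.
  - intros p; apply S3_qm; auto; now apply S3_qc.
  - intros p q hq.
    assert (Fg : forall p, F p = qm (qc (g1 (lp p))) (g2 (lm p))) by (intros; unfold F; now rewrite eA, eB).
    assert (lpa : forall a b, lp (Ladd a b) = lp a + lp b) by (intros; unfold lp, Ladd; cbn; ring).
    assert (lma : forall a b, lm (Ladd a b) = lm a + lm b) by (intros; unfold lm, Ladd; cbn; ring).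
    rewrite !Fg, lpa, lma.
    destruct per as [[per1 per2] | [per1 [per2 lat]]].
    + destruct hq as [m [n ->]]; rewrite !Lscal_st, Ladd_st, lp_st, lm_st.
      destruct (proj1 (hS (IZR m * s1 + IZR n * s2))) as [k ->]; [now exists m, n|].
      destruct (proj1 (hT (IZR m * t1 + IZR n * t2))) as [l ->]; [now exists m, n|].
      now rewrite (Z_invariant g1 S per1), (Z_invariant g2 T per2).
    (* Each of the two curves contributes a sign; the parity condition makes their product 1. *)
    + destruct (lat q hq) as [m [n [-> h2]]]; rewrite lp_st, lm_st, per1, per2.
      assert (e := powerRZ_opp1_parity m n h2).
      transitivity (qs (powerRZ (-1) m * powerRZ (-1) n) (qm (qc (g1 (lp p))) (g2 (lm p)))).
      * generalize (powerRZ (-1) m) (powerRZ (-1) n) (g1 (lp p)) (g2 (lm p)); qring.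
      * now rewrite e, qs1.
  - intros p a b h; destruct (nsc p) as [n1 n2].
    assert (E : forall i j, qdot (partial4 i F p) (partial4 j F p) = principal_metric th i j p)
      by (intros; rewrite <- met; reflexivity).
    assert (h' : qadd (qs a (partial4 ax F p)) (qs b (partial4 ay F p)) = Quat 0 0 0 0) by exact h.
    assert (ea := f_equal (fun q => qdot q (partial4 ax F p)) h').
    assert (eb := f_equal (fun q => qdot q (partial4 ay F p)) h').
    assert (z : forall x, qdot (Quat 0 0 0 0) x = 0) by qring.
    cbv beta in ea, eb; rewrite z, qdot_qadd_l, !qdot_qs_l, !E in ea, eb.
    unfold principal_metric in ea, eb.
    assert (0 < sin (th p) * sin (th p)) by nra.
    assert (0 < cos (th p) * cos (th p)) by nra.
    split; nra.
  - rewrite met; apply principal_metric_flat; auto; try (intros; apply nsc).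
    intros p.
    (* Cauchy-Riemann equations for [psi]: each first partial of [th] is the other partial of the
       real part, so symmetry of second derivatives gives the wave equation. *)
    assert (c1 : forall q, partial ay (fun b => fst (psi b)) q = partial ax th q).
    { intros q; assert (e := f_equal fst (cf q)); unfold Lpartial, Lmul, Lsigma in e; cbn [fst snd] in e.
      refine (eq_trans e _); rewrite Rmult_0_l, Rplus_0_l, Rmult_1_l; reflexivity. }
    assert (c2 : forall q, partial ay th q = partial ax (fun b => fst (psi b)) q).
    { intros q; assert (e := f_equal snd (cf q)); unfold Lpartial, Lmul, Lsigma in e; cbn [fst snd] in e.
      refine (eq_trans e _); rewrite Rmult_0_l, Rmult_1_l, Rplus_0_l; reflexivity. }
    replace (partial ay th) with (partial ax (fun b => fst (psi b)))
      by (apply functional_extensionality; intros; now rewrite c2).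
    rewrite <- (smooth_Schwarz _ _ sp1); f_equal.
    apply functional_extensionality; intros; now rewrite c1.
Qed.


(** * Periods of the asymptotic curves *)

(** If [f a < f 0], concavity along the multiples of [a] makes every later step drop by at least the
    same amount, so [f] would eventually be negative. *)
Lemma concave_orbit_nonneg (f : R -> R) a : (forall s, 0 < f s) ->
  (forall s, f (s + a) + f (s - a) <= 2 * f s) -> f 0 <= f a.
Proof.
  intros pos con; destruct (Rle_lt_dec (f 0) (f a)) as [h | h]; auto; exfalso.
  set (d := f 0 - f a).
  assert (dec : forall n : nat, f (INR n * a + a) - f (INR n * a) <= - d).
  { induction n.
    - simpl; rewrite Rmult_0_l, Rplus_0_l; unfold d; lra.
    - rewrite S_INR; specialize (con ((INR n + 1) * a)).
      replace ((INR n + 1) * a - a) with (INR n * a) in con by ring.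
      replace ((INR n + 1) * a) with (INR n * a + a) in * by ring; lra. }
  assert (lin : forall n : nat, f (INR n * a) <= f 0 - INR n * d).
  { induction n; [simpl; rewrite Rmult_0_l; lra|].
    specialize (dec n); rewrite S_INR.
    replace ((INR n + 1) * a) with (INR n * a + a) by ring; lra. }
  destruct (nfloor_ex (f 0 / d)) as [n [_ hn]].
  { apply Rdiv_le_0_compat; [left; apply pos | unfold d; lra]. }
  specialize (lin (S n)); specialize (pos (INR (S n) * a)); rewrite S_INR in lin, pos.
  apply (Rmult_lt_compat_r d) in hn; [|unfold d; lra].
  unfold Rdiv in hn; rewrite Rmult_assoc, Rinv_l, Rmult_1_r in hn by (unfold d; lra); lra.
Qed.

(** The previous bound for [a] and for [- a] contradicts strict concavity at 0. *)
Lemma no_strictly_concave_orbit (f : R -> R) a : (forall s, 0 < f s) ->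
  (forall s, f (s + a) + f (s - a) < 2 * f s) -> False.
Proof.
  intros pos con.
  assert (h1 := concave_orbit_nonneg f a pos (fun s => Rlt_le _ _ (con s))).
  assert (h2 := concave_orbit_nonneg f (- a) pos).
  specialize (con 0) as c0; rewrite Rplus_0_l, Rminus_0_l in c0.
  enough (f 0 <= f (- a)) by lra.
  apply h2; intros s; specialize (con s); unfold Rminus in *; rewrite Ropp_involutive; lra.
Qed.

Lemma qderive_translate f a s : curve4 f -> qderive (fun s => f (s + a)) s = qderive f (s + a).
Proof.
  intros h; unfold qderive at 1.
  assert (hu : smooth (fun p => fst p + a)) by smooth_tac.
  assert (e := partial4_curve ax f (fun p => fst p + a) (s, 0) h hu); cbn [fst] in e.
  rewrite e.
  rewrite (is_partial_eq _ _ _ _ (is_partial_plus _ _ _ _ _ _ (is_partial_fst ax (s, 0)) (is_partial_const ax a (s, 0)))).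
  rewrite Rplus_0_r; apply qs1.
Qed.

Lemma qm_real c x : q1 c = 0 -> q2 c = 0 -> q3 c = 0 -> qm c x = qs (q0 c) x.
Proof.
  destruct c as [c0 c1 c2 c3]; cbn [q0 q1 q2 q3]; intros -> -> ->; qring.
Qed.

(* The monodromy [c] commutes with [I] because it preserves the oriented JK-plane
   containing both velocities; a nontrivial rotation of that plane cannot keep the
   velocity of [g1] in a half-plane. *)
Lemma asymptotic_monodromy g1 g2 psi1 psi2 a b : asymptotic_pair g1 g2 psi1 psi2 ->
  (forall s t, qm (qc (g1 (s + a))) (g2 (t + b)) = qm (qc (g1 s)) (g2 t)) ->
  exists chi, (chi = 1 \/ chi = -1) /\
    (forall s, g1 (s + a) = qs chi (g1 s)) /\ (forall t, g2 (t + b) = qs chi (g2 t)).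
Proof.
  intros [h1 h2 u1 u2 _ _ v1 v2 sg] per.
  (* The left side is free of [s] and the right side of [t], so both are one constant [c]. *)
  assert (eq : forall s t, qm (g2 (t + b)) (qc (g2 t)) = qm (g1 (s + a)) (qc (g1 s))).
  { intros s t; specialize (per s t).
    apply (f_equal (fun q => qm (g1 (s + a)) (qm q (qc (g2 t))))) in per.
    now rewrite S3_cancel_r, <- qmA, S3_cancel_l' in per by auto. }
  set (c := qm (g1 (0 + a)) (qc (g1 0))).
  assert (c2 : forall t, g2 (t + b) = qm c (g2 t)).
  { intros t; unfold c; rewrite <- (eq 0 t), S3_cancel_r'; auto. }
  assert (c1 : forall s, g1 (s + a) = qm c (g1 s)).
  { intros s; unfold c; rewrite <- (eq 0 0), (eq s 0), S3_cancel_r'; auto. }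
  assert (uc : S3 c) by (apply S3_qm; auto; now apply S3_qc).
  clearbody c.
  assert (w1 : forall s, velocity g1 (s + a) = qm (qm c (velocity g1 s)) (qc c)).
  { intros s; rewrite <- velocity_const_qm by auto; unfold velocity.
    rewrite <- (qderive_translate g1 a s h1), c1; do 2 f_equal.
    apply functional_extensionality; auto. }
  assert (w2 : forall s, velocity g2 (s + b) = qm (qm c (velocity g2 s)) (qc c)).
  { intros s; rewrite <- velocity_const_qm by auto; unfold velocity.
    rewrite <- (qderive_translate g2 b s h2), c2; do 2 f_equal.
    apply functional_extensionality; auto. }
  set (d := fun s t => - sin (psi1 s - psi2 t)).
  assert (pd : forall s t, 0 < d s t) by (intros s t; specialize (sg s t); unfold d; lra).
  assert (prod : forall s t, qim (qm (velocity g1 s) (velocity g2 t)) = qs (d s t) qI).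
  { intros s t; rewrite v1, v2; unfold d; rewrite sin_minus; unfold qI; quat_cbv; f_equal; ring. }
  assert (cI : qs (d 0 0) (qm (qm c qI) (qc c)) = qs (d (0 + a) (0 + b)) qI).
  { rewrite <- prod, w1, w2.
    transitivity (qm (qm c (qs (d 0 0) qI)) (qc c)); [qring|].
    rewrite <- prod.
    transitivity (qim (qm (qm c (qm (velocity g1 0) (velocity g2 0))) (qc c))).
    - generalize (qm (velocity g1 0) (velocity g2 0)) c; qring.
    - f_equal; rewrite !qmA; do 2 f_equal.
      rewrite <- (qmA _ (qc c) c), (proj2 (S3_inv c uc)), qm1r; reflexivity. }
  (* Conjugation by a unit quaternion preserves length, so the two positive coefficients are equal
     and [c] commutes with [I]. *)
  assert (nI : d 0 0 * d 0 0 = d (0 + a) (0 + b) * d (0 + a) (0 + b)).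
  { apply (f_equal (fun q => qdot q q)) in cI.
    rewrite !qdot_qs_l, !qdot_qs_r, qdot_qm_r, qdot_qm_l, qdot_qc, uc in cI.
    assert (I1 : qdot qI qI = 1) by (unfold qI; quat_cbv; ring); rewrite I1 in cI; lra. }
  assert (dd : d 0 0 = d (0 + a) (0 + b)).
  { assert (p1 := pd 0 0); assert (p2 := pd (0 + a) (0 + b)); nra. }
  assert (cI' : qm c qI = qm qI c).
  { rewrite <- (S3_cancel_r' (qm c qI) c uc); f_equal.
    rewrite <- dd in cI; apply (f_equal (qs (/ d 0 0))) in cI.
    assert (p1 := pd 0 0).
    assert (ss : forall q, qs (/ d 0 0) (qs (d 0 0) q) = q).
    { intros [x0 x1 x2 x3]; quat_cbv; f_equal; field; lra. }
    now rewrite !ss in cI. }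
  assert (z2 : q2 c = 0 /\ q3 c = 0).
  { assert (e2 := f_equal q2 cI'); assert (e3 := f_equal q3 cI'); unfold qI in *; cbn [qm qs qc qmap q0 q1 q2 q3] in e2, e3; lra. }
  destruct z2 as [z2 z3].
  assert (n01 : q0 c * q0 c + q1 c * q1 c = 1).
  { unfold S3, qdot in uc; rewrite z2, z3 in uc; lra. }
  assert (rot : forall s,
    cos (psi1 (s + a)) = (1 - 2 * (q1 c * q1 c)) * cos (psi1 s) - 2 * q0 c * q1 c * sin (psi1 s) /\
    sin (psi1 (s + a)) = (1 - 2 * (q1 c * q1 c)) * sin (psi1 s) + 2 * q0 c * q1 c * cos (psi1 s)).
  { intros s; specialize (w1 s); rewrite !v1 in w1.
    assert (e2 := f_equal q2 w1); assert (e3 := f_equal q3 w1); cbn [qm qs qc qmap q0 q1 q2 q3] in e2, e3.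
    rewrite z2, z3 in e2, e3; rewrite e2, e3.
    replace (1 - 2 * (q1 c * q1 c)) with (q0 c * q0 c - q1 c * q1 c) by lra; split; ring. }
  (* [P] is the cosine of the rotation angle. With [f s = d s 0], the rotation gives
     [f (s + a) + f (s - a) = 2 * P * f s], and [P < 1] as soon as [q1 c] is nonzero. *)
  assert (z1 : q1 c = 0).
  { apply NNPP; intros nz.
    assert (p1 : 0 < q1 c * q1 c) by nra.
    apply (no_strictly_concave_orbit (fun s => d s 0) a); [intros; apply pd|].
    intros s; assert (ps := pd s 0); unfold d in *; rewrite !sin_minus in *.
    destruct (rot s) as [r1 r2]; destruct (rot (s - a)) as [r3 r4].
    replace (s - a + a) with s in r3, r4 by ring.
    set (P := 1 - 2 * (q1 c * q1 c)) in *; set (Q := 2 * q0 c * q1 c) in *.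
    assert (PQ : P * P + Q * Q = 1).
    { unfold P, Q; replace ((1 - 2 * (q1 c * q1 c)) * (1 - 2 * (q1 c * q1 c)) + 2 * q0 c * q1 c * (2 * q0 c * q1 c))
        with (1 + 4 * (q1 c * q1 c) * (q0 c * q0 c + q1 c * q1 c - 1)) by ring; rewrite n01; ring. }
    assert (x : cos (psi1 (s - a)) = P * cos (psi1 s) + Q * sin (psi1 s)).
    { replace (cos (psi1 (s - a))) with ((P * P + Q * Q) * cos (psi1 (s - a))) by (rewrite PQ; ring).
      rewrite r3, r4; ring. }
    assert (y : sin (psi1 (s - a)) = P * sin (psi1 s) - Q * cos (psi1 s)).
    { replace (sin (psi1 (s - a))) with ((P * P + Q * Q) * sin (psi1 (s - a))) by (rewrite PQ; ring).
      rewrite r3, r4; ring. }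
    rewrite r1, r2, x, y.
    assert (P < 1) by (unfold P; lra).
    set (X := sin (psi1 s) * cos (psi2 0) - cos (psi1 s) * sin (psi2 0)) in *.
    replace (- ((P * sin (psi1 s) + Q * cos (psi1 s)) * cos (psi2 0) -
      (P * cos (psi1 s) - Q * sin (psi1 s)) * sin (psi2 0)) +
      - ((P * sin (psi1 s) - Q * cos (psi1 s)) * cos (psi2 0) -
      (P * cos (psi1 s) + Q * sin (psi1 s)) * sin (psi2 0))) with (2 * P * (- X))
      by (unfold X; ring).
    nra. }
  assert (c0 : q0 c = 1 \/ q0 c = -1).
  { rewrite z1 in n01; assert (e : (q0 c - 1) * (q0 c + 1) = 0) by lra.
    apply Rmult_integral in e; lra. }
  exists (q0 c); split; [exact c0 | split].
  - intros s; rewrite c1; now apply qm_real.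
  - intros t; rewrite c2; now apply qm_real.
Qed.

(** * Discreteness of the period groups *)

(** The scalar product of [f] with its velocity at 0 vanishes at 0 and has derivative 1 there. A
    return to a multiple of [f 0] makes it vanish again, which is impossible near 0. *)
Lemma isolated_return f : curve4 f -> (forall s, S3 (f s)) -> (forall s, S3 (velocity f s)) ->
  exists delta, 0 < delta /\ forall a chi, f a = qs chi (f 0) -> a = 0 \/ delta <= Rabs a.
Proof.
  intros h u v.
  set (w := qderive f 0).
  assert (dw : is_derive (fun s => qdot (f s) w) 0 1).
  { assert (sm : smooth (fun p => qdot (f (fst p)) w)) by (apply smooth_qdot; auto using smooth4_const).
    assert (d := smooth_is _ ax (0, 0) sm).
    rewrite (partial_qdot ax (fun p => f (fst p)) (fun _ => w)) in d by auto using smooth4_const.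
    rewrite partial4_const in d.
    replace 1 with (qdot (partial4 ax (fun p => f (fst p)) (0, 0)) w + qdot (f (fst (0, 0))) (Quat 0 0 0 0)).
    - exact d.
    - change (partial4 ax (fun p => f (fst p)) (0, 0)) with w.
      replace (qdot (f (fst (0, 0))) (Quat 0 0 0 0)) with 0 by (unfold qdot; cbn; ring).
      unfold w; rewrite qderive_velocity, qdot_qm_r, v, u by auto; ring. }
  assert (z0 : qdot (f 0) w = 0).
  { rewrite qdot_comm; exact (sphere_tangent ax (fun p => f (fst p)) (0, 0) h (fun p => u (fst p))). }
  apply is_derive_Reals in dw.
  destruct (dw (/ 2) ltac:(lra)) as [delta hd].
  exists delta; split; [apply cond_pos|].
  intros a chi e; destruct (Req_dec a 0) as [-> | nz]; auto; right.
  destruct (Rle_lt_dec delta (Rabs a)) as [l | l]; auto; exfalso.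
  specialize (hd a nz l); cbv beta in hd; rewrite Rplus_0_l, e, qdot_qs_l, z0 in hd.
  replace ((chi * 0 - 0) / a - 1) with (-1) in hd by (field; auto).
  rewrite Rabs_left in hd; lra.
Qed.

(** The generator is the least positive combination; Euclidean division by it leaves no
    remainder. *)
Lemma discrete_cyclic r1 r2 delta : 0 < delta -> (r1 <> 0 \/ r2 <> 0) ->
  (forall m n : Z, IZR m * r1 + IZR n * r2 = 0 \/ delta <= Rabs (IZR m * r1 + IZR n * r2)) ->
  exists r, 0 < r /\ cyclic_span r1 r2 r.
Proof.
  intros pd nz gap.
  set (A := fun x => exists m n : Z, x = IZR m * r1 + IZR n * r2).
  assert (Aneg : forall x, A x -> A (- x)).
  { intros x [m [n ->]]; exists (- m)%Z, (- n)%Z; rewrite !opp_IZR; ring. }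
  assert (Aadd : forall x y, A x -> A y -> A (x + y)).
  { intros x y [m [n ->]] [m' [n' ->]]; exists (m + m')%Z, (n + n')%Z; rewrite !plus_IZR; ring. }
  assert (Amul : forall (k : Z) x, A x -> A (IZR k * x)).
  { intros k x [m [n ->]]; exists (k * m)%Z, (k * n)%Z; rewrite !mult_IZR; ring. }
  assert (gap' : forall x, A x -> 0 < x -> delta <= x).
  { intros x [m [n ->]] px; destruct (gap m n) as [e | h]; [lra | now rewrite Rabs_right in h by lra]. }
  assert (exP : exists x, A x /\ 0 < x).
  { assert (A1 : A r1) by (exists 1%Z, 0%Z; ring).
    assert (A2 : A r2) by (exists 0%Z, 1%Z; ring).
    assert (pick : forall r, A r -> r <> 0 -> exists x, A x /\ 0 < x).
    { intros r Ar nr; destruct (Rtotal_order r 0) as [l | [e | g]]; [|lra|].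
      - exists (- r); split; [auto | lra].
      - exists r; auto. }
    destruct nz as [n | n]; [exact (pick _ A1 n) | exact (pick _ A2 n)]. }
  destruct exP as [x0 [Ax0 px0]].
  destruct (completeness (fun y => A (- y) /\ 0 < - y)) as [l [ub lub]].
  { exists 0; intros y [_ py]; lra. }
  { exists (- x0); rewrite Ropp_involutive; auto. }
  (* [- l] is the infimum of the positive elements. An element within [delta] of it is already the
     least one, for a smaller one would differ from it by less than [delta]. *)
  assert (exr : exists r, A r /\ 0 < r /\ r < - l + delta).
  { apply NNPP; intros no.
    assert (l <= l - delta); [|lra].
    apply lub; intros y [Ay py]; destruct (Rle_lt_dec y (l - delta)) as [h | h]; auto.
    exfalso; apply no; exists (- y); repeat split; auto; lra. }
  destruct exr as [r [Ar [pr hr]]].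
  assert (minr : forall x, A x -> 0 < x -> r <= x).
  { intros x Ax px; destruct (Rle_lt_dec r x) as [h | h]; auto; exfalso.
    assert (b : - x <= l) by (apply ub; rewrite Ropp_involutive; auto).
    assert (g := gap' (r - x) (Aadd _ _ Ar (Aneg _ Ax)) ltac:(lra)); lra. }
  exists r; split; auto.
  intros x; split.
  - intros Ax; exists (Int_part (x / r)).
    destruct (base_Int_part (x / r)) as [i1 i2].
    set (k := Int_part (x / r)) in *.
    assert (e : x / r * r = x) by (field; lra).
    assert (j1 : IZR k * r <= x) by (rewrite <- e; apply Rmult_le_compat_r; lra).
    assert (j2 : x < IZR k * r + r) by nra.
    destruct (Rle_lt_dec (x - IZR k * r) 0) as [h | h]; [lra | exfalso].
    assert (Ak : A (x - IZR k * r)) by (apply Aadd; [exact Ax | apply Aneg, Amul, Ar]).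
    specialize (minr _ Ak h); lra.
  - intros [k ->]; now apply Amul.
Qed.

Lemma qs_powerRZ f S chi : chi = 1 \/ chi = -1 ->
  (forall s, f (s + S) = qs chi (f s)) ->
  forall (k : Z) s, f (s + IZR k * S) = qs (powerRZ chi k) (f s).
Proof.
  intros hc hf.
  assert (nz : chi <> 0) by lra.
  assert (qss : forall x y q, qs x (qs y q) = qs (x * y) q) by qring.
  assert (nat_case : forall (n : nat) s, f (s + INR n * S) = qs (chi ^ n) (f s)).
  { induction n; intros s; [simpl; rewrite Rmult_0_l, Rplus_0_r, qs1; auto|].
    rewrite S_INR; replace (s + (INR n + 1) * S) with (s + INR n * S + S) by ring.
    rewrite hf, IHn, qss; reflexivity. }
  intros k s; destruct (Z.le_ge_cases 0 k) as [p | p].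
  - rewrite <- (Z2Nat.id k p), <- pow_powerRZ, <- INR_IZR_INZ; apply nat_case.
  - assert (e := nat_case (Z.to_nat (- k)) (s + IZR k * S)).
    rewrite INR_IZR_INZ, Z2Nat.id, opp_IZR in e by lia.
    replace (s + IZR k * S + - IZR k * S) with s in e by ring.
    rewrite e, qss, pow_powerRZ, Z2Nat.id, <- powerRZ_add by (lia || auto).
    rewrite Z.add_opp_diag_r; simpl; now rewrite qs1.
Qed.

Lemma powerRZ_opp1_eq k l : powerRZ (-1) k = powerRZ (-1) l -> (2 | k - l)%Z.
Proof.
  intros e.
  assert (h : powerRZ (-1) (k - l) = 1).
  { unfold Z.sub; rewrite powerRZ_add, e by lra; rewrite <- powerRZ_add by lra.
    rewrite Z.add_opp_diag_r; reflexivity. }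
  destruct (Z.Even_or_Odd (k - l)) as [[j hj] | [j hj]].
  - exists j; lia.
  - exfalso; rewrite hj, powerRZ_add, Z.mul_comm in h by lra.
    replace (j * 2)%Z with (j + j)%Z in h by lia.
    rewrite powerRZ_add, powerRZ_opp1_sqr in h by lra; simpl in h; lra.
Qed.

Lemma S3_qs_inj x y q : S3 q -> qs x q = qs y q -> x = y.
Proof.
  intros u e; apply (f_equal (fun r => qdot r q)) in e.
  rewrite !qdot_qs_l, u in e; lra.
Qed.

Lemma curve_cyclic f r1 r2 : curve4 f -> (forall s, S3 (f s)) -> (forall s, S3 (velocity f s)) ->
  (r1 <> 0 \/ r2 <> 0) ->
  (forall m n : Z, exists chi, forall s, f (s + (IZR m * r1 + IZR n * r2)) = qs chi (f s)) ->
  exists r, 0 < r /\ cyclic_span r1 r2 r.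
Proof.
  intros h u v nz per; destruct (isolated_return f h u v) as [delta [pd iso]].
  apply (discrete_cyclic r1 r2 delta pd nz).
  intros m n; destruct (per m n) as [chi e]; apply (iso _ chi).
  specialize (e 0); now rewrite Rplus_0_l in e.
Qed.


(** * From a flat torus to a conformal map *)

Lemma partial_translate i f p u : smooth f ->
  partial i (fun q => f (Ladd q u)) p = partial i f (Ladd p u).
Proof.
  intros hf.
  assert (e := is_partial_comp2 i f (fun q => fst q + fst u) (fun q => snd q + snd u) p _ _ (hf 1%nat)
    (is_partial_plus _ _ _ _ _ _ (is_partial_fst i p) (is_partial_const i (fst u) p))
    (is_partial_plus _ _ _ _ _ _ (is_partial_snd i p) (is_partial_const i (snd u) p))).
  apply is_partial_eq in e; unfold Ladd; rewrite e; destruct i; ring.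
Qed.

Lemma partial4_translate i F p u : smooth4 F -> (forall q, F (Ladd q u) = F q) ->
  partial4 i F (Ladd p u) = partial4 i F p.
Proof.
  intros (h0 & h1 & h2 & h3) per.
  assert (K : forall (c : quat R -> R), smooth (fun r => c (F r)) ->
    partial i (fun r => c (F r)) (Ladd p u) = partial i (fun r => c (F r)) p).
  { intros c hc; rewrite <- partial_translate by auto; f_equal.
    apply functional_extensionality; intros q; now rewrite per. }
  apply quat_ext; [apply (K q0) | apply (K q1) | apply (K q2) | apply (K q3)]; auto.
Qed.

Lemma unit_normal_translate F p u : smooth4 F -> (forall q, F (Ladd q u) = F q) ->
  unit_normal F (Ladd p u) = unit_normal F p.
Proof.
  intros hF per; unfold unit_normal, metric_det, induced_metric.
  now rewrite !(partial4_translate _ F), per.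
Qed.

(** The products determine [alpha] up to a sign at each point. The scalar product of [alpha] with
    its translate is, in absolute value, the squared norm of [alpha]; it never vanishes, so the sign
    is the same everywhere. *)
Lemma translate_sign alpha u : (forall i, smooth (alpha i)) ->
  (forall p : R * R, alpha ax p <> 0 \/ alpha ay p <> 0) ->
  (forall i j p, alpha i (Ladd p u) * alpha j (Ladd p u) = alpha i p * alpha j p) ->
  exists eps, (eps = 1 \/ eps = -1) /\ forall i p, alpha i (Ladd p u) = eps * alpha i p.
Proof.
  intros sm nz per.
  set (n := fun p => alpha ax p * alpha ax p + alpha ay p * alpha ay p).
  assert (pn : forall p, 0 < n p) by (intros p; unfold n; destruct (nz p); nra).
  set (f := fun p => alpha ax (Ladd p u) * alpha ax p + alpha ay (Ladd p u) * alpha ay p).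
  assert (st_ : forall i, smooth (fun p => alpha i (Ladd p u))).
  { intros i; apply (smooth_comp2 (alpha i) (fun p => fst p + fst u) (fun p => snd p + snd u));
      auto; smooth_tac. }
  assert (sf : smooth f) by (apply smooth_plus; apply smooth_mult; auto; apply sm).
  assert (ff : forall p, f p * f p = n p * n p).
  { intros p; assert (e1 := per ax ax p); assert (e2 := per ax ay p); assert (e3 := per ay ay p).
    unfold f, n.
    transitivity (alpha ax (Ladd p u) * alpha ax (Ladd p u) * (alpha ax p * alpha ax p)
      + 2 * (alpha ax (Ladd p u) * alpha ay (Ladd p u)) * (alpha ax p * alpha ay p)
      + alpha ay (Ladd p u) * alpha ay (Ladd p u) * (alpha ay p * alpha ay p)); [ring|].
    rewrite e1, e2, e3; ring. }
  assert (nn : forall p, alpha ax (Ladd p u) * alpha ax (Ladd p u) + alpha ay (Ladd p u) * alpha ay (Ladd p u) = n p)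
    by (intros p; now rewrite !per).
  assert (conc : forall eps, (eps = 1 \/ eps = -1) -> (forall p, f p = eps * n p) ->
    forall i p, alpha i (Ladd p u) = eps * alpha i p).
  { intros eps he hf i p; specialize (hf p); specialize (nn p).
    assert (z : (alpha ax (Ladd p u) - eps * alpha ax p) * (alpha ax (Ladd p u) - eps * alpha ax p)
      + (alpha ay (Ladd p u) - eps * alpha ay p) * (alpha ay (Ladd p u) - eps * alpha ay p) = 0).
    { transitivity (n p - 2 * eps * f p + eps * eps * n p).
      - rewrite <- nn at 1; unfold f, n; ring.
      - rewrite hf; destruct he as [-> | ->]; ring. }
    apply Rplus_sqr_eq_0 in z; destruct i; lra. }
  destruct (smooth_constant_sign f sf) as [h | h].
  - intros p e; specialize (ff p); specialize (pn p); rewrite e in ff; nra.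
  - exists 1; split; auto; apply conc; auto; intros p; specialize (ff p); specialize (pn p);
      specialize (h p); nra.
  - exists (-1); split; auto; apply conc; auto; intros p; specialize (ff p); specialize (pn p);
      specialize (h p); nra.
Qed.

(** The scalar products of the partials of the Gauss map equal [4 * (alpha i * alpha j)]; these are
    truly periodic, although [alpha] and [e] may both change sign. *)
Lemma factor_translate F N alpha e u : adapted F N ->
  (forall i, smooth (alpha i)) -> (forall p, S3 (e p)) ->
  (forall p : R * R, alpha ax p <> 0 \/ alpha ay p <> 0) ->
  (forall i p, partial4 i (gauss_map F N) p = qs (2 * alpha i p) (e p)) ->
  (forall p, gauss_map F N (Ladd p u) = gauss_map F N p) ->
  exists eps, (eps = 1 \/ eps = -1) /\ forall i p, alpha i (Ladd p u) = eps * alpha i p.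
Proof.
  intros ad sal e1 nz hal per; apply translate_sign; auto; intros i j p.
  assert (m : forall p, 4 * (alpha i p * alpha j p) =
    qdot (partial4 i (gauss_map F N) p) (partial4 j (gauss_map F N) p)).
  { intros q; rewrite !hal, qdot_qs_l, qdot_qs_r, e1; ring. }
  assert (m1 := m p); assert (m2 := m (Ladd p u)).
  rewrite !(partial4_translate _ (gauss_map F N)) in m2 by (auto; now apply smooth4_gauss_map); lra.
Qed.

Lemma primitive_translate f u eps : smooth f ->
  (forall i p, partial i f (Ladd p u) = eps * partial i f p) ->
  exists k, forall p, f (Ladd p u) = eps * f p + k.
Proof.
  intros hf per.
  assert (st_ : smooth (fun p => f (Ladd p u))).
  { apply (smooth_comp2 f (fun p => fst p + fst u) (fun p => snd p + snd u)); auto; smooth_tac. }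
  exists (f (Ladd (0, 0) u) - eps * f (0, 0)); intros p.
  assert (c : forall p q, f (Ladd p u) - eps * f p = f (Ladd q u) - eps * f q).
  { apply (partial_zero_const (fun p => f (Ladd p u) - eps * f p)); [smooth_tac|].
    intros i q; etransitivity; [apply is_partial_eq|].
    - eapply (is_partial_minus i (fun p => f (Ladd p u))); [apply smooth_is, st_ | partial_tac].
    - cbn beta; rewrite partial_translate, per by auto; ring. }
  specialize (c p (0, 0)); lra.
Qed.

(** Subtracting the linear function with values [cv] at [v] and [cw] at [w] leaves a function
    invariant under the lattice. *)
Lemma additive_translate f v w cv cw : lin_indep v w ->
  (forall p, f (Ladd p v) = f p + cv) -> (forall p, f (Ladd p w) = f p + cw) ->
  forall (m n : Z) p, f (Ladd p (Ladd (Lscal (IZR m) v) (Lscal (IZR n) w))) = f p + (IZR m * cv + IZR n * cw).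
Proof.
  intros li hv hw m n p; apply lin_indep_det in li.
  set (D := det2 v w) in *.
  set (l := fun q : R * R => (cv * det2 q w + cw * det2 v q) / D).
  assert (ladd : forall q r, l (Ladd q r) = l q + l r).
  { intros q r; unfold l, det2, Ladd; cbn; field; auto. }
  assert (lv : l v = cv) by (unfold l, D, det2 in *; field; auto).
  assert (lw : l w = cw) by (unfold l, D, det2 in *; field; auto).
  assert (e := lattice_invariant (fun q => f q - l q) v w).
  cbv beta in e; specialize (e ltac:(intros q; rewrite hv, ladd, lv; ring)
    ltac:(intros q; rewrite hw, ladd, lw; ring) p _ (ex_intro _ m (ex_intro _ n eq_refl))).
  rewrite !ladd in e.
  assert (ls : forall r q, l (Lscal r q) = r * l q).
  { intros r q; unfold l, det2, Lscal; cbn; field; auto. }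
  rewrite !ls, lv, lw in e; lra.
Qed.

Lemma bounded_axis (f : axis -> R * R -> R) :
  (forall i, exists M, forall p, Rabs (f i p) <= M) -> exists M, forall i p, Rabs (f i p) <= M.
Proof.
  intros h; destruct (h ax) as [a ha]; destruct (h ay) as [b hb].
  exists (Rmax a b); intros [] p; [eapply Rle_trans; [apply ha | apply Rmax_l]
                                  | eapply Rle_trans; [apply hb | apply Rmax_r]].
Qed.

(** A sign acquired by the first derivatives is inherited by the second ones; their absolute values
    are then doubly periodic, which yields the bounds assumed in the inversion theorem. *)
Lemma sign_periodic_bounded v w f : lin_indep v w -> smooth f ->
  (exists eps, (eps = 1 \/ eps = -1) /\ forall i p, partial i f (Ladd p v) = eps * partial i f p) ->
  (exists eps, (eps = 1 \/ eps = -1) /\ forall i p, partial i f (Ladd p w) = eps * partial i f p) ->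
  exists K, (forall i p, Rabs (partial i f p) <= K) /\
    (forall i j p, Rabs (partial i (partial j f) p) <= K).
Proof.
  intros li hf [e1 [he1 h1]] [e2 [he2 h2]].
  assert (ab : forall e x, e = 1 \/ e = -1 -> Rabs (e * x) = Rabs x).
  { intros e x [-> | ->]; rewrite Rabs_mult; [rewrite Rabs_R1 | rewrite Rabs_left by lra]; ring. }
  destruct (bounded_axis (fun i => partial i f)) as [M1 hM1].
  { intros i; apply (periodic_bounded _ v w); auto; [now apply smooth_partial | |];
      intros p; [rewrite h1 | rewrite h2]; auto. }
  assert (d : forall e u, (forall i p, partial i f (Ladd p u) = e * partial i f p) ->
    forall i j p, partial i (partial j f) (Ladd p u) = e * partial i (partial j f) p).
  { intros e u he i j p; rewrite <- partial_translate by now apply smooth_partial.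
    assert (E : (fun q => partial j f (Ladd q u)) = (fun q => e * partial j f q))
      by (apply functional_extensionality; auto).
    refine (eq_trans (f_equal (fun h => partial i h p) E) _).
    etransitivity; [apply is_partial_eq, (is_partial_mult i (fun _ => e) (partial j f));
      [apply is_partial_const | now apply smooth_is, smooth_partial] | cbn beta; ring]. }
  assert (h3 : forall j, exists M, forall i p, Rabs (partial i (partial j f) p) <= M).
  { intros j; apply bounded_axis; intros i; apply (periodic_bounded _ v w); auto;
      [now repeat apply smooth_partial | |];
      intros p; [rewrite (d _ _ h1) | rewrite (d _ _ h2)]; auto. }
  destruct (h3 ax) as [M2 hM2]; destruct (h3 ay) as [M3 hM3].
  exists (Rmax M1 (Rmax M2 M3)); split.
  - intros i p; eapply Rle_trans; [apply hM1 | apply Rmax_l].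
  - intros i j p; eapply Rle_trans; [|apply Rmax_r]; destruct j.
    + eapply Rle_trans; [apply hM2 | apply Rmax_l].
    + eapply Rle_trans; [apply hM3 | apply Rmax_r].
Qed.

(* Both forms keep their sign under the translation: since it preserves
   orientation the signs agree, and were both negative the translation would act in
   the coordinates [(U, V)] as a point reflection, which has a fixed point. *)
Lemma translation_signs U V Phi1 Phi2 u eps eps' :
  smooth U -> smooth V -> u <> (0, 0) ->
  (forall p, partial ax U p * partial ay V p - partial ay U p * partial ax V p <> 0) ->
  (forall p, (Phi1 (U p, V p), Phi2 (U p, V p)) = p) ->
  (forall z, (U (Phi1 z, Phi2 z), V (Phi1 z, Phi2 z)) = z) ->
  eps = 1 \/ eps = -1 -> eps' = 1 \/ eps' = -1 ->
  (forall i p, partial i U (Ladd p u) = eps * partial i U p) ->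
  (forall i p, partial i V (Ladd p u) = eps' * partial i V p) ->
  exists a b, forall p, U (Ladd p u) = U p + a /\ V (Ladd p u) = V p + b.
Proof.
  intros hU hV nu nJ hl hr he he' perU perV.
  destruct (primitive_translate U u eps hU perU) as [a ha].
  destruct (primitive_translate V u eps' hV perV) as [b hb].
  assert (sg : eps * eps' = 1).
  { set (J := fun p => partial ax U p * partial ay V p - partial ay U p * partial ax V p) in *.
    assert (sJ : smooth J) by (unfold J; smooth_tac).
    assert (eJ : J (Ladd (0, 0) u) = eps * eps' * J (0, 0)) by (unfold J; rewrite !perU, !perV; ring).
    assert (pos : 0 < J (Ladd (0, 0) u) * J (0, 0)).
    { destruct (smooth_constant_sign J sJ nJ) as [h | h];
        assert (h1 := h (0, 0)); assert (h2 := h (Ladd (0, 0) u)); nra. }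
    rewrite eJ in pos; destruct he as [-> | ->], he' as [-> | ->]; nra. }
  destruct he as [-> | ->].
  - exists a, b; intros p; rewrite ha, hb.
    replace eps' with 1 by lra; split; ring.
  - exfalso; apply nu; replace eps' with (-1) in * by lra.
    (* The point where [U = a / 2] and [V = b / 2], fixed by the reflection taking [(U, V)] to
       [(a - U, b - V)]. *)
    set (p := (Phi1 (a / 2, b / 2), Phi2 (a / 2, b / 2))).
    assert (e := hr (a / 2, b / 2)); fold p in e; clearbody p.
    assert (eU := f_equal fst e); assert (eV := f_equal snd e); cbn [fst snd] in eU, eV.
    assert (fix_ : Ladd p u = p).
    { assert (eu : U (Ladd p u) = U p) by (rewrite ha; lra).
      assert (ev : V (Ladd p u) = V p) by (rewrite hb; lra).
      rewrite <- (hl (Ladd p u)), eu, ev; apply hl. }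
    destruct p as [x y], u as [u1 u2]; unfold Ladd in fix_; cbn in fix_; injection fix_; intros.
    f_equal; lra.
Qed.

Lemma lin_indep_nonzero v w : lin_indep v w -> v <> (0, 0) /\ w <> (0, 0).
Proof.
  intros h; apply lin_indep_det in h; split; intros ->; apply h; unfold det2; cbn; ring.
Qed.

(** * The asymptotic chart of a flat torus *)

Record asymptotic_chart (v w : R * R) (F : R * R -> quat R) (U V Phi1 Phi2 : R * R -> R)
    (s1 t1 s2 t2 : R) : Prop := {
  ac_U : smooth U;
  ac_V : smooth V;
  ac_Phi1 : smooth Phi1;
  ac_Phi2 : smooth Phi2;
  ac_left : forall p, (Phi1 (U p, V p), Phi2 (U p, V p)) = p;
  ac_right : forall z, (U (Phi1 z, Phi2 z), V (Phi1 z, Phi2 z)) = z;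
  ac_Uv : forall p, U (Ladd p v) = U p + s1;
  ac_Vv : forall p, V (Ladd p v) = V p + t1;
  ac_Uw : forall p, U (Ladd p w) = U p + s2;
  ac_Vw : forall p, V (Ladd p w) = V p + t2
}.

Lemma asymptotic_coordinates v w F : flat_torus_in_S3 v w F ->
  exists U V Phi1 Phi2 s1 t1 s2 t2 e e', asymptotic_chart v w F U V Phi1 Phi2 s1 t1 s2 t2 /\
    (forall p, S3 (e p)) /\ (forall p, S3 (e' p)) /\
    (forall i p, partial4 i (gauss_map F (unit_normal F)) p = qs (2 * partial i U p) (e p)) /\
    (forall i p, partial4 i (gauss_map (fun p => qc (F p)) (fun p => qc (unit_normal F p))) p
       = qs (2 * partial i V p) (e' p)).
Proof.
  intros [li sF F1 per im fl].
  set (N := unit_normal F).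
  assert (ad : adapted F N) by now apply flat_adapted.
  assert (ad' := adapted_conj F N ad).
  destruct (gauss_map_factor F N ad) as (al & e & sal & se & e1 & hal & cal).
  destruct (gauss_map_factor _ _ ad') as (be & e' & sbe & se' & e1' & hbe & cbe).
  assert (nJ := gauss_maps_independent F N al be e e' ad hal hbe).
  destruct (poincare (al ax) (al ay) (sal ax) (sal ay) cal) as (U & sU & Ux & Uy).
  destruct (poincare (be ax) (be ay) (sbe ax) (sbe ay) cbe) as (V & sV & Vx & Vy).
  assert (Ui : forall i p, partial i U p = al i p) by (intros []; auto).
  assert (Vi : forall i p, partial i V p = be i p) by (intros []; auto).
  assert (Fv : forall p, F (Ladd p v) = F p).
  { intros p; apply per; exists 1%Z, 0%Z; destruct v, w; unfold Ladd, Lscal; cbn; f_equal; ring. }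
  assert (Fw : forall p, F (Ladd p w) = F p).
  { intros p; apply per; exists 0%Z, 1%Z; destruct v, w; unfold Ladd, Lscal; cbn; f_equal; ring. }
  assert (nal : forall p, al ax p <> 0 \/ al ay p <> 0).
  { intros p; destruct (Req_dec (al ax p) 0) as [z | z]; auto; right; intros z'.
    apply (nJ p); rewrite z, z'; ring. }
  assert (nbe : forall p, be ax p <> 0 \/ be ay p <> 0).
  { intros p; destruct (Req_dec (be ax p) 0) as [z | z]; auto; right; intros z'.
    apply (nJ p); rewrite z, z'; ring. }
  assert (sgU : forall u, (forall p, F (Ladd p u) = F p) ->
    exists eps, (eps = 1 \/ eps = -1) /\ forall i p, partial i U (Ladd p u) = eps * partial i U p).
  { intros u hu; destruct (factor_translate F N al e u) as [eps [he h]]; auto.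
    - intros q; unfold gauss_map, N; now rewrite unit_normal_translate, hu.
    - exists eps; split; auto; intros i p; now rewrite !Ui. }
  assert (sgV : forall u, (forall p, F (Ladd p u) = F p) ->
    exists eps, (eps = 1 \/ eps = -1) /\ forall i p, partial i V (Ladd p u) = eps * partial i V p).
  { intros u hu; destruct (factor_translate _ _ be e' u ad') as [eps [he h]]; auto.
    - intros q; rewrite !gauss_map_conj; unfold N; now rewrite unit_normal_translate, hu.
    - exists eps; split; auto; intros i p; now rewrite !Vi. }
  destruct (sign_periodic_bounded v w U li sU (sgU v Fv) (sgU w Fw)) as (K1 & b1 & b2).
  destruct (sign_periodic_bounded v w V li sV (sgV v Fv) (sgV w Fw)) as (K2 & b3 & b4).
  set (J := fun p => partial ax U p * partial ay V p - partial ay U p * partial ax V p).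
  assert (nJ' : forall p, J p <> 0) by (intros p; unfold J; rewrite !Ui, !Vi; apply nJ).
  assert (sJ : smooth J) by (unfold J; smooth_tac).
  destruct (sgU v Fv) as (ev & hev & pUv); destruct (sgU w Fw) as (ew & hew & pUw).
  destruct (sgV v Fv) as (ev' & hev' & pVv); destruct (sgV w Fw) as (ew' & hew' & pVw).
  assert (aJ : forall u a b, a = 1 \/ a = -1 -> b = 1 \/ b = -1 ->
    (forall i p, partial i U (Ladd p u) = a * partial i U p) ->
    (forall i p, partial i V (Ladd p u) = b * partial i V p) ->
    forall p, Rabs (/ J (Ladd p u)) = Rabs (/ J p)).
  { intros u a b ha hb pa pb p; rewrite !Rabs_inv; f_equal.
    replace (J (Ladd p u)) with (a * b * J p) by (unfold J; rewrite !pa, !pb; ring).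
    rewrite !Rabs_mult; destruct ha as [-> | ->], hb as [-> | ->];
      rewrite ?Rabs_R1, ?(Rabs_left (-1)) by lra; ring. }
  (* The lower bound on the Jacobian is obtained as an upper bound on its inverse, which is doubly
     periodic in absolute value. *)
  destruct (periodic_bounded (fun p => / J p) v w) as [M hM]; auto.
  { now apply smooth_inv. }
  { now apply (aJ v ev ev'). }
  { now apply (aJ w ew ew'). }
  assert (pM : 0 < M).
  { eapply Rlt_le_trans; [|apply (hM (0, 0))]; apply Rabs_pos_lt, Rinv_neq_0_compat, nJ'. }
  assert (lowJ : forall p, / M <= Rabs (J p)).
  { intros p; specialize (hM p); rewrite Rabs_inv in hM.
    assert (pJ : 0 < Rabs (J p)) by (apply Rabs_pos_lt, nJ').
    rewrite <- (Rinv_inv (Rabs (J p))); apply Rinv_le_contravar; auto.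
    now apply Rinv_0_lt_compat. }
  destruct (hadamard U V (Rmax K1 K2) (/ M)) as (Phi1 & Phi2 & sP1 & sP2 & hl & hr);
    try assumption.
  { now apply Rinv_0_lt_compat. }
  { intros; eapply Rle_trans; [apply b1 | apply Rmax_l]. }
  { intros; eapply Rle_trans; [apply b3 | apply Rmax_r]. }
  { intros; eapply Rle_trans; [apply b2 | apply Rmax_l]. }
  { intros; eapply Rle_trans; [apply b4 | apply Rmax_r]. }
  destruct (lin_indep_nonzero v w li) as [nv nw].
  destruct (translation_signs U V Phi1 Phi2 v ev ev') as (s1 & t1 & h1); auto.
  destruct (translation_signs U V Phi1 Phi2 w ew ew') as (s2 & t2 & h2); auto.
  exists U, V, Phi1, Phi2, s1, t1, s2, t2, e, e'.
  split; [|split; [auto | split; [auto | split]]].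
  - split; auto; intros p; apply h1 || apply h2.
  - intros i p; rewrite Ui; apply hal.
  - intros i p; rewrite Vi; apply hbe.
Qed.

(** Were the two period vectors dependent, a nonzero covector [(c, d)] would annihilate both. Then
    [c U + d V] would be doubly periodic, hence bounded, although [(U, V)] is onto. *)
Lemma asymptotic_lattice v w F U V Phi1 Phi2 s1 t1 s2 t2 : lin_indep v w ->
  asymptotic_chart v w F U V Phi1 Phi2 s1 t1 s2 t2 -> s1 * t2 - t1 * s2 <> 0.
Proof.
  intros li [sU sV _ _ _ hr Uv Vv Uw Vw] z.
  assert (ex : exists c d, 0 < c * c + d * d /\ c * s1 + d * t1 = 0 /\ c * s2 + d * t2 = 0).
  { destruct (Req_dec s1 0) as [a | a]; [destruct (Req_dec t1 0) as [b | b]|].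
    - destruct (Req_dec s2 0) as [a' | a']; [destruct (Req_dec t2 0) as [b' | b']|].
      + exists 1, 0; rewrite a, b, a', b'; lra.
      + exists t2, (- s2); rewrite a, b; nra.
      + exists t2, (- s2); rewrite a, b; nra.
    - exists t1, (- s1); nra.
    - exists t1, (- s1); nra. }
  destruct ex as (c & d & pos & h1 & h2).
  destruct (periodic_bounded (fun p => c * U p + d * V p) v w) as [M hM]; auto.
  { smooth_tac. }
  { intros p; rewrite Uv, Vv; f_equal; lra. }
  { intros p; rewrite Uw, Vw; f_equal; lra. }
  (* At the point with coordinates [(r c, r d)] the combination takes the value [Rabs M + 1], beyond
     its bound. *)
  set (r := (Rabs M + 1) / (c * c + d * d)).
  specialize (hr (r * c, r * d)).
  specialize (hM (Phi1 (r * c, r * d), Phi2 (r * c, r * d))).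
  injection hr; intros eV eU; rewrite eU, eV in hM.
  replace (c * (r * c) + d * (r * d)) with (Rabs M + 1) in hM by (unfold r; field; lra).
  pose proof (Rabs_pos M); pose proof (RRle_abs M); rewrite Rabs_right in hM; lra.
Qed.

Lemma theta2_range th : sin (2 * th) < 0 -> exists k : Z, PI / 2 < th - IZR k * PI < PI.
Proof.
  intros h; exists (Int_part (th / PI)).
  destruct (base_Int_part (th / PI)) as [i1 i2].
  set (k := Int_part (th / PI)) in *.
  assert (pp := PI_RGT_0).
  assert (e : th / PI * PI = th) by (field; lra).
  assert (j1 : IZR k * PI <= th) by (rewrite <- e; apply Rmult_le_compat_r; lra).
  assert (j2 : th < IZR k * PI + PI) by nra.
  split; [|lra].
  destruct (Rlt_le_dec (PI / 2) (th - IZR k * PI)) as [l | l]; auto; exfalso.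
  assert (s : sin (2 * th) = sin (2 * (th - IZR k * PI))).
  { replace (2 * th) with (2 * (th - IZR k * PI) + IZR k * (2 * PI)) by ring.
    apply (Z_invariant sin (2 * PI)); intros x; rewrite sin_plus, sin_2PI, cos_2PI; ring. }
  assert (0 <= sin (2 * (th - IZR k * PI))) by (apply sin_ge_0; lra); lra.
Qed.

Lemma quat_curve_derive (c : quat R -> R) f s :
  (forall F p, smooth4 F -> smooth (fun r => c (F r)) /\
     partial ax (fun r => c (F r)) p = c (partial4 ax F p)) ->
  curve4 f -> is_derive (fun s => c (f s)) s (c (qderive f s)).
Proof.
  intros hc h; destruct (hc (fun p => f (fst p)) (s, 0) h) as [sm e].
  exact (eq_ind _ (fun l => is_derive (fun s => c (f s)) s l) (smooth_is _ ax (s, 0) sm) _ e).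
Qed.

Lemma curves_conformal g1 g2 : curve4 g1 -> curve4 g2 ->
  let g := fun a : lorentz => Hst (g1 (lp a)) (g2 (lm a)) in
  Hconformal g /\ forall a, Hderive g a = Hst (qderive g1 (lp a)) (qderive g2 (lm a)).
Proof.
  intros h1 h2 g.
  assert (K : forall c : quat R -> R,
    (forall F p, smooth4 F -> smooth (fun r => c (F r)) /\
       partial ax (fun r => c (F r)) p = c (partial4 ax F p)) ->
    conformal (fun a => st (c (g1 (lp a))) (c (g2 (lm a)))) /\
    forall a, Lderive (fun a => st (c (g1 (lp a))) (c (g2 (lm a)))) a
      = st (c (qderive g1 (lp a))) (c (qderive g2 (lm a)))).
  { intros c hc.
    apply (null_conformal (fun s => c (g1 s)) (fun s => c (g2 s))
      (fun s => c (qderive g1 s)) (fun s => c (qderive g2 s))).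
    - exact (proj1 (hc (fun p => g1 (fst p)) (0, 0) h1)).
    - exact (proj1 (hc (fun p => g2 (fst p)) (0, 0) h2)).
    - intros; now apply quat_curve_derive.
    - intros; now apply quat_curve_derive. }
  destruct (K q0) as [c0 d0]; [intros F p (h & _); split; [exact h | reflexivity]|].
  destruct (K q1) as [c1 d1]; [intros F p (_ & h & _); split; [exact h | reflexivity]|].
  destruct (K q2) as [c2 d2]; [intros F p (_ & _ & h & _); split; [exact h | reflexivity]|].
  destruct (K q3) as [c3 d3]; [intros F p (_ & _ & _ & h); split; [exact h | reflexivity]|].
  split; [exact (conj c0 (conj c1 (conj c2 c3)))|].
  intros a; apply HL_ext; [apply d0 | apply d1 | apply d2 | apply d3].
Qed.

Lemma flat_torus_split v w F U V Phi1 Phi2 s1 t1 s2 t2 e e' : flat_torus_in_S3 v w F ->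
  asymptotic_chart v w F U V Phi1 Phi2 s1 t1 s2 t2 ->
  (forall p, S3 (e p)) -> (forall p, S3 (e' p)) ->
  (forall i p, partial4 i (gauss_map F (unit_normal F)) p = qs (2 * partial i U p) (e p)) ->
  (forall i p, partial4 i (gauss_map (fun p => qc (F p)) (fun p => qc (unit_normal F p))) p
     = qs (2 * partial i V p) (e' p)) ->
  exists g1 g2 psi1 psi2, asymptotic_pair g1 g2 psi1 psi2 /\
    forall p, F p = qm (qc (g1 (U p))) (g2 (V p)).
Proof.
  intros [li sF F1 per im fl] [sU sV sP1 sP2 hl hr _ _ _ _] e1 e1' hnu hmu.
  set (N := unit_normal F) in *.
  assert (ad : adapted F N) by now apply flat_adapted.
  assert (ad' := adapted_conj F N ad).
  assert (cmp : forall A, smooth4 A -> smooth4 (fun z => A (Phi1 z, Phi2 z)))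
    by (intros; now apply smooth4_comp).
  set (G := fun z => F (Phi1 z, Phi2 z)); set (M := fun z => N (Phi1 z, Phi2 z)).
  assert (dU : forall i z, partial i (fun z => U (Phi1 z, Phi2 z)) z =
    partial ax U (Phi1 z, Phi2 z) * partial i Phi1 z + partial ay U (Phi1 z, Phi2 z) * partial i Phi2 z)
    by (intros; apply is_partial_eq, is_partial_comp2; [apply sU | now apply smooth_is ..]).
  assert (dV : forall i z, partial i (fun z => V (Phi1 z, Phi2 z)) z =
    partial ax V (Phi1 z, Phi2 z) * partial i Phi1 z + partial ay V (Phi1 z, Phi2 z) * partial i Phi2 z)
    by (intros; apply is_partial_eq, is_partial_comp2; [apply sV | now apply smooth_is ..]).
  (* In the chart [U] and [V] are the coordinate functions, so each Gauss map of [G] has one zero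
     partial and one of squared length 4. *)
  replace (fun z => U (Phi1 z, Phi2 z)) with (fst : R * R -> R) in dU
    by (apply functional_extensionality; intros z; symmetry; exact (f_equal fst (hr z))).
  replace (fun z => V (Phi1 z, Phi2 z)) with (snd : R * R -> R) in dV
    by (apply functional_extensionality; intros z; symmetry; exact (f_equal snd (hr z))).
  assert (comb : forall (a b r s : R) (q : quat R),
    qadd (qs a (qs (2 * r) q)) (qs b (qs (2 * s) q)) = qs (2 * (r * a + s * b)) q) by qring.
  assert (q00 : forall q, qs (2 * 0) q = Quat 0 0 0 0) by qring.
  assert (nu' : forall i z, partial4 i (gauss_map G M) z = qs (2 * partial i fst z) (e (Phi1 z, Phi2 z))).
  { intros i z; rewrite dU, <- comb, <- !hnu.
    apply (partial4_comp i (gauss_map F N)); auto; now apply smooth4_gauss_map. }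
  assert (mu' : forall i z, partial4 i (gauss_map (fun z => qc (G z)) (fun z => qc (M z))) z
      = qs (2 * partial i snd z) (e' (Phi1 z, Phi2 z))).
  { intros i z; rewrite dV, <- comb, <- !hmu.
    apply (partial4_comp i (gauss_map (fun p => qc (F p)) (fun p => qc (N p)))); auto;
      now apply smooth4_gauss_map. }
  assert (p1 := fun i z => is_partial_eq i fst z _ (is_partial_fst i z)).
  assert (p2 := fun i z => is_partial_eq i snd z _ (is_partial_snd i z)).
  destruct (asymptotic_split G M) as (g1 & g2 & psi1 & psi2 & pair & dec).
  - now apply cmp.
  - apply cmp, ad.
  - intros z; apply F1.
  - intros z; apply ad.
  - intros z; apply ad.
  - intros i z; unfold G, M; rewrite partial4_comp, qdot_comm, qdot_qadd_l, !qdot_qs_l by auto.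
    rewrite !(qdot_comm _ (N _)), !(ad_tan _ _ ad); ring.
  - intros z hz.
    set (p := (Phi1 z, Phi2 z)).
    assert (zp : (U p, V p) = z) by apply hr.
    assert (Fi : forall i, partial4 i F p =
      qadd (qs (partial i U p) (partial4 ax G z)) (qs (partial i V p) (partial4 ay G z))).
    { intros i; rewrite <- zp, <- partial4_comp; auto; [|now apply cmp].
      f_equal; apply functional_extensionality; intros q; unfold G; now rewrite hl. }
    assert (pd := ad_det _ _ ad p).
    enough (metric_det (induced_metric F) p = 0) by lra.
    (* Change of variables: the metric determinant of [F] is the squared Jacobian of [(U, V)] times
       that of [G]. *)
    transitivity ((partial ax U p * partial ay V p - partial ay U p * partial ax V p)
      * (partial ax U p * partial ay V p - partial ay U p * partial ax V p)
      * metric_det (induced_metric G) z); [|rewrite hz; ring].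
    unfold metric_det, induced_metric; rewrite !Fi; qdot_expand.
    rewrite !(qdot_comm (partial4 ay G z) (partial4 ax G z)); ring.
  - intros z; rewrite nu', p1; apply q00.
  - intros z; rewrite nu', p1, qdot_qs_l, qdot_qs_r, e1; ring.
  - intros z; rewrite mu', p2; apply q00.
  - intros z; rewrite mu', p2, qdot_qs_l, qdot_qs_r, e1'; ring.
  - exists g1, g2, psi1, psi2; split; [exact pair|].
    intros p; refine (eq_trans _ (dec (U p, V p))); unfold G; now rewrite hl.
Qed.

Lemma flat_torus_data v w F : flat_torus_in_S3 v w F ->
  exists (s1 t1 s2 t2 S T : R) (g : lorentz -> HL) (psi : lorentz -> lorentz)
    (g1 g2 : R -> quat R) (phi : R * R -> lorentz),
    torus_data s1 t1 s2 t2 S T g psi g1 g2 /\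
    torus_diffeo v w (st s1 t1) (st s2 t2) phi /\
    forall p, R4_HL (F p) = torus_formula g (phi p).
Proof.
  intros ft.
  destruct (asymptotic_coordinates v w F ft)
    as (U & V & Phi1 & Phi2 & s1 & t1 & s2 & t2 & e & e' & ac & ue & ue' & hnu & hmu).
  destruct (flat_torus_split v w F U V Phi1 Phi2 s1 t1 s2 t2 e e' ft ac ue ue' hnu hmu)
    as (g1 & g2 & psi1 & psi2 & pair & dec).
  assert (pair' := pair); destruct pair' as [c1 c2 u1 u2 sp1 sp2 v1 v2 sg].
  assert (li := ft_basis _ _ _ ft).
  assert (nD := asymptotic_lattice _ _ _ _ _ _ _ _ _ _ _ li ac).
  destruct ac as [sU sV sP1 sP2 hl hr Uv Vv Uw Vw].
  assert (LU := additive_translate U v w s1 s2 li Uv Uw).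
  assert (LV := additive_translate V v w t1 t2 li Vv Vw).
  (* Every pair [(s, t)] is the image of a point, and a lattice vector shifts [(U, V)] by a
     constant; periodicity of [F] thus becomes an invariance of the product of the two curves. *)
  assert (mono : forall m n : Z, exists chi, (chi = 1 \/ chi = -1) /\
    (forall s, g1 (s + (IZR m * s1 + IZR n * s2)) = qs chi (g1 s)) /\
    (forall t, g2 (t + (IZR m * t1 + IZR n * t2)) = qs chi (g2 t))).
  { intros m n; apply (asymptotic_monodromy g1 g2 psi1 psi2); auto.
    intros s t; set (p := (Phi1 (s, t), Phi2 (s, t))).
    assert (ep : (U p, V p) = (s, t)) by apply hr; injection ep; intros eV eU.
    rewrite <- eU, <- eV, <- LU, <- LV, <- !dec; apply (ft_periodic _ _ _ ft).
    now exists m, n. }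
  assert (unit_angle : forall x, S3 (Quat 0 0 (cos x) (sin x))).
  { intros x; unfold S3; quat_cbv; assert (t := sin2_cos2 x); unfold Rsqr in t; lra. }
  destruct (curve_cyclic g1 s1 s2) as (S & pS & hS); auto.
  { intros s; rewrite v1; auto. }
  { destruct (Req_dec s1 0) as [z | z]; auto; right; intros z'; apply nD; rewrite z, z'; ring. }
  { intros m n; destruct (mono m n) as (chi & _ & h & _); now exists chi. }
  destruct (curve_cyclic g2 t1 t2) as (T & pT & hT); auto.
  { intros s; rewrite v2; auto. }
  { destruct (Req_dec t1 0) as [z | z]; auto; right; intros z'; apply nD; rewrite z, z'; ring. }
  { intros m n; destruct (mono m n) as (chi & _ & _ & h); now exists chi. }
  assert (lat : forall m n : Z, exists k l chi, (chi = 1 \/ chi = -1) /\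
    IZR m * s1 + IZR n * s2 = IZR k * S /\ IZR m * t1 + IZR n * t2 = IZR l * T /\
    (forall s, g1 (s + IZR k * S) = qs chi (g1 s)) /\ (forall t, g2 (t + IZR l * T) = qs chi (g2 t))).
  { intros m n; destruct (mono m n) as (chi & hc & h1 & h2).
    destruct (proj1 (hS (IZR m * s1 + IZR n * s2))) as [k ek]; [now exists m, n|].
    destruct (proj1 (hT (IZR m * t1 + IZR n * t2))) as [l el]; [now exists m, n|].
    exists k, l, chi; rewrite <- ek, <- el; auto. }
  assert (one_mul : forall x, x = IZR 1 * x) by (intros; ring).
  (* [S] and [T] are themselves components of lattice vectors, generally different ones, so each
     curve acquires a sign over its own generator. *)
  destruct (proj2 (hS S)) as (m1 & n1 & eS); [exists 1%Z; apply one_mul|].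
  destruct (proj2 (hT T)) as (m2 & n2 & eT); [exists 1%Z; apply one_mul|].
  destruct (mono m1 n1) as (chi1 & hc1 & per1 & _); rewrite <- eS in per1.
  destruct (mono m2 n2) as (chi2 & hc2 & _ & per2); rewrite <- eT in per2.
  assert (pw1 := qs_powerRZ g1 S chi1 hc1 per1); assert (pw2 := qs_powerRZ g2 T chi2 hc2 per2).
  assert (par : forall m n : Z, exists k l, IZR m * s1 + IZR n * s2 = IZR k * S /\
    IZR m * t1 + IZR n * t2 = IZR l * T /\ powerRZ chi1 k = powerRZ chi2 l).
  { intros m n; destruct (lat m n) as (k & l & chi & _ & ek & el & h1 & h2).
    exists k, l; split; [auto | split; [auto|]].
    transitivity chi; [apply (S3_qs_inj _ _ (g1 0)) | symmetry; apply (S3_qs_inj _ _ (g2 0))]; auto.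
    - now rewrite <- pw1, h1.
    - now rewrite <- pw2, h2. }
  (* [par] at these two lattice vectors gives [chi1 = chi2 ^ l] and [chi1 ^ k' = chi2]; hence if one
     sign is 1, so is the other. *)
  assert (chis : chi1 = chi2).
  { destruct (par m1 n1) as (k & l & ek & _ & e1); destruct (par m2 n2) as (k' & l' & _ & el' & e2).
    assert (k = 1%Z) as ->.
    { apply eq_IZR, (Rmult_eq_reg_r S); lra. }
    assert (l' = 1%Z) as ->.
    { apply eq_IZR, (Rmult_eq_reg_r T); lra. }
    rewrite powerRZ_1 in e1, e2.
    destruct hc1 as [-> | ->], hc2 as [-> | ->]; auto.
    - now rewrite powerRZ_R1 in e2.
    - rewrite powerRZ_R1 in e1; auto. }
  subst chi2.
  set (g := fun a : lorentz => Hst (g1 (lp a)) (g2 (lm a))).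
  set (psi := fun a : lorentz => st (psi1 (lp a)) (psi2 (lm a))).
  set (phi := fun p : R * R => st (U p) (V p)).
  destruct (curves_conformal g1 g2 c1 c2) as [cg dg]; fold g in cg, dg.
  assert (lattice_st : forall u, lattice (st s1 t1) (st s2 t2) u <->
    exists m n : Z, u = st (IZR m * s1 + IZR n * s2) (IZR m * t1 + IZR n * t2)).
  { intros u; split; intros [m [n h]]; exists m, n; rewrite h, !Lscal_st, Ladd_st; auto. }
  assert (gS : forall a, S3L (g a)) by (intros a; apply S3L_st; auto).
  exists s1, t1, s2, t2, S, T, g, psi, g1, g2, phi.
  split; [|split].
  - split; auto.
    + apply lin_indep_det; unfold det2; rewrite !fst_st, !snd_st; intros z; apply nD; lra.
    + apply (null_conformal psi1 psi2 (fun s => partial ax (fun p => psi1 (fst p)) (s, 0))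
        (fun s => partial ax (fun p => psi2 (fst p)) (s, 0))); auto; intros s.
      * exact (smooth_is _ ax (s, 0) sp1).
      * exact (smooth_is _ ax (s, 0) sp2).
    + intros a; rewrite Hinv_S3L, dg by auto; unfold g, psi.
      rewrite Hbar_st, Hmul_st, Lcos_st, Lsin_st, JK_plane_st, <- v1, <- v2; reflexivity.
    + intros s t; unfold g; now rewrite lp_st, lm_st.
    (* The common sign selects the alternative: 1 gives periodic curves. For -1, equality of the two
       powers in [par] is the parity condition on the lattice. *)
    + destruct hc1 as [-> | ->].
      * left; split; intros; [rewrite per1 | rewrite per2]; apply qs1.
      * right; split; [exact pw1 | split; [exact pw2|]].
        intros u hu; apply lattice_st in hu; destruct hu as (m & n & ->).
        destruct (par m n) as (k & l & -> & -> & ekl).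
        exists k, l; split; [auto | now apply powerRZ_opp1_eq].
    + intros a; apply theta2_range; unfold psi; rewrite snd_st.
      replace (2 * (/ 2 * (psi1 (lp a) - psi2 (lm a)))) with (psi1 (lp a) - psi2 (lm a)) by field.
      apply sg.
  - assert (phi_inj : forall p q, phi p = phi q -> p = q).
    { intros p q h; apply st_inj in h; destruct h as [h1 h2].
      rewrite <- (hl p), <- (hl q), h1, h2; reflexivity. }
    assert (phi_add : forall m n p, phi (Ladd p (Ladd (Lscal (IZR m) v) (Lscal (IZR n) w)))
      = Ladd (phi p) (st (IZR m * s1 + IZR n * s2) (IZR m * t1 + IZR n * t2))).
    { intros m n p; unfold phi; now rewrite LU, LV, Ladd_st. }
    assert (sub_iff : forall a b c : lorentz, Lsub b a = c <-> b = Ladd a c).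
    { intros [] [] []; unfold Lsub, Ladd, Lopp; cbn; split; intros h; injection h; intros; f_equal; lra. }
    split.
    + split.
      * split.
        -- replace (fun a => fst (phi a)) with (fun p => / 2 * (U p + V p))
             by (apply functional_extensionality; intros; symmetry; apply fst_st).
           smooth_tac.
        -- replace (fun a => snd (phi a)) with (fun p => / 2 * (U p - V p))
             by (apply functional_extensionality; intros; symmetry; apply snd_st).
           smooth_tac.
      * exists (fun a => (Phi1 (lp a, lm a), Phi2 (lp a, lm a))); split; [|split].
        -- split; [apply (smooth_comp2 Phi1 lp lm) | apply (smooth_comp2 Phi2 lp lm)];
             auto using smooth_lp_id, smooth_lm_id.
        -- intros p; unfold phi; rewrite lp_st, lm_st; apply hl.
        -- intros p; unfold phi; rewrite (f_equal fst (hr (lp p, lm p)) : U _ = _),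
             (f_equal snd (hr (lp p, lm p)) : V _ = _); apply st_lp_lm.
    + intros p q; rewrite lattice_st; split.
      * intros [m [n h]]; exists m, n; apply (proj2 (sub_iff _ _ _)); apply (proj1 (sub_iff _ _ _)) in h; rewrite h; apply phi_add.
      * intros [m [n h]]; exists m, n; apply (proj2 (sub_iff _ _ _)); apply (proj1 (sub_iff _ _ _)) in h.
        apply phi_inj; now rewrite phi_add.
  - intros p; rewrite dec; symmetry; apply torus_formula_st.
    unfold g, phi; now rewrite lp_st, lm_st.
Qed.

Theorem theorem4 :
  (forall (s1 t1 s2 t2 S T : R) (g : lorentz -> HL) (psi : lorentz -> lorentz)
      (g1 g2 : R -> quat R),
    torus_data s1 t1 s2 t2 S T g psi g1 g2 ->
    exists F : lorentz -> quat R,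
      (forall a, R4_HL (F a) = torus_formula g a) /\
      flat_torus_in_S3 (st s1 t1) (st s2 t2) F)
  /\
  (forall (v w : R * R) (F : R * R -> quat R),
    flat_torus_in_S3 v w F ->
    exists (s1 t1 s2 t2 S T : R) (g : lorentz -> HL) (psi : lorentz -> lorentz)
      (g1 g2 : R -> quat R) (phi : R * R -> lorentz),
      torus_data s1 t1 s2 t2 S T g psi g1 g2 /\
      torus_diffeo v w (st s1 t1) (st s2 t2) phi /\
      forall p, R4_HL (F p) = torus_formula g (phi p)).
Proof.
  split; [exact torus_data_flat | exact flat_torus_data].
Qed.
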